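(* Let $X\subseteq Z=Z_\Sigma$ be an explicit general arrangement variety. (i) Let $\sigma\in\Sigma$ be a big cone and $\gamma_0\preccurlyeq\gamma$ the corresponding $X$-face. Let $(\ast)$ denote the condition: every sequence $0\le i_1<\dots<i_{c+2}\le r$ admits $1\le q\le c+2$ and $1\le j\le n_{i_q}$ such that $v_{i_qj}\in\sigma$, $l_{i_qj}=1$ and $v_{i_qk}\notin\sigma$ for all $k\ne j$. Then the following statements are equivalent: (a) there is a smooth point of $X$ in the piece $X(\sigma)=X(\gamma_0)\subseteq X$; (b) the piece $X(\sigma)=X(\gamma_0)\subseteq X$ consists of smooth points of $X$; (c) the cone $\sigma$ is regular and $(\ast)$ holds; (d) $K=Q(\mathrm{lin}_{\mathbb{Q}}(\gamma_0)\cap\mathbb{Z}^{n+m})$ and $(\ast)$ holds. (ii) Let $\sigma\in\Sigma$ be a leaf cone and $\gamma_0\preccurlyeq\gamma$ the corresponding $X$-face. Then the following statements are equivalent: (a) there is a smooth point of $X$ in the piece $X(\sigma)=X(\gamma_0)\subseteq X$; (b) the piece $X(\sigma)=X(\gamma_0)\subseteq X$ consists of smooth points of $X$; (c) the cone $\sigma$ is regular; (d) $K=Q(\mathrm{lin}_{\mathbb{Q}}(\gamma_0)\cap\mathbb{Z}^{n+m})$.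
   Context: $\mathbb{K}$ is an algebraically closed field of characteristic zero; varieties are integral separated schemes of finite type over $\mathbb{K}$; points are closed points. $\mathbb{T}^n=(\mathbb{K}^* )^n$. Toric conventions. For a fan $\Sigma$ in $\mathbb{Z}^N$ with generator matrix $P$ (columns: the primitive generators of the rays), where the columns generate the rational vector space, Cox's quotient presentation $p\colon\hat Z\to Z_\Sigma$ is as follows: $\hat Z\subseteq\bar Z=\mathbb{K}^{M}$ ($M$ the number of rays) is the open toric subvariety defined by the fan of faces $\tau$ of the orthant $\mathbb{Q}^M_{\ge0}$ with $P(\tau)\subseteq\sigma$ for some $\sigma\in\Sigma$, and $p$ is the toric morphism defined by $P$, a good quotient by $H=\mathrm{Spec}\,\mathbb{K}[\mathbb{Z}^M/\mathrm{im}(P^* )]$, $P^*$ the transpose. For $\sigma\in\Sigma$, $z_\sigma\in Z_\Sigma$ is the distinguished point of the torus orbit corresponding to $\sigma$. A cone is regular if it is generated by part of a lattice basis. Explicit general arrangement varieties. Fix integers $r\ge c>0$, $n_0,\dots,n_r>0$, $m\ge0$, and put $n=n_0+\dots+n_r$. Let $A$ be a $(c+1)\times(r+1)$ matrix over $\mathbb{K}$ such that any $c+1$ of its columns $a_0,\dots,a_r$ are linearly independent. Let $l_i=(l_{i1},\dots,l_{in_i})$, $0\le i\le r$, be tuples of positive integers. Let $P_0$ be the integral $r\times(n+m)$ matrix with columns indexed by $ij$ ($0\le i\le r$, $1\le j\le n_i$) and $k$ ($1\le k\le m$): the column $0j$ is $-l_{0j}(e_1+\dots+e_r)$, the column $ij$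 with $i\ge1$ is $l_{ij}e_i$, the columns $k$ are zero. In $\mathbb{K}[T_{ij},S_k]$ put $T_i^{l_i}=T_{i1}^{l_{i1}}\cdots T_{in_i}^{l_{in_i}}$ and for $t=1,\dots,r-c$ let $g_t$ be the $(c+2)\times(c+2)$ determinant $g_t=\det\begin{bmatrix}a_0&\cdots&a_c&a_{c+t}\\ T_0^{l_0}&\cdots&T_c^{l_c}&T_{c+t}^{l_{c+t}}\end{bmatrix}$. Fix $1\le s\le n+m-r$ and an integral $s\times(n+m)$ matrix $d$ such that the columns $v_{ij},v_k$ of the stack matrix $P=\begin{bmatrix}P_0\\ d\end{bmatrix}$ are pairwise different, primitive and generate $\mathbb{Q}^{r+s}$. Let $K=\mathbb{Z}^{n+m}/\mathrm{im}(P^* )$ with projection $Q\colon\mathbb{Z}^{n+m}\to K$, and $R(A,P)=\mathbb{K}[T_{ij},S_k]/\langle g_1,\dots,g_{r-c}\rangle$ with the $K$-grading $\deg(T_{ij})=Q(e_{ij})$, $\deg(S_k)=Q(e_k)$. Let $\Sigma$ be any fan in $\mathbb{Z}^{r+s}$ whose rays are precisely those through the columns of $P$, $Z=Z_\Sigma$ with acting torus $\mathbb{T}_Z=\mathbb{T}^{r+s}$, $\bar X=V(g_1,\dots,g_{r-c})\subseteq\mathbb{K}^{n+m}$, $\hat X=\bar X\cap\hat Z$, $H=\mathrm{Spec}\,\mathbb{K}[K]$. Then $X=X(A,P,\Sigma)=\hat X/\!/H\subseteq Z$, with the effective complexity-$c$ action of $\mathbb{T}=\{1\}\times\mathbb{T}^s\subseteq\mathbb{T}^r\times\mathbb{T}^s=\mathbb{T}_Z$,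 is called an explicit general arrangement variety. One has $\mathrm{Cl}(X)=K$ and $\mathcal{R}(X)=R(A,P)$. Cones and pieces. Let $\gamma=\mathbb{Q}^{n+m}_{\ge0}$ with extremal ray generators $e_{ij},e_k$. For $\sigma\in\Sigma$ the corresponding face is $\gamma_0=\mathrm{cone}(e_{ij},e_k;\ v_{ij}\notin\sigma,\ v_k\notin\sigma)\preccurlyeq\gamma$, so that $P$ maps the complementary face $\gamma_0^*$ (generated by the remaining canonical basis vectors) onto $\sigma$. The piece is $X(\sigma)=X(\gamma_0)=X\cap\mathbb{T}_Z\cdot z_\sigma$; if it is non-empty, $\sigma$ is called an $X$-cone and $\gamma_0$ an $X$-face. A cone $\sigma\in\Sigma$ is big if for every $i=0,\dots,r$ it contains at least one column $v_{ij}$; it is a leaf cone if there is a set $I_\sigma=\{i_1,\dots,i_c\}$ of indices $0\le i_1<\dots<i_c\le r$ such that $v_{ij}\in\sigma$ implies $i\in I_\sigma$. (Big cones and leaf cones are $X$-cones.) $\mathrm{lin}_{\mathbb{Q}}$ denotes the $\mathbb{Q}$-linear hull. *)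

(* Defs.v *)
From HB Require Import structures.
From mathcomp Require Import all_boot all_order all_algebra.
From mathcomp Require Import boolp classical_sets cardinality.
From mathcomp Require Import mpoly.

Set Implicit Arguments.
Unset Strict Implicit.
Unset Printing Implicit Defensive.

Import Order.TTheory GRing.Theory Num.Theory.

Local Open Scope classical_set_scope.
Local Open Scope ring_scope.

Section Cones.
Variable V : lmodType rat.
Implicit Types (G A : set V).

Definition cone G : set V :=
  [set x | exists (k : nat) (a : 'I_k -> rat) (y : 'I_k -> V),
     (forall i, 0 <= a i /\ G (y i)) /\ x = \sum_i a i *: y i].

Definition linQ A : set V :=
  [set x | exists (k : nat) (a : 'I_k -> rat) (y : 'I_k -> V),
     (forall i, A (y i)) /\ x = \sum_i a i *: y i].

End Cones.

Definition dot (R : pzRingType) (N : nat) (u x : 'cV[R]_N) : R :=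
  \sum_i u i 0 * x i 0.

Definition toQ (N : nat) (u : 'cV[int]_N) : 'cV[rat]_N := map_mx intr u.

Section Fans.
Variable N : nat.
Implicit Types (sigma tau rho : set 'cV[rat]_N).

Definition polyhedral sigma : Prop := exists2 G, finite_set G & sigma = cone G.

Definition pointed_cone sigma : Prop :=
  forall x, sigma x -> sigma (- x) -> x = 0.

Definition face tau sigma : Prop :=
  exists u : 'cV[rat]_N, (forall x, sigma x -> 0 <= dot u x) /\
    tau = sigma `&` [set x | dot u x = 0].

Definition is_fan (Sigma : set (set 'cV[rat]_N)) : Prop :=
  [/\ finite_set Sigma,
      forall sigma, Sigma sigma -> polyhedral sigma /\ pointed_cone sigma,
      forall sigma tau, Sigma sigma -> face tau sigma -> Sigma tau
    & forall sigma tau, Sigma sigma -> Sigma tau ->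
        face (sigma `&` tau) sigma /\ face (sigma `&` tau) tau].

Definition ray (x : 'cV[rat]_N) : set 'cV[rat]_N := cone [set x].

Definition rays (Sigma : set (set 'cV[rat]_N)) : set (set 'cV[rat]_N) :=
  [set rho | Sigma rho /\ exists2 x, x <> 0 & rho = ray x].

Definition regular_cone sigma : Prop :=
  exists (B : 'M[int]_N) (J : {set 'I_N}),
    B \in unitmx /\ sigma = cone [set toQ (col j B) | j in [set` J]].

(* The sets of lattice points (characters) in sigma^vee and sigma^perp. *)
Definition dual_chars sigma : set 'cV[int]_N :=
  [set u | forall x, sigma x -> 0 <= dot (toQ u) x].

Definition perp_chars sigma : set 'cV[int]_N :=
  [set u | forall x, sigma x -> dot (toQ u) x = 0].

Definition primitive_vec (x : 'cV[int]_N) : Prop :=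
  x <> 0 /\ forall (k : int) (y : 'cV[int]_N), x = k *: y -> `|k| = 1.

End Fans.

(* An affine variety over an algebraically closed field, given by its set T of
   closed points and its coordinate ring A, a K-algebra of functions on T. *)
Section AffineVarieties.
Variables (K : fieldType) (T : Type) (A : set (T -> K)).

Definition max_ideal (x : T) : set (T -> K) := [set f | A f /\ f x = 0].

Definition max_ideal2 (x : T) : set (T -> K) :=
  [set h | exists (k : nat) (f g : 'I_k -> T -> K),
     (forall i, max_ideal x (f i) /\ max_ideal x (g i)) /\
     h = fun y => \sum_i f i y * g i y].

(* d is the K-dimension of m/m^2 (the Zariski cotangent space at x): the
   classes of some b_1, ..., b_d in m form a K-basis of m/m^2. *)
Definition cotangent_dim (x : T) (d : nat) : Prop :=
  exists b : 'I_d -> T -> K, (forall i, max_ideal x (b i)) /\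
    forall f, max_ideal x f ->
      exists! a : 'rV[K]_d,
        max_ideal2 x (fun y => f y - \sum_i a 0 i * b i y).

Definition alg_independent (d : nat) (f : 'I_d -> T -> K) : Prop :=
  forall q : {mpoly K[d]}, (forall y, q.@[fun i => f i y] = 0) -> q = 0.

(* For A integral this is the transcendence degree over K of the function
   field Frac(A), that is, the dimension of the variety. *)
Definition variety_dim (d : nat) : Prop :=
  (exists f : 'I_d -> T -> K, (forall i, A (f i)) /\ alg_independent f) /\
  (forall (e : nat) (f : 'I_e -> T -> K),
     (forall i, A (f i)) -> alg_independent f -> (e <= d)%N).

Definition smooth_point (x : T) : Prop :=
  exists2 d, cotangent_dim x d & variety_dim d.

End AffineVarieties.

(* A closed point of Z_Sigma lying in the orbit of sigma is a monoid
   homomorphism from the characters in sigma^vee to K; it is recorded as the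
   cone sigma together with this homomorphism, extended by zero to all
   characters.  For u in tau^vee, where sigma is a face of tau,
   pchar_at x u is the value at x of the regular function chi^u on Z_tau. *)
Record toric_point (K : fieldType) (N : nat) := ToricPoint {
  pcone : set 'cV[rat]_N;
  pchar_at : 'cV[int]_N -> K }.

Section Toric.
Variables (K : fieldType) (N : nat).
Implicit Types (sigma tau : set 'cV[rat]_N).

Definition distinguished_point sigma : toric_point K N :=
  ToricPoint sigma (fun u => if u \in perp_chars sigma then 1 else 0).

Definition torus_act (t : 'I_N -> K) (x : toric_point K N) : toric_point K N :=
  ToricPoint (pcone x) (fun u => (\prod_i t i ^ u i 0) * pchar_at x u).

Definition torus_orbit (x : toric_point K N) : set (toric_point K N) :=
  [set torus_act t x | t in [set t : 'I_N -> K | forall i, t i != 0]].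

(* For a subvariety Y of a toric variety: the closed points of Y cap Z_sigma,
   where Z_sigma is the union of the orbits of the faces of sigma, and the
   restrictions to them of the elements of K[Z_sigma]. *)
Definition affine_chart (Y : set (toric_point K N)) sigma :
    set (toric_point K N) :=
  Y `&` [set x | face (pcone x) sigma].

Definition chart_ring (Y : set (toric_point K N)) sigma :
    set (affine_chart Y sigma -> K) :=
  [set f | exists (k : nat) (a : 'I_k -> K) (u : 'I_k -> 'cV[int]_N),
     (forall i, dual_chars sigma (u i)) /\
     f = fun y => \sum_i a i * pchar_at (val y) (u i)].

(* Smoothness is local; pcone x is the cone of the smallest toric chart
   containing x. *)
Definition smooth_at (Y : set (toric_point K N)) (x : toric_point K N) : Prop :=
  exists2 y : affine_chart Y (pcone x),
    val y = x & smooth_point (chart_ring (Y := Y) (sigma := pcone x)) y.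

(* Cox's quotient presentation; I indexes the rays, v lists the columns of P.
   Affine space K^M is the type I -> K. *)
Variables (I : finType) (v : I -> 'cV[int]_N) (Sigma : set (set 'cV[rat]_N)).

(* The cones of Sigma containing P(tau), for tau = cone(e_i ; z_i = 0), the
   face of the orthant whose orbit contains z. *)
Definition cones_over (z : I -> K) : set (set 'cV[rat]_N) :=
  [set sigma | Sigma sigma /\ forall i, z i = 0 -> sigma (toQ (v i))].

Definition hatZ : set (I -> K) :=
  [set z | exists sigma, cones_over z sigma].

(* p maps z to the orbit of the smallest cone containing P(tau), with
   chi^u(p(z)) = z^(P^* u) for u in the dual of that cone; 0 ^ 0 = 1, and the
   exponent of a vanishing coordinate is then nonnegative. *)
Definition cox_map (z : I -> K) : toric_point K N :=
  let sigma := \bigcap_(s in cones_over z) s in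
  ToricPoint sigma
    (fun u => if u \in dual_chars sigma then \prod_i z i ^ dot u (v i) else 0).

End Toric.

Section ClassGroup.
Variables (N : nat) (I : finType) (v : I -> 'cV[int]_N).

Definition im_Pdual : {pred {ffun I -> int}} :=
  fun w => `[< exists u : 'cV[int]_N, w = [ffun i => dot u (v i)] >].

Fact im_Pdual_zmod_closed : zmod_closed im_Pdual.
Proof.
split=> [|_ _ /asboolP[u ->] /asboolP[w ->]]; apply/asboolP.
  by exists 0; apply/ffunP=> i; rewrite !ffunE /dot big1 // => j _; rewrite mxE mul0r.
exists (u - w); apply/ffunP=> i; rewrite !ffunE /dot -sumrB.
by apply: eq_bigr => j _; rewrite !mxE mulrBl.
Qed.

HB.instance Definition _ :=
  GRing.isZmodClosed.Build {ffun I -> int} im_Pdual im_Pdual_zmod_closed.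

Definition ClK : zmodType := {ideal_quot im_Pdual}.

Definition Qproj (w : {ffun I -> int}) : ClK := (\pi_({ideal_quot im_Pdual}) w)%qT.

Definition basis_vec (i : I) : {ffun I -> rat^o} := [ffun k => (k == i)%:R].

Definition gamma_face (sigma : set 'cV[rat]_N) : set {ffun I -> rat^o} :=
  cone [set basis_vec i | i in [set i | ~ sigma (toQ (v i))]].

Definition lin_lattice (F : set {ffun I -> rat^o}) : set {ffun I -> int} :=
  [set w | linQ F [ffun i => (w i)%:~R]].

End ClassGroup.

(* inl (existT _ i j) stands for the index ij and inr k for the index k;
   the number n_i of indices ij is n i. *)
Definition col_index (r : nat) (n : 'I_r.+1 -> nat) (m : nat) : finType :=
  ({i : 'I_r.+1 & 'I_(n i)} + 'I_m)%type.

Definition idx_ij (r : nat) (n : 'I_r.+1 -> nat) (m : nat) (i : 'I_r.+1)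
    (j : 'I_(n i)) : col_index n m :=
  inl (existT (fun i => 'I_(n i)) i j).

Section ArrangementVarieties.
Variables (K : fieldType) (c r : nat) (n : 'I_r.+1 -> nat) (m s : nat).
Variables (A : 'M[K]_(c.+1, r.+1)) (l : forall i : 'I_r.+1, 'I_(n i) -> nat).
Variable (d : col_index n m -> 'cV[int]_s).

(* The vector e_i of Z^r, for 1 <= i <= r, has row index i - 1. *)
Definition P0_col (a : col_index n m) : 'cV[int]_r :=
  match a with
  | inl (existT i j) =>
      \col_k (if i == ord0 then - (l j)%:Z
              else if i == lift ord0 k then (l j)%:Z else 0)
  | inr _ => 0
  end.

Definition P_col (a : col_index n m) : 'cV[int]_(r + s) :=
  col_mx (P0_col a) (d a).

Definition monom_T (z : col_index n m -> K) (i : 'I_r.+1) : K :=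
  \prod_(j < n i) z (idx_ij m j) ^+ l j.

(* g_t(z), for 1 <= t <= r - c: the columns 0, ..., c and c + t of A with the
   row of the T_i^{l_i} added at the bottom. *)
Definition g_eval (t : nat) (z : col_index n m -> K) : K :=
  \det (colsub (fun k : 'I_(c.+1 + 1) => inord (if k <= c then k : nat else c + t)%N)
          (col_mx A (\row_i monom_T z i))).

Definition barX : set (col_index n m -> K) :=
  [set z | forall t, (0 < t <= r - c)%N -> g_eval t z = 0].

Variable Sigma : set (set 'cV[rat]_(r + s)).

Definition hatX : set (col_index n m -> K) := barX `&` hatZ P_col Sigma.

(* X = hatX // H, as the closed subvariety p(hatX) of Z. *)
Definition X_var : set (toric_point K (r + s)) := cox_map P_col Sigma @` hatX.

Definition piece (sigma : set 'cV[rat]_(r + s)) : set (toric_point K (r + s)) :=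
  X_var `&` torus_orbit (distinguished_point K sigma).

Definition v_ij (i : 'I_r.+1) (j : 'I_(n i)) : 'cV[rat]_(r + s) :=
  toQ (P_col (idx_ij m j)).

Definition big_cone (sigma : set 'cV[rat]_(r + s)) : Prop :=
  forall i : 'I_r.+1, exists j : 'I_(n i), sigma (v_ij j).

Definition leaf_cone (sigma : set 'cV[rat]_(r + s)) : Prop :=
  exists J : {set 'I_r.+1}, #|J| = c /\
    forall (i : 'I_r.+1) (j : 'I_(n i)), sigma (v_ij j) -> i \in J.

Definition star_condition (sigma : set 'cV[rat]_(r + s)) : Prop :=
  forall iota : 'I_c.+2 -> 'I_r.+1,
    (forall a b : 'I_c.+2, (a < b)%N -> (iota a < iota b)%N) ->
    exists (q : 'I_c.+2) (j : 'I_(n (iota q))),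
      [/\ sigma (v_ij j), l j = 1%N & forall k, k != j -> ~ sigma (v_ij k)].

(* K = Q(lin_Q(gamma_0) cap Z^(n+m)), gamma_0 the face corresponding to sigma *)
Definition Q_full (sigma : set 'cV[rat]_(r + s)) : Prop :=
  [set: ClK P_col] = Qproj P_col @` lin_lattice (gamma_face P_col sigma).

Definition explicit_gav : Prop :=
  [/\ (0 < c <= r)%N,
      forall i, (0 < n i)%N,
      (forall f : 'I_c.+1 -> 'I_r.+1, injective f -> \rank (colsub f A) = c.+1)
    & forall (i : 'I_r.+1) (j : 'I_(n i)), (0 < l j)%N] /\
  [/\ (1 <= s <= ((\sum_i n i) + m) - r)%N,
      injective P_col,
      forall a, primitive_vec (P_col a),
      linQ [set toQ (P_col a) | a in [set: col_index n m]] = [set: 'cV[rat]_(r + s)]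
    & is_fan Sigma /\ rays Sigma = [set ray (toQ (P_col a)) | a in [set: col_index n m]]].

End ArrangementVarieties.

(* Main.v *)
(* The chart of X at sigma has a coordinate ring spanned by the characters in sigma^vee, all
   relations between them being generated by the linear relations between the rows
   T_0^{l_0}, ..., T_r^{l_r}. At a point x of the piece all characters vanish that are not
   units. If x is smooth, a basis of the units together with finitely many characters h_i,
   chosen so as to be independent modulo m_x^2, generate all characters (up to degree), and
   by dimension they are algebraically independent. So each h_i is a prime element, and
   comparing orders of vanishing along the divisors of the rays of sigma shows that h_i has
   order one along one of them and order zero along the others: the h_i are dual to rays of
   sigma. In the leaf case every ray is reached, so sigma is regular. In the big case a ray
   can only be missed if it is the only ray of sigma in its row and has l = 1; the rows
   containing no such ray consist of monomials in the independent h_i and satisfy no linear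
   relation, so there are at most c + 1 of them.
   Conversely, a dual basis for the rays of sigma and the linear relations allow to eliminate
   coordinates until the chart becomes a principal open subset of an affine space. *)
Require Import Defs.
From HB Require Import structures.
From mathcomp Require Import all_boot all_order all_algebra.
From mathcomp Require Import boolp classical_sets cardinality.
From mathcomp Require Import mpoly ring lra zify.

Set Implicit Arguments.
Unset Strict Implicit.
Unset Printing Implicit Defensive.

Import Order.TTheory GRing.Theory Num.Theory.

Local Open Scope classical_set_scope.
Local Open Scope ring_scope.

(** * Laurent polynomials and algebraic relations *)

(** Generators modulo m_x^2 generate a priori only the local ring. They generate all characters
    because the chart carries a grading with nonnegative weights in which the characters of weight
    zero are exactly the units: Nakayama's lemma becomes an induction on the weight. The obstacle is
    that m_x is not homogeneous, since the units do not vanish at x. Homogeneous components are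
    therefore taken up to units, and the unit factor is evaluated at x. Over a big cone the degree
    is the projection of a character to Z^s, for which the row relations are homogeneous. Over a
    leaf cone the degree is the character itself, on a sublattice of characters that are linearly
    independent as functions; the rows left out reappear only as denominators without zeros.
    Elements of m_x^2 are handled as formal sums of characters, to which functionals compatible with
    all relations are applied. Transcendence degrees are compared by counting monomials in boxes. *)

(** Euclid's argument: a root of one plus the product of the linear factors of [p * 'X] is no root
    of [p * 'X], hence neither zero nor a root of [p]. *)
Lemma closed_field_nonroot (K : closedFieldType) (p : {poly K}) :
  p != 0 -> exists2 x, x != 0 & p.[x] != 0.
Proof.
move=> p0.
have [s [Es _]] : exists s : seq K, p * 'X = lead_coef (p * 'X) *: \prod_(a <- s) ('X - a%:P) /\ True.
  by have [s Es] := closed_field_poly_normal (p * 'X); exists s.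
have q0 : p * 'X != 0 by rewrite mulf_neq0 ?polyX_eq0.
have /closed_rootP[x xr] : size (\prod_(a <- s) ('X - a%:P) + 1 : {poly K}) != 1.
  case: s Es => [|b s] Es.
    move/(congr1 (fun q : {poly K} => q.[0])): (Es).
    rewrite big_nil !hornerE => /esym/eqP.
    rewrite ?mulr1 lead_coef_eq0 (negbTE q0) //.
  by rewrite size_polyDl ?size_prod_XsubC // size_poly1.
exists x; rewrite -?negb_or; last first.
  apply: contraL xr => /eqP px; have : (p * 'X).[x] = 0 by rewrite hornerM px mul0r.
  rewrite Es hornerE /root => /eqP; rewrite mulf_eq0 lead_coef_eq0 (negbTE q0) /= => /eqP s0.
  by rewrite hornerD s0 !hornerE oner_eq0.
apply: contraL xr => /eqP ->.
have : (p * 'X).[0] = 0 by rewrite hornerM hornerX mulr0.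
rewrite Es hornerE /root => /eqP; rewrite mulf_eq0 lead_coef_eq0 (negbTE q0) /= => /eqP s0.
by rewrite hornerD s0 !hornerE oner_eq0.
Qed.

Lemma int_poly_nonroot (p : {poly int}) :
  p != 0 -> exists2 x : int, 0 < x & p.[x] != 0.
Proof.
move=> p0; apply: contrapT => H.
suff : (size [seq (i.+1)%:Z | i <- iota 0 (size p)] < size p)%N.
  by rewrite size_map size_iota ltnn.
apply: max_poly_roots => //; last by rewrite map_inj_uniq ?iota_uniq // => a b [].
apply/allP=> _ /mapP[i _ ->]; apply: contrapT => /negP ri.
by apply: H; exists (i.+1)%:Z.
Qed.

(** The weights are the powers of one positive integer [x]. Two vectors get the same value only if
    [x] is a root of the polynomial whose coefficients are the entries of their difference, and some
    positive integer is a root of none of these finitely many nonzero polynomials. *)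
Lemma separating_weight (N : nat) (s : seq 'cV[int]_N) :
  exists lam : 'cV[int]_N, (forall i, 0 < lam i 0) /\
    {in s &, injective (fun u => dot lam u)}.
Proof.
pose P (v : 'cV[int]_N) : {poly int} := \poly_(k < N) (if insub k is Some i then v i 0 else 0).
have PE (v : 'cV[int]_N) (x : int) : (P v).[x] = \sum_i v i 0 * x ^+ i.
  rewrite horner_poly; apply: eq_bigr => i _; rewrite valK //.
have P0 v : P v = 0 -> v = 0.
  move=> Pv; apply/colP => i; move/(congr1 (fun q : {poly int} => q`_i)): Pv.
  by rewrite coef_poly ltn_ord valK coef0 mxE.
have [x x0 xr] : exists2 x : int, 0 < x &
    (\prod_(u <- s) \prod_(w <- s | u != w) P (u - w)).[x] != 0.
  apply: int_poly_nonroot; rewrite prodf_seq_neq0; apply/allP => u _ /=.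
  rewrite prodf_seq_neq0; apply/allP => w _ /=; apply/implyP => uw.
  by apply: contra_neq uw => /P0/eqP; rewrite subr_eq0 => /eqP.
exists (\col_i x ^+ i); split=> [i|u w us ws]; first by rewrite mxE exprn_gt0.
move=> E; apply/eqP; apply: contraT => uw; move: xr.
rewrite horner_prod prodf_seq_neq0 => /allP/(_ u us) /=.
rewrite horner_prod prodf_seq_neq0 => /allP/(_ w ws) /=; rewrite uw PE /=.
suff -> : \sum_i (u - w) i 0 * x ^+ i = 0 by rewrite eqxx.
transitivity (dot (\col_i x ^+ i) u - dot (\col_i x ^+ i) w); last by rewrite E subrr.
by rewrite /dot -sumrB; apply: eq_bigr => i _; rewrite !mxE; ring.
Qed.

(** This is how one-parameter families of points are exploited: the polynomial [g] collects the
    parameters at which the family leaves the torus. *)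
Lemma laurent_vanish (K : closedFieldType) (I : Type) (s : seq I) (c : I -> K)
    (e : I -> int) (g : {poly K}) : g != 0 ->
  (forall x, x != 0 -> g.[x] != 0 -> \sum_(i <- s) c i * x ^ e i = 0) ->
  forall n : int, \sum_(i <- s | e i == n) c i = 0.
Proof.
move=> g0 H n.
(* Multiplying by the [N]-th power of the variable clears all negative exponents. *)
have [N HN] : exists N : nat, forall i, List.In i s -> 0 <= e i + N%:Z.
  elim: s {H} => [|a s [N HN]]; first by exists 0%N.
  exists (N + `|e a|)%N => i /= [<-|/HN]; lia.
case: (boolP (0 <= n + N%:Z)) => [nN|nN]; last first.
  elim: s HN {H} => [|a s IH] HN; first by rewrite big_nil.
  rewrite big_cons; case: eqP => [E|_]; last by apply: IH => i si; apply: HN; right.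
  by have := HN a (or_introl erefl); rewrite E (negbTE nN).
pose P : {poly K} := \sum_(i <- s) c i *: 'X^(`|e i + N%:Z|).
have PE x : x != 0 -> P.[x] = x ^+ N * \sum_(i <- s) c i * x ^ e i.
  move=> x0; rewrite horner_sum mulr_sumr.
  elim: s HN {H P} => [|a s IH] HN; first by rewrite !big_nil.
  rewrite !big_cons IH; last by move=> i si; apply: HN; right.
  congr (_ + _); rewrite hornerZ hornerXn.
  have h : 0 <= e a + N%:Z by apply: HN; left.
  rewrite exprnP (gez0_abs h) expfzDr // exprnP; ring.
have P0 : P = 0.
  apply/eqP; apply: contraT => Pn0.
  have [x x0] := closed_field_nonroot (mulf_neq0 Pn0 g0).
  by rewrite hornerM mulf_eq0 negb_or => /andP[] /[swap] gx; rewrite PE // H // mulr0 eqxx.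
move/(congr1 (fun q : {poly K} => q`_`|n + N%:Z|)): P0; rewrite coef0 coef_sum => h0; apply: etrans h0.
elim: s HN {H P PE} => [|a s IH] HN; first by rewrite !big_nil.
rewrite !big_cons IH; last by move=> i si; apply: HN; right.
have h : 0 <= e a + N%:Z by apply: HN; left.
rewrite coefZ coefXn; case: eqP => [->|ne]; first by rewrite eqxx mulr1.
rewrite (_ : (_ == _) = false); last first.
  apply/negbTE/eqP => E; apply: ne; apply: (addIr N%:Z).
  by rewrite -(gez0_abs h) -(gez0_abs nN) E.
by rewrite mulr0 add0r.
Qed.

(** Restrict [P] to a curve [x ^ lam] whose exponents separate the monomials of [P]: vanishing along
    it would kill each coefficient. *)
Lemma mpoly_nonvanish (K : closedFieldType) (d : nat) (P : {mpoly K[d]}) :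
  P != 0 -> exists2 v : 'I_d -> K, (forall i, v i != 0) & P.@[v] != 0.
Proof.
move=> P0.
pose col (m : 'X_{1..d}) : 'cV[int]_d := \col_i (m i)%:Z.
have [lam [lam0 inj]] := separating_weight (map col (msupp P)).
apply: contrapT => H; move/negP: P0; apply.
rewrite -msupp_eq0; case E: (msupp P) => [//|m0 s'].
have m0s : m0 \in msupp P by rewrite E mem_head.
have colI : injective col.
  by move=> m m' /colP h; apply/mnmP => i; have := h i; rewrite !mxE => -[].
have : \sum_(m <- msupp P | dot lam (col m) == dot lam (col m0)) P@_m = 0.
  apply: (laurent_vanish (g := 1)); first exact: oner_neq0.
  move=> x x0 _; apply: contrapT => /eqP ne; apply: H; exists (fun i => x ^ lam i 0).
    by move=> i; rewrite expfz_neq0.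
  move: ne; rewrite mevalE; congr (_ != 0); apply: eq_bigr => m _; congr (_ * _).
  rewrite /dot; elim/big_rec2: _ => [|i a b _ <-]; first by rewrite expr0z.
  by rewrite expfzDr // mxE -exprz_exp.
rewrite big_seq_cond (eq_bigl (fun m => (m \in msupp P) && (m == m0))).
  rewrite -big_seq_cond -big_filter filter_pred1_uniq ?msupp_uniq // big_seq1 => /eqP.
  by rewrite mcoeff_eq0 m0s.
move=> m; case: (boolP (m \in _)) => //= ms; apply/eqP/eqP => [h|-> //].
by apply: colI; apply: inj; rewrite ?map_f.
Qed.

Lemma nontrivial_relation (K : fieldType) (I J : finType) (M : I -> J -> K) :
  (#|J| < #|I|)%N ->
  exists2 w : I -> K, (exists i, w i != 0) & forall j, \sum_i w i * M i j = 0.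
Proof.
move=> lt; pose B : 'M[K]_(#|I|, #|J|) := \matrix_(i, j) M (enum_val i) (enum_val j).
have : kermx B != 0.
  rewrite kermx_eq0 /row_free; apply: contraTneq lt => rk.
  by rewrite -leqNgt -rk rank_leq_col.
case/rowV0Pn=> v /sub_kermxP vB v0.
exists (fun i => v 0 (enum_rank i)).
  apply: contrapT => H; case/eqP: v0; apply/rowP => k; rewrite mxE.
  apply: contrapT => /eqP vk; apply: H; exists (enum_val k); by rewrite enum_valK.
move=> j; move/rowP/(_ (enum_rank j)): vB; rewrite !mxE => vB; apply: etrans vB.
rewrite (reindex (@enum_val I I)) /=; last exact: onW_bij (enum_val_bij I).
by apply: eq_bigr => k _; rewrite !mxE enum_valK enum_rankK.
Qed.

Section Counting.
Variables (K : fieldType) (p : nat).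
Implicit Types P Q : {mpoly K[p]}.

(** Exponents are bounded variable by variable and not in total degree, so that the admissible
    monomials fill a box and are counted by a power. *)
Definition exp_bound (n : nat) P := forall m, m \in msupp P -> forall i, (m i <= n)%N.

Lemma exp_boundM a b P Q : exp_bound a P -> exp_bound b Q -> exp_bound (a + b) (P * Q).
Proof.
move=> hP hQ m /msuppM_le /allpairsP[[m1 m2] /= [h1 h2 ->]] i.
by rewrite mnmDE leq_add ?hP ?hQ.
Qed.

Lemma exp_bound_leq a b P : (a <= b)%N -> exp_bound a P -> exp_bound b P.
Proof. by move=> ab h m mP i; apply: leq_trans (h _ mP i) ab. Qed.

Lemma exp_bound1 a : exp_bound a 1.
Proof. by move=> m; rewrite msupp1 inE => /eqP -> i; rewrite mnm0E. Qed.

Lemma exp_bound_exp a k P : exp_bound a P -> exp_bound (a * k) (P ^+ k).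
Proof.
move=> h; elim: k => [|k IH]; first by rewrite expr0; apply: exp_bound1.
by rewrite exprS mulnS; apply: exp_boundM.
Qed.

Lemma exp_bound_sum (I : Type) (s : seq I) a (F : I -> {mpoly K[p]}) :
  (forall i, exp_bound a (F i)) -> exp_bound a (\sum_(i <- s) F i).
Proof.
move=> h; elim: s => [|i s IH]; first by rewrite big_nil => m; rewrite msupp0.
rewrite big_cons => m /msuppD_le; rewrite mem_cat => /orP[/h//|/IH//].
Qed.

Lemma exp_boundZ a c P : exp_bound a P -> exp_bound a (c *: P).
Proof. by move=> h m /msuppZ_le /h. Qed.

Lemma exp_bound_exists P : exists a, exp_bound a P.
Proof.
exists (msize P) => m mP i; apply: ltnW; apply: leq_ltn_trans (msize_mdeg_lt mP).
by rewrite mdegE (bigD1 i) //= leq_addr.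
Qed.

Definition mono n (a : {ffun 'I_p -> 'I_n}) : 'X_{1..p} := [multinom (a i : nat) | i < p].

Lemma mono_inj n : injective (@mono n).
Proof.
by move=> a b /mnmP h; apply/ffunP => i; apply: val_inj; have := h i; rewrite !mnmE.
Qed.

Definition box_poly n (w : {ffun 'I_p -> 'I_n} -> K) : {mpoly K[p]} :=
  \sum_a w a *: 'X_[mono a].

Lemma box_polyE n w a : (@box_poly n w)@_(mono a) = w a.
Proof.
rewrite raddf_sum (bigD1 a) //= big1 => [|b ba]; rewrite mcoeffZ mcoeffX.
  by rewrite eqxx mulr1 addr0.
by rewrite (inj_eq (@mono_inj n)) (negbTE ba) mulr0.
Qed.

Lemma box_poly_bound n w : exp_bound n (@box_poly n.+1 w).
Proof.
apply: exp_bound_sum => a; apply: exp_boundZ => m.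
rewrite msuppX inE => /eqP -> i; rewrite mnmE; exact: leq_ord.
Qed.

Lemma box_eq0 n P : exp_bound n P ->
  (forall a : {ffun 'I_p -> 'I_n.+1}, P@_(mono a) = 0) -> P = 0.
Proof.
move=> h H; apply/mpolyP => m; rewrite mcoeff0.
case: (boolP (m \in msupp P)) => [mP|]; last exact: memN_msupp_eq0.
rewrite -(H [ffun i => inord (m i)]); congr (_@__); apply/mnmP => i.
by rewrite mnmE ffunE inordK // ltnS h.
Qed.

End Counting.

(** A discrete mean value inequality: widening a box by a constant costs one order of growth less
    than its volume. *)
Lemma expn_add_gap (n e p : nat) :
  ((n + e) ^ p.+1 <= n ^ p.+1 + e * p.+1 * (n + e) ^ p)%N.
Proof.
elim: p => [|p IH]; first by rewrite !expn1 expn0; lia.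
rewrite expnS (expnS n) (expnS (n + e) p).
have h : (n ^ p.+1 <= (n + e) ^ p.+1)%N by rewrite leq_exp2r // leq_addr.
move: IH h; rewrite expnS; set X := ((n + e) ^ p)%N; set Y := (n ^ p.+1)%N => *; nia.
Qed.

(* The k^p monomials of multidegree below k in the f_i and the (a k + 1)^p monomial
   multiples of the relation R live in a space of dimension (a k + 1 + e)^p. *)
Lemma box_count (a e p : nat) : exists k, ((a * k + 1 + e) ^ p < k ^ p + (a * k + 1) ^ p)%N.
Proof.
case: p => [|p]; first by exists 0%N; rewrite !expn0.
(* The gap is at most [e * p.+1 * (a + 1 + e) ^ p * k ^ p], so it is beaten by [k ^ p.+1] as soon as
   [k] exceeds the constant factor. *)
pose k := (e * p.+1 * (a + 1 + e) ^ p).+1; exists k.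
apply: leq_ltn_trans (expn_add_gap _ _ _) _; rewrite addnC ltn_add2r.
have : ((a * k + 1 + e) ^ p <= (k * (a + 1 + e)) ^ p)%N.
  have : (a * k + 1 + e <= k * (a + 1 + e))%N by rewrite /k; nia.
  by case: p @k => [|p] k ?; rewrite ?expn0 // leq_exp2r.
rewrite expnMn expnS => h.
apply: leq_ltn_trans (leq_mul (leqnn _) h) _.
by rewrite mulnCA mulnC ltn_pmul2r ?expn_gt0.
Qed.

(** By counting, the products [Phi b] and the monomial multiples of [R] are linearly dependent.
    Evaluated along [y], the multiples of [R] disappear and a polynomial relation between the [f i]
    remains. If it were trivial, a nonzero multiple of [R] would vanish. *)
Lemma algebraic_relation (K : fieldType) (T : Type) (p : nat) (y f : 'I_p -> T -> K)
    (Q R : {mpoly K[p]}) (P : 'I_p -> {mpoly K[p]}) : R != 0 ->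
  (forall t, R.@[fun i => y i t] = 0) -> (forall t, Q.@[fun i => y i t] != 0) ->
  (forall i t, Q.@[fun i => y i t] * f i t = (P i).@[fun i => y i t]) ->
  ~ alg_independent f.
Proof.
move=> R0 Ry Qy QP indep.
have [e eR] := exp_bound_exists R.
have [D [DQ DP]] : exists D, exp_bound D Q /\ forall i, exp_bound D (P i).
  have [D0 hD0] := exp_bound_exists Q.
  have [D1 hD1] := choice (fun i => exp_bound_exists (P i)).
  exists (D0 + \sum_i D1 i)%N; split; first by apply: exp_bound_leq hD0; rewrite leq_addr.
  move=> i; apply: exp_bound_leq (hD1 i); rewrite (bigD1 i) //=; lia.
have [k hk] := box_count (D * p) e p.
(* The power of [Q] brings all monomials in the fractions [P i / Q] to the common denominator
   [Q ^+ (k * p)]. *)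
pose Phi (b : {ffun 'I_p -> 'I_k}) := Q ^+ (k * p - \sum_i b i) * \prod_i P i ^+ b i.
have sb (b : {ffun 'I_p -> 'I_k}) : (\sum_i b i <= k * p)%N.
  rewrite (leq_trans (leq_sum _ (fun i _ => ltnW (ltn_ord (b i))))) //.
  by rewrite sum_nat_const card_ord mulnC.
have PhiB b : exp_bound (D * p * k) (Phi b).
  have : exp_bound (D * (k * p - \sum_i b i) + D * \sum_i b i) (Phi b).
    apply: exp_boundM; first exact: exp_bound_exp.
    rewrite big_distrr /=; elim/big_rec2: _ => [|i a c _ h]; first exact: exp_bound1.
    by apply: exp_boundM => //; apply: exp_bound_exp.
  by apply: exp_bound_leq; rewrite -mulnDr subnK // -mulnA (mulnC p).
pose n := (D * p * k + e)%N.
pose M (x : {ffun 'I_p -> 'I_k} + {ffun 'I_p -> 'I_(D * p * k).+1})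
       (a : {ffun 'I_p -> 'I_n.+1}) : K :=
  match x with inl b => (Phi b)@_(mono a) | inr c => (R * 'X_[mono c])@_(mono a) end.
have [|w [x0 wx0] wM] := nontrivial_relation M.
  rewrite card_sum !card_ffun !card_ord /n; move: hk.
  by rewrite !addn1 addSn addnC [X in (_ < X)%N]addnC.
pose q := box_poly (fun b => w (inl b)); pose g := box_poly (fun c => w (inr c)).
have E : \sum_b w (inl b) *: Phi b + R * g = 0.
  apply: (@box_eq0 _ _ n).
    move=> m /msuppD_le; rewrite mem_cat => /orP[|]; move: m; last first.
      by rewrite /n addnC; apply: exp_boundM => //; apply: box_poly_bound.
    by apply: exp_bound_sum => b; apply: exp_boundZ; apply: exp_bound_leq (PhiB b); rewrite leq_addr.
  move=> a; rewrite -[RHS](wM a) big_sumType /= mcoeffD; congr (_ + _).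
    by rewrite raddf_sum /=; apply: eq_bigr => b _; rewrite mcoeffZ.
  rewrite mulr_sumr raddf_sum /=; apply: eq_bigr => c _; by rewrite -scalerAr mcoeffZ.
have q0 : q = 0.
  apply: indep => t; apply: (mulfI (expf_neq0 (k * p) (Qy t))); rewrite mulr0.
  have /(congr1 (meval (fun i => y i t))) := E.
  rewrite mevalD mevalM Ry mul0r addr0 meval0 => h; apply: etrans h.
  rewrite !raddf_sum /= mulr_sumr; apply: eq_bigr => b _.
  rewrite !mevalZ mulrCA; congr (_ * _).
  rewrite mevalX mevalM -[in LHS](subnK (sb b)) exprD -mulrA; congr (_ * _).
    by rewrite rmorphXn.
  rewrite rmorph_prod /= -prodrXr -big_split /=; apply: eq_bigr => i _.
  by rewrite mnmE rmorphXn /= -QP exprMn.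
have w0 b : w (inl b) = 0 by rewrite -[LHS](box_polyE (fun b => w (inl b))) -/q q0 mcoeff0.
have /eqP : R * g = 0.
  by rewrite -[RHS]E big1 ?add0r // => b _; rewrite w0 scale0r.
rewrite mulf_eq0 (negbTE R0) /= => /eqP g0.
have w1 c : w (inr c) = 0 by rewrite -[LHS](box_polyE (fun c => w (inr c))) -/g g0 mcoeff0.
by case: x0 wx0 => b; rewrite ?w0 ?w1 eqxx.
Qed.

(** * Smooth points *)

Lemma meval_sum (K : comNzRingType) (d : nat) (v : 'I_d -> K) (I : Type) (s : seq I)
    (P : pred I) (F : I -> {mpoly K[d]}) :
  (\sum_(i <- s | P i) F i).@[v] = \sum_(i <- s | P i) (F i).@[v].
Proof. exact: raddf_sum. Qed.

Section TranscendenceDegree.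
Variables (K : fieldType) (T : Type).

(** Pad [y] with zero functions up to length [d]; the first new variable is then a relation to which
    [algebraic_relation] applies. *)
Lemma transcendence_bound (p d : nat) (y : 'I_p -> T -> K) (f : 'I_d -> T -> K)
    (Q : {mpoly K[p]}) (P : 'I_d -> {mpoly K[p]}) : (p < d)%N ->
  (forall t, Q.@[fun i => y i t] != 0) ->
  (forall i t, Q.@[fun i => y i t] * f i t = (P i).@[fun i => y i t]) ->
  ~ alg_independent f.
Proof.
move=> lt Qy QP.
pose y' (i : 'I_d) (t : T) := if insub (i : nat) is Some j then y j t else 0.
pose lq : p.-tuple {mpoly K[d]} := [tuple 'X_(widen_ord (ltnW lt) i) | i < p].
have E (F : {mpoly K[p]}) t : (F \mPo lq).@[fun i => y' i t] = F.@[fun i => y i t].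
  rewrite comp_mpoly_meval; apply: meval_eq => i; rewrite tnth_mktuple mevalXU /y' /=.
  by rewrite valK.
apply: (@algebraic_relation _ _ _ y' _ (Q \mPo lq) 'X_(Ordinal lt) (fun i => P i \mPo lq)).
- by rewrite -msize_poly_eq0 msizeX.
- by move=> t; rewrite mevalXU /y' insubN //= ltnn.
- by move=> t; rewrite E.
- by move=> i t; rewrite !E.
Qed.

(** Fewer than [d] generators are excluded by [transcendence_bound], and a relation between exactly
    [d] of them would make [f] dependent. This turns a bound on the number of generators into their
    independence. *)
Lemma generators_alg_independent (p d : nat) (y : 'I_p -> T -> K) (f : 'I_d -> T -> K)
    (Q : {mpoly K[p]}) (P : 'I_d -> {mpoly K[p]}) : (p <= d)%N ->
  (forall t, Q.@[fun i => y i t] != 0) ->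
  (forall i t, Q.@[fun i => y i t] * f i t = (P i).@[fun i => y i t]) ->
  alg_independent f -> alg_independent y.
Proof.
rewrite leq_eqVlt => /orP[/eqP pd|lt] Qy QP indep; last first.
  by case: (transcendence_bound lt Qy QP indep).
subst d; move=> R Ry; apply: contrapT => /eqP R0.
exact: (algebraic_relation R0 Ry Qy QP indep).
Qed.

End TranscendenceDegree.

Section MaximalIdeals.
Variables (K : fieldType) (T : Type) (A : set (T -> K)).

Definition subalgebra : Prop :=
  [/\ forall c : K, A (fun=> c),
      forall f g, A f -> A g -> A (fun t => f t + g t)
    & forall f g, A f -> A g -> A (fun t => f t * g t)].

Hypothesis sA : subalgebra.
Variable x : T.
Let m2 := max_ideal2 A x.

Lemma subalgebra_sum (I : Type) (s : seq I) (F : I -> T -> K) :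
  (forall i, A (F i)) -> A (fun t => \sum_(i <- s) F i t).
Proof.
case: sA => cA addA mulA h; elim: s => [|i s IH].
  by rewrite (_ : (fun t => _) = (fun=> 0)) //; apply/funext => t; rewrite big_nil.
rewrite (_ : (fun t => _) = (fun t => F i t + \sum_(j <- s) F j t)); first exact: addA.
by apply/funext => t; rewrite big_cons.
Qed.

Lemma subalgebra_exp f k : A f -> A (fun t => f t ^+ k).
Proof.
case: sA => cA addA mulA Af; elim: k => [|k IH].
  by rewrite (_ : (fun t => _) = (fun=> 1)) //; apply/funext => t; rewrite expr0.
rewrite (_ : (fun t => _) = (fun t => f t * f t ^+ k)); first exact: mulA.
by apply/funext => t; rewrite exprS.
Qed.

Lemma subalgebra_prod (I : Type) (s : seq I) (P : pred I) (F : I -> T -> K) :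
  (forall i, P i -> A (F i)) -> A (fun t => \prod_(i <- s | P i) F i t).
Proof.
case: sA => cA addA mulA h; elim: s => [|i s IH].
  by rewrite (_ : (fun t => _) = (fun=> 1)) //; apply/funext => t; rewrite big_nil.
case Pi: (P i).
  rewrite (_ : (fun t => _) = (fun t => F i t * \prod_(j <- s | P j) F j t)).
    by apply: mulA => //; exact: h.
  by apply/funext => t; rewrite big_cons Pi.
by rewrite (_ : (fun t => _) = (fun t => \prod_(j <- s | P j) F j t)) //;
  apply/funext => t; rewrite big_cons Pi.
Qed.

Lemma subalgebra_mpoly (d : nat) (y : 'I_d -> T -> K) (P : {mpoly K[d]}) :
  (forall i, A (y i)) -> A (fun t => P.@[fun i => y i t]).
Proof.
case: sA => cA addA mulA h.
rewrite (_ : (fun t => _) = (fun t => \sum_(m <- msupp P) P@_m * \prod_i y i t ^+ m i)); last first.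
  by apply/funext => t; rewrite mevalE.
apply: subalgebra_sum => m; apply: (mulA (fun=> _)) => //.
by apply: subalgebra_prod => i _; exact: subalgebra_exp.
Qed.

Lemma max_ideal2D h h' : m2 h -> m2 h' -> m2 (fun t => h t + h' t).
Proof.
move=> [k [f [g [H ->]]]] [k' [f' [g' [H' ->]]]].
exists (k + k')%N, (fun i => match split i with inl a => f a | inr a => f' a end),
  (fun i => match split i with inl a => g a | inr a => g' a end); split.
  by move=> i; case: (split i).
apply/funext => t; rewrite big_split_ord /=; congr (_ + _); apply: eq_bigr => i _.
  by rewrite (unsplitK (inl i)).
by rewrite (unsplitK (inr i)).
Qed.

Lemma max_ideal2M f g : max_ideal A x f -> max_ideal A x g -> m2 (fun t => f t * g t).
Proof.
move=> hf hg; exists 1%N, (fun=> f), (fun=> g); split => //.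
by apply/funext => t; rewrite big_ord1.
Qed.

Lemma max_ideal2Z c h : m2 h -> m2 (fun t => c * h t).
Proof.
case: sA => cA addA mulA [k [f [g [H ->]]]].
exists k, (fun i t => c * f i t), g; split.
  move=> i; case: (H i) => -[fA fx] hg; split=> //; split; last by rewrite fx mulr0.
  exact: (mulA (fun=> c)).
by apply/funext => t; rewrite mulr_sumr; apply: eq_bigr => i _; rewrite mulrA.
Qed.

Lemma max_ideal2_0 : m2 (fun=> 0).
Proof.
exists 0%N, (fun=> fun=> 0), (fun=> fun=> 0); split; first by case.
by apply/funext => t; rewrite big_ord0.
Qed.

Lemma max_ideal2_sum (I : Type) (s : seq I) (F : I -> T -> K) :
  (forall i, m2 (F i)) -> m2 (fun t => \sum_(i <- s) F i t).
Proof.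
move=> h; elim: s => [|i s IH].
  rewrite (_ : (fun t => _) = (fun=> 0)); first exact: max_ideal2_0.
  by apply/funext => t; rewrite big_nil.
rewrite (_ : (fun t => _) = (fun t => F i t + \sum_(j <- s) F j t)); first exact: max_ideal2D.
by apply/funext => t; rewrite big_cons.
Qed.

Lemma cotangent_dim_ge (d : nat) (I : finType) (y : I -> T -> K) :
  cotangent_dim A x d -> (forall i, max_ideal A x (y i)) ->
  (forall a : I -> K, m2 (fun t => \sum_i a i * y i t) -> forall i, a i = 0) ->
  (#|I| <= d)%N.
Proof.
move=> [b [hb bas]] hy indep; rewrite leqNgt; apply/negP => lt.
have [a ha] := choice (fun i => bas _ (hy i)).
have [|w [i0 wi0] wa] := @nontrivial_relation K I 'I_d (fun i j => a i 0 j).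
  by rewrite card_ord.
case/eqP: wi0; apply: indep.
have := @max_ideal2_sum _ (index_enum I) (fun i t => w i * (y i t - \sum_j a i 0 j * b j t)).
move=> /(_ (fun i => max_ideal2Z (w i) (ha i).1)).
congr (m2 _); apply/funext => t.
under eq_bigr do rewrite mulrBr mulr_sumr.
rewrite sumrB exchange_big /= [X in _ - X]big1 ?subr0 // => j _.
under eq_bigr do rewrite mulrA.
by rewrite -mulr_suml wa mul0r.
Qed.

End MaximalIdeals.

(** First-order Taylor expansion at [v]: the property holds for constants and variables and is
    stable under sums and products. *)
Lemma mpoly_hadamard (K : fieldType) (d : nat) (v : 'I_d -> K) (P : {mpoly K[d]}) :
  exists G : 'I_d -> {mpoly K[d]},
    P = (P.@[v])%:MP + \sum_i ('X_i - (v i)%:MP) * G i.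
Proof.
pose good (P : {mpoly K[d]}) := exists G : 'I_d -> {mpoly K[d]},
  P = (P.@[v])%:MP + \sum_i ('X_i - (v i)%:MP) * G i.
have goodC c : good c%:MP.
  by exists (fun=> 0); rewrite mevalC big1 ?addr0 // => i _; rewrite mulr0.
have goodX i : good 'X_i.
  exists (fun j => (j == i)%:R); rewrite mevalXU (bigD1 i) //= big1 ?eqxx => [|j /negbTE ->].
    by rewrite mulr1 addr0 addrC subrK.
  by rewrite mulr0.
have goodD F F' : good F -> good F' -> good (F + F').
  move=> [G EF] [G' EF']; exists (fun i => G i + G' i).
  rewrite [in LHS]EF [in LHS]EF' mevalD mpolyCD.
  under [in RHS]eq_bigr do rewrite mulrDr.
  by rewrite big_split /= addrACA.
have goodM F F' : good F -> good F' -> good (F * F').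
  move=> [G EF] [G' EF']; exists (fun i => G i * F' + (F.@[v])%:MP * G' i).
  rewrite [in LHS]EF mulrDl mulr_suml mevalM mpolyCM [in X in X + _]EF' mulrDr -addrA.
  congr (_ + _); rewrite mulr_sumr -big_split /=; apply: eq_bigr => i _; ring.
rewrite [P]mpolyE; elim/big_ind: _ => [||m _].
- exact: (goodC 0).
- exact: goodD.
rewrite -mul_mpolyC; apply: (goodM) => //; rewrite mpolyXE_id; elim/big_ind: _ => [||i _].
- exact: (goodC 1).
- exact: goodM.
by elim: (m i) => [|k IH]; rewrite ?expr0 ?exprS; [exact: (goodC 1) | exact: goodM].
Qed.

(** The hypotheses describe [T] through [y] as the open set of affine space where [g] does not
    vanish. The differences [y i - y i x] form a basis of the cotangent space: partial derivatives
    at [x] show their independence, Hadamard's expansion shows that they span. *)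
Lemma smooth_of_parametrization (K : closedFieldType) (T : Type) (A : set (T -> K))
    (d : nat) (y : 'I_d -> T -> K) (g : {mpoly K[d]}) :
  subalgebra A -> (forall i, A (y i)) ->
  (forall t, g.@[fun i => y i t] != 0) ->
  (forall v, g.@[v] != 0 -> exists t, forall i, y i t = v i) ->
  (forall f, A f -> exists (k : nat) (P : {mpoly K[d]}), forall t,
     g.@[fun i => y i t] ^+ k * f t = P.@[fun i => y i t]) ->
  forall x, smooth_point A x.
Proof.
move=> sA yA gy surj reg x.
have [cA addA mulA] := sA.
have ident P : (forall t, P.@[fun i => y i t] = 0) -> P = 0.
  move=> Py; apply: contrapT => /eqP P0.
  have g0 : g != 0 by apply: contraTneq (gy x) => ->; rewrite meval0 eqxx.
  have [v _] := mpoly_nonvanish (mulf_neq0 P0 g0).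
  rewrite mevalM mulf_eq0 negb_or => /andP[/[swap] /surj[t yt]].
  by rewrite -(meval_eq _ yt) Py eqxx.
have regs (e : nat) (f : 'I_e -> T -> K) : (forall i, A (f i)) ->
    exists (k : nat) (P : 'I_e -> {mpoly K[d]}), forall i t,
     (g ^+ k).@[fun i => y i t] * f i t = (P i).@[fun i => y i t].
  move=> fA; have [k hk] := choice (fun i => reg _ (fA i)); have [P hP] := choice hk.
  exists (\sum_i k i)%N, (fun i => g ^+ (\sum_j k j - k i) * P i) => i t.
  rewrite mevalM -hP mulrA !rmorphXn /= -exprD subnK //.
  by rewrite (bigD1 i) //= leq_addr.
exists d; last first.
  split=> [|e f fA indep]; first by exists y.
  rewrite leqNgt; apply/negP => lt; have [k [P hP]] := regs _ _ fA.
  apply: (transcendence_bound lt _ hP indep) => t.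
  by rewrite rmorphXn /= expf_neq0.
pose b i t := y i t - y i x.
have bm i : max_ideal A x (b i).
  split; last by rewrite /b subrr.
  by apply: (addA (y i) (fun=> - y i x)); [exact: yA|exact: cA].
have indep (c : 'I_d -> K) : max_ideal2 A x (fun t => \sum_i c i * b i t) -> forall i, c i = 0.
  move=> [k [f [f' [H E]]]] l.
  have [kf [F hF]] := regs _ _ (fun i => (H i).1.1).
  have [kf' [F' hF']] := regs _ _ (fun i => (H i).2.1).
  pose X i : {mpoly K[d]} := 'X_i - (y i x)%:MP.
  have : g ^+ (kf + kf') * (\sum_i c i *: X i) - \sum_j F j * F' j = 0.
    apply: ident => t; rewrite mevalB !mevalM !meval_sum ; apply/eqP; rewrite subr_eq0; apply/eqP.
    transitivity ((g ^+ (kf + kf')).@[fun i => y i t] * \sum_i c i * b i t).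
      by congr (_ * _); apply: eq_bigr => i _; rewrite mevalZ mevalB mevalXU mevalC.
    move/(congr1 (fun h => h t)): E => ->; rewrite mulr_sumr; apply: eq_bigr => j _.
    rewrite mevalM -hF -hF' exprD mevalM; ring.
  (* The derivative at [x] kills every product of two polynomials vanishing there, which isolates
     the coefficient [c l]. *)
  move/(congr1 (fun P => (mderiv l P).@[fun i => y i x])).
  rewrite mderiv0 meval0 mderivB mevalB mderivM mevalD !mevalM !(raddf_sum (mderiv l)) !meval_sum /=.
  rewrite [X in _ * X + _ - _]big1 ?mulr0 => [|i _]; last first.
    by rewrite mevalZ mevalB mevalXU mevalC subrr mulr0.
  rewrite [X in _ - X]big1 ?subr0 => [|j _]; last first.
    rewrite mderivM mevalD !mevalM -hF -hF' (H j).1.2 (H j).2.2; ring.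
  rewrite (bigD1 l) //= big1 ?addr0 => [|i il]; last first.
    by rewrite mderivZ mderivB mderivC mderivX mnm1E (negbTE il) scale0r subr0 scaler0 meval0.
  rewrite mderivZ mderivB mderivC mderivX mnm1E eqxx scale1r subr0 -[X in 'X_[X - _]]add0m addmK mevalZ.
  rewrite mpolyX0 meval1 mulr1 add0r => /eqP; rewrite mulf_eq0 rmorphXn /= expf_eq0.
  by rewrite (negbTE (gy x)) andbF => /eqP.
exists b; split=> // f [fA fx].
have [k [P hP]] := reg _ fA.
have [G EP] := mpoly_hadamard (fun i => y i x) P.
have P0 : P.@[fun i => y i x] = 0 by rewrite -hP fx mulr0.
pose ga := g.@[fun i => y i x] ^+ k; have ga0 : ga != 0 by rewrite expf_neq0.
pose a i := ga^-1 * (G i).@[fun j => y j x].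
have ha : max_ideal2 A x (fun t => f t - \sum_i a i * b i t).
  (* Freezing the denominator [g ^+ k] at its value [ga] changes [f] by a product of two functions
     vanishing at [x]; the same holds for freezing the cofactors [G i]. *)
  have -> : (fun t => f t - \sum_i a i * b i t) = (fun t => ga^-1 *
      (f t * (ga - g.@[fun i => y i t] ^+ k)
       + \sum_i b i t * ((G i).@[fun j => y j t] - (G i).@[fun j => y j x]))).
    apply/funext => t; rewrite [f t * _]mulrBr (mulrC (f t) (g.@[fun i => y i t] ^+ k)) hP EP mevalD mevalC P0 add0r.
    rewrite meval_sum.
    under [X in _ = _ * (_ + X)]eq_bigr do rewrite mulrBr.
    rewrite sumrB [X in _ - X + _](eq_bigr (fun i => b i t * (G i).@[fun j => y j t])); last first.
      by move=> i _; rewrite mevalM mevalB mevalXU mevalC.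
    rewrite addrA subrK mulrBr mulrCA mulVf // mulr1; congr (_ - _).
    by rewrite mulr_sumr; apply: eq_bigr => i _; rewrite /a; ring.
  apply: max_ideal2Z => //; apply: max_ideal2D.
    apply: max_ideal2M => //; split; last by rewrite /ga subrr.
    apply: (addA (fun=> ga)) => //.
    rewrite (_ : (fun t => _) = (fun t => (- g ^+ k).@[fun i => y i t])); last first.
      by apply/funext => t; rewrite mevalN rmorphXn.
    exact: subalgebra_mpoly.
  apply: max_ideal2_sum => i; apply: max_ideal2M => //; split; last by rewrite subrr.
  apply: (addA (fun t => (G i).@[_]) (fun=> - _)); [exact: subalgebra_mpoly|exact: cA].
exists (\row_i a i); split.
  by congr (max_ideal2 A x _): ha; apply/funext => t; congr (_ - _); apply: eq_bigr => i _; rewrite mxE.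
move=> a' ha'; apply/rowP => i; rewrite mxE; apply/eqP; rewrite -subr_eq0; apply/eqP.
apply: (indep (fun i => a i - a' 0 i)).
have := max_ideal2D ha' (max_ideal2Z sA (-1) ha); congr (max_ideal2 A x _); apply/funext => t.
under [in RHS]eq_bigr do rewrite mulrBl.
rewrite sumrB; ring.
Qed.

(** * Graded algebras of characters *)

Lemma big_fibers_eq0 (V : nmodType) (I D : eqType) (s : seq I) (g : I -> D) (F : I -> V) :
  (forall z, \sum_(i <- s | g i == z) F i = 0) -> \sum_(i <- s) F i = 0.
Proof.
move=> H.
have : \sum_(z <- undup (map g s)) \sum_(i <- s | g i == z) F i = 0 by rewrite big1.
rewrite (exchange_big_dep xpredT) //= => h; rewrite -[RHS]h.
rewrite big_seq [RHS]big_seq; apply: eq_bigr => i si.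
rewrite -big_filter (eq_filter (a2 := pred1 (g i))); last by move=> z /=; rewrite eq_sym.
by rewrite filter_pred1_uniq ?undup_uniq ?mem_undup ?map_f // big_seq1.
Qed.

Section CharacterSpan.
Variables (K : fieldType) (T : Type) (M : zmodType) (S : set M) (chi : M -> T -> K).

Definition monomial_sum (s : seq (K * M)) (t : T) : K := \sum_(a <- s) a.1 * chi a.2 t.

Definition char_span (f : T -> K) : Prop :=
  exists2 s : seq (K * M), (forall a, a \in s -> S a.2) & f = monomial_sum s.

Hypotheses (S0 : S 0) (SD : forall u v, S u -> S v -> S (u + v))
  (chi0 : forall t, chi 0 t = 1)
  (chiD : forall u v t, S u -> S v -> chi (u + v) t = chi u t * chi v t).

Lemma char_span_char u : S u -> char_span (chi u).
Proof.
move=> Su; exists [:: (1, u)] => [a|]; first by rewrite inE => /eqP ->.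
by apply/funext => t; rewrite /monomial_sum big_seq1 mul1r.
Qed.

Lemma monomial_sumM (s s' : seq (K * M)) t : (forall a, a \in s -> S a.2) ->
  (forall a, a \in s' -> S a.2) ->
  monomial_sum [seq (a.1 * b.1, a.2 + b.2) | a <- s, b <- s'] t
  = monomial_sum s t * monomial_sum s' t.
Proof.
move=> Ss Ss'; rewrite /monomial_sum big_allpairs_dep /= mulr_suml.
rewrite big_seq [RHS]big_seq; apply: eq_bigr => a /Ss Sa.
rewrite mulr_sumr big_seq [RHS]big_seq; apply: eq_bigr => b /Ss' Sb.
by rewrite chiD //; ring.
Qed.

Lemma char_span_subalgebra : subalgebra char_span.
Proof.
split=> [b|f g [s Ss ->] [s' Ss' ->]|f g [s Ss ->] [s' Ss' ->]].
- exists [:: (b, 0)] => [a|]; first by rewrite inE => /eqP ->.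
  by apply/funext => t; rewrite /monomial_sum big_seq1 chi0 mulr1.
- exists (s ++ s') => [a|]; first by rewrite mem_cat => /orP[/Ss|/Ss'].
  by apply/funext => t; rewrite /monomial_sum big_cat.
exists [seq (a.1 * b.1, a.2 + b.2) | a <- s, b <- s'].
  by move=> _ /allpairsP[[a b] /= [/Ss Sa /Ss' Sb ->]]; apply: SD.
by apply/funext => t; rewrite monomial_sumM.
Qed.

End CharacterSpan.

Section CharacterAlgebras.
Variables (K : closedFieldType) (T : Type) (M D : zmodType).
Variables (deg : {additive M -> D}) (wt : {additive D -> int}).
Variables (S U : set M) (chi : M -> T -> K).
Variables (A : set (T -> K)) (n0 : nat) (w : 'I_n0 -> M) (kap : 'I_n0 -> {additive M -> int}).

Local Notation monomial_sum := (monomial_sum chi).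
Local Notation char_span := (char_span S chi).

(* S plays the role of the monoid of characters of an affine chart with coordinate
   ring A, U that of its group of units, with basis w and dual basis kap; A may be
   larger than the span of the characters in S, but only by denominators without zeros. *)
Record graded_characters : Prop := GradedCharacters {
  gc_U0 : U 0;
  gc_UD : forall u v, U u -> U v -> U (u + v);
  gc_UN : forall u, U u -> U (- u);
  gc_US : forall u, U u -> S u;
  gc_SD : forall u v, S u -> S v -> S (u + v);
  gc_chi0 : forall t, chi 0 t = 1;
  gc_chiD : forall u v t, S u -> S v -> chi (u + v) t = chi u t * chi v t;
  gc_Uw : forall j, U (w j);
  gc_Ubasis : forall u, U u -> u = \sum_j w j *~ kap j u;
  gc_kapw : forall i j, kap j (w i) = (i == j)%:Z;
  gc_wt_ge0 : forall u, S u -> 0 <= wt (deg u);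
  gc_wt_eq0 : forall u, S u -> wt (deg u) = 0 -> U u;
  gc_wtU : forall u, U u -> wt (deg u) = 0;
  gc_degU : forall u v, U u -> U v -> deg u = deg v -> u = v;
  gc_homog : forall s : seq (K * M), (forall a, a \in s -> S a.2) ->
    (forall t, monomial_sum s t = 0) ->
    forall z t, \sum_(a <- s | deg a.2 == z) a.1 * chi a.2 t = 0;
  gc_subalg : subalgebra A;
  gc_span : forall f, char_span f -> A f;
  gc_clear : forall f, A f -> exists tau, [/\ char_span tau, forall t, tau t != 0
     & char_span (fun t => tau t * f t)] }.

Hypothesis gc : graded_characters.

Lemma chi_unit u t : U u -> chi u t != 0.
Proof.
move=> Uu; have := gc_chiD gc t (gc_US gc Uu) (gc_US gc (gc_UN gc Uu)).
by rewrite subrr (gc_chi0 gc) => h; apply: contra_eq_neq h => ->; rewrite mul0r oner_neq0.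
Qed.

Lemma S0 : S 0. Proof. exact: gc_US (gc_U0 gc). Qed.

Let monomial_sumM := monomial_sumM (gc_chiD gc).

Lemma graded_span_subalgebra : subalgebra char_span.
Proof. exact: (char_span_subalgebra S0 (gc_SD gc) (gc_chi0 gc) (gc_chiD gc)). Qed.

Lemma char_spanM f g : char_span f -> char_span g -> char_span (fun t => f t * g t).
Proof. by have [_ _ h] := graded_span_subalgebra; exact: h. Qed.

Lemma common_clear (k : nat) (f : 'I_k -> T -> K) : (forall i, A (f i)) ->
  exists tau, [/\ char_span tau, forall t, tau t != 0
    & forall i, char_span (fun t => tau t * f i t)].
Proof.
elim: k f => [|k IH] f fA.
  by exists (fun=> 1); split=> [|t|[]//]; [have [h _ _] := graded_span_subalgebra; exact: h | exact: oner_neq0].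
have [tau [h1 h2 h3]] := gc_clear gc (fA ord0).
have [tau' [h1' h2' h3']] := IH (fun i => f (lift ord0 i)) (fun i => fA _).
exists (fun t => tau t * tau' t); split; first exact: char_spanM.
  by move=> t; rewrite mulf_neq0.
move=> i; case: (unliftP ord0 i) => [j|] ->.
  rewrite (_ : (fun t => _) = (fun t => tau t * (tau' t * f (lift ord0 j) t))).
    exact: char_spanM.
  by apply/funext => t; rewrite mulrA.
rewrite (_ : (fun t => _) = (fun t => tau' t * (tau t * f ord0 t))).
  exact: char_spanM.
by apply/funext => t; ring.
Qed.

(* Linear functionals on formal sums of characters that descend to functions. *)
Definition respectful (Lam : M -> K) : Prop :=
  forall s : seq (K * M), (forall a, a \in s -> S a.2) ->
    (forall t, monomial_sum s t = 0) -> \sum_(a <- s) a.1 * Lam a.2 = 0.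

Variable x : T.
Hypothesis chi_x : forall u, S u -> ~ U u -> chi u x = 0.

(** Membership in m_x^2, which concerns functions with denominators, becomes an identity of formal
    sums of characters. Here [r] is the product of the two common denominators and does not vanish
    at [x]. *)
Lemma formal_max_ideal2 (s : seq (K * M)) : (forall a, a \in s -> S a.2) ->
  max_ideal2 A x (monomial_sum s) ->
  exists (r : seq (K * M)) (k : nat) (F G : 'I_k -> seq (K * M)),
  [/\ forall a, a \in r -> S a.2, monomial_sum r x != 0,
      forall i, (forall a, a \in F i -> S a.2) /\ monomial_sum (F i) x = 0,
      forall i, (forall a, a \in G i -> S a.2) /\ monomial_sum (G i) x = 0
    & forall Lam, respectful Lam ->
      \sum_(a <- r) \sum_(b <- s) a.1 * b.1 * Lam (a.2 + b.2)
      = \sum_i \sum_(a <- F i) \sum_(b <- G i) a.1 * b.1 * Lam (a.2 + b.2)].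
Proof.
move=> Ss [k [f [g [H E]]]].
have [tau [t1 t2 t3]] := common_clear (fun i => (H i).1.1).
have [tau' [t1' t2' t3']] := common_clear (fun i => (H i).2.1).
have [r Sr Er] := char_spanM t1 t1'.
pose PF i (q : seq (K * M)) := (forall a, a \in q -> S a.2) /\ (fun t => tau t * f i t) = monomial_sum q.
have /choice[F hF] i : exists q, PF i q by have [q ? ?] := t3 i; exists q.
pose PG i (q : seq (K * M)) := (forall a, a \in q -> S a.2) /\ (fun t => tau' t * g i t) = monomial_sum q.
have /choice[G hG] i : exists q, PG i q by have [q ? ?] := t3' i; exists q.
exists r, k, F, G; split=> //.
- by rewrite -Er mulf_neq0.
- by move=> i; split; [exact: (hF i).1 | rewrite -(hF i).2 (H i).1.2 mulr0].
- by move=> i; split; [exact: (hG i).1 | rewrite -(hG i).2 (H i).2.2 mulr0].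
move=> Lam resp; apply/eqP; rewrite -subr_eq0; apply/eqP.
pose mul (p q : seq (K * M)) := [seq (a.1 * b.1, a.2 + b.2) | a <- p, b <- q].
have mulS p q : (forall a, a \in p -> S a.2) -> (forall a, a \in q -> S a.2) ->
    forall a, a \in mul p q -> S a.2.
  by move=> Sp Sq _ /allpairsP[[a b] /= [/Sp Sa /Sq Sb ->]]; apply: (gc_SD gc).
(* The formal difference of the two sides represents the zero function, so [Lam] kills it. *)
pose tot := mul r s ++ [seq (- a.1, a.2) | a <- flatten [seq mul (F i) (G i) | i <- index_enum 'I_k]].
have := resp tot; rewrite /tot big_cat big_map big_allpairs_dep big_flatten big_map /=.
have -> : \sum_(j <- index_enum 'I_k) \sum_(i <- mul (F j) (G j)) - i.1 * Lam i.2
   = - \sum_i \sum_(a <- F i) \sum_(b <- G i) a.1 * b.1 * Lam (a.2 + b.2).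
  rewrite -sumrN; apply: eq_bigr => i _; rewrite big_allpairs_dep /= -sumrN.
  by apply: eq_bigr => a _; rewrite -sumrN; apply: eq_bigr => b _; rewrite mulNr.
apply.
  move=> a; rewrite mem_cat => /orP[|/mapP[b]]; first exact: mulS.
  by case/flatten_mapP => i _ hb -> /=; apply: (mulS _ _ (hF i).1 (hG i).1).
move=> t; rewrite /monomial_sum big_cat /= -!/(monomial_sum _ t) (monomial_sumM t Sr Ss) -Er E.
apply/eqP; rewrite mulr_sumr /monomial_sum big_map big_flatten big_map /= -big_split /= big1 // => i _.
have -> : \sum_(j <- mul (F i) (G i)) - j.1 * chi j.2 t = - monomial_sum (mul (F i) (G i)) t.
  by rewrite /monomial_sum -sumrN; apply: eq_bigr => a _; rewrite mulNr.
rewrite (monomial_sumM t (hF i).1 (hG i).1) -(hF i).2 -(hG i).2; ring.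
Qed.

Lemma monomial_sum_unit (s : seq (K * M)) : (forall a, a \in s -> S a.2) ->
  monomial_sum s x = \sum_(a <- s | `[< U a.2 >]) a.1 * chi a.2 x.
Proof.
move=> Ss; rewrite /monomial_sum (bigID (fun a : K * M => `[< U a.2 >])) /= [X in _ + X]big_seq_cond.
rewrite [X in _ + X]big1 ?addr0 // => a /andP[/Ss Sa /asboolPn nU].
by rewrite chi_x // mulr0.
Qed.

(** Weights are nonnegative on [S] and vanish only on units, so the units form a face of [S]. *)
Lemma unit_split (u v : M) : S u -> S v -> U (u + v) -> U u.
Proof.
move=> Su Sv /(gc_wtU gc); rewrite !raddfD => h; apply: (gc_wt_eq0 gc) => //.
have := gc_wt_ge0 gc Su; have := gc_wt_ge0 gc Sv; lia.
Qed.

(* The derivation at x given by w_j d/dw_j on units. *)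
Definition unit_deriv (j : 'I_n0) (u : M) : K :=
  if `[< U u >] then (kap j u)%:~R * chi u x else 0.

(** A degree that contains a unit contains no other character of [S]. The component of a relation in
    that degree is thus a relation between scalars, while in the other degrees the derivation is
    zero. *)
Lemma unit_deriv_respectful j : respectful (unit_deriv j).
Proof.
move=> s Ss s0; apply: (big_fibers_eq0 (g := fun a => deg a.2)) => z.
have [[a0 [sa0 az Ua0]]|no] := pselect (exists a, [/\ a \in s, deg a.2 = z & U a.2]); last first.
  rewrite big_seq_cond big1 // => a /andP[sa /eqP az].
  by rewrite /unit_deriv; case: asboolP; rewrite ?mulr0 // => Ua; case: no; exists a.
have Ea a : a \in s -> deg a.2 == z -> a.2 = a0.2.
  move=> sa /eqP az'; apply: (gc_degU gc) => //; last by rewrite az az'.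
  by apply: (gc_wt_eq0 gc (Ss _ sa)); rewrite az' -az gc_wtU.
have := gc_homog gc Ss s0 z x.
rewrite big_seq_cond (eq_bigr (fun a => a.1 * chi a0.2 x)) => [|a /andP[sa az']]; last first.
  by rewrite (Ea a sa az').
rewrite -mulr_suml => /eqP; rewrite mulf_eq0 (negbTE (chi_unit x Ua0)) orbF => /eqP h.
rewrite big_seq_cond (eq_bigr (fun a => a.1 * unit_deriv j a0.2)) => [|a /andP[sa az']]; last first.
  by rewrite (Ea a sa az').
by rewrite -mulr_suml h mul0r.
Qed.

Lemma unit_derivD j u v : S u -> S v ->
  unit_deriv j (u + v) = chi u x * unit_deriv j v + unit_deriv j u * chi v x.
Proof.
move=> Su Sv; rewrite /unit_deriv.
have UD : `[< U (u + v) >] = `[< U u >] && `[< U v >].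
  apply/asboolP/andP => [h|[/asboolP Uu /asboolP Uv]]; last exact: (gc_UD gc).
  by split; apply/asboolP; [apply: unit_split h | rewrite addrC in h; apply: unit_split h].
rewrite UD; case: asboolP => [Uu|nu]; case: asboolP => [Uv|nv] /=.
- by rewrite (gc_chiD gc) // raddfD /= intrD; ring.
- by rewrite (chi_x Sv nv) !mulr0 addr0.
- by rewrite (chi_x Su nu) !mul0r addr0.
- by rewrite mulr0 mul0r addr0.
Qed.

(** A derivation at [x] kills products of functions vanishing at [x], and the denominator [r] has a
    nonzero value there, which cancels. *)
Lemma unit_deriv_max_ideal2 j (s : seq (K * M)) : (forall a, a \in s -> S a.2) ->
  max_ideal2 A x (monomial_sum s) -> \sum_(a <- s) a.1 * unit_deriv j a.2 = 0.
Proof.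
move=> Ss m2; have [r [k [F [G [Sr r0 hF hG E]]]]] := formal_max_ideal2 Ss m2.
have s0 : monomial_sum s x = 0.
  have [k' [f [g [H ->]]]] := m2; rewrite big1 // => i _; by rewrite (H i).1.2 mul0r.
have P p q : (forall a, a \in p -> S a.2) -> (forall a, a \in q -> S a.2) ->
  \sum_(a <- p) \sum_(b <- q) a.1 * b.1 * unit_deriv j (a.2 + b.2)
  = monomial_sum p x * (\sum_(b <- q) b.1 * unit_deriv j b.2)
    + (\sum_(a <- p) a.1 * unit_deriv j a.2) * monomial_sum q x.
  move=> Sp Sq; rewrite /monomial_sum !mulr_suml -big_split /= big_seq [RHS]big_seq.
  apply: eq_bigr => a /Sp Sa; rewrite !mulr_sumr -big_split /= big_seq [RHS]big_seq.
  by apply: eq_bigr => b /Sq Sb; rewrite unit_derivD //; ring.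
have := E _ (unit_deriv_respectful j); rewrite P // s0 mulr0 addr0 [RHS]big1.
  by move/eqP; rewrite mulf_eq0 (negbTE r0) => /eqP.
by move=> i _; rewrite P ?(hF i).2 ?(hG i).2 ?mul0r ?mulr0 ?addr0 //; [exact: (hF i).1 | exact: (hG i).1].
Qed.

Definition unit_shift (u0 v : M) : M := xget 0 [set z | U z /\ deg v = deg u0 + deg z].

Definition unit_class (u0 v : M) : bool := `[< exists z, U z /\ deg v = deg u0 + deg z >].

Lemma unit_shiftP u0 v : unit_class u0 v ->
  U (unit_shift u0 v) /\ deg v = deg u0 + deg (unit_shift u0 v).
Proof.
move=> /asboolP ex; pose P : set M := [set z | U z /\ deg v = deg u0 + deg z].
by have : P (xget 0 P) by apply: xgetPex.
Qed.

Lemma unit_shift_unique u0 v z : U z -> deg v = deg u0 + deg z ->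
  unit_class u0 v /\ unit_shift u0 v = z.
Proof.
move=> Uz dz; have cl : unit_class u0 v by apply/asboolP; exists z.
split=> //; have [U' d'] := unit_shiftP cl.
by apply: (gc_degU gc) => //; apply: (addrI (deg u0)); rewrite -dz -d'.
Qed.

(* Keeps only the characters whose degree is that of u0 up to units, and evaluates
   the unit factor at x; homogeneity makes this well defined on functions. *)
Definition shifted (t : T) (u0 v : M) : K :=
  if unit_class u0 v then chi (unit_shift u0 v) x * chi (v - unit_shift u0 v) t else 0.

(** Characters of one degree have the same unit shift, so on each homogeneous component the
    functional is evaluation at [t] up to a common factor, and homogeneous components of relations
    are relations. *)
Lemma shifted_respectful t u0 : respectful (shifted t u0).
Proof.
move=> s Ss s0; apply: (big_fibers_eq0 (g := fun a => deg a.2)) => z.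
have [[z' [Uz' zE]]|no] := pselect (exists z', U z' /\ z = deg u0 + deg z'); last first.
  rewrite big1 // => a /eqP az; rewrite /shifted; case: ifP; rewrite ?mulr0 // => /asboolP[z' [U' E]].
  by case: no; exists z'; rewrite -az.
rewrite big_seq_cond (eq_bigr (fun a => a.1 * chi a.2 t * (chi z' x * chi (- z') t))).
  by rewrite -big_seq_cond -mulr_suml (gc_homog gc) // mul0r.
move=> a /andP[sa /eqP az]; rewrite zE in az.
have [cl sh] := unit_shift_unique Uz' az.
rewrite /shifted cl sh (gc_chiD gc) //; first ring; first exact: Ss.
by apply: (gc_US gc); exact: (gc_UN gc).
Qed.

Lemma shifted_unit t u0 p v : U p -> S v -> shifted t u0 (p + v) = chi p x * shifted t u0 v.
Proof.
move=> Up Sv; rewrite /shifted; case: (boolP (unit_class u0 v)) => cl.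
  have [Uz dz] := unit_shiftP cl.
  have [-> ->] : unit_class u0 (p + v) /\ unit_shift u0 (p + v) = p + unit_shift u0 v.
    by apply: unit_shift_unique; [by apply: (gc_UD gc) | rewrite !raddfD dz addrCA].
  rewrite (gc_chiD gc); [|exact: (gc_US gc)..].
  rewrite mulrA; congr (_ * chi _ t); by rewrite opprD addrACA subrr add0r.
rewrite mulr0; case: ifP => // cl'; case/negP: cl.
have [Uz dz] := unit_shiftP cl'; apply/asboolP; exists (unit_shift u0 (p + v) - p); split.
  by apply: (gc_UD gc) => //; exact: (gc_UN gc).
by rewrite raddfB addrA -dz raddfD addrC addKr.
Qed.

Lemma shifted_self t u : S u -> shifted t u u = chi u t.
Proof.
move=> Su; rewrite /shifted; have [-> ->] : unit_class u u /\ unit_shift u u = 0.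
  by apply: unit_shift_unique; [exact: (gc_U0 gc) | rewrite raddf0 addr0].
by rewrite (gc_chi0 gc) mul1r subr0.
Qed.

Lemma shifted_nonunit t u v : S u -> ~ U u -> U v -> shifted t u v = 0.
Proof.
move=> Su nU Uv; rewrite /shifted; case: ifP => // /asboolP[z [Uz]].
move=> /(congr1 wt); rewrite raddfD (gc_wtU gc Uv) (gc_wtU gc Uz) addr0 => /esym.
by move/(gc_wt_eq0 gc Su).
Qed.

(** Units may be pulled out at their value at [x]. Unit terms of [p] thus give the value of [p] at
    [x], and unit terms of [q] sum to the value of [q] at [x], which is zero; products of nonunits
    remain. *)
Lemma shifted_product t u0 (p q : seq (K * M)) : (forall a, a \in p -> S a.2) ->
  (forall a, a \in q -> S a.2) -> monomial_sum q x = 0 ->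
  \sum_(a <- p) \sum_(b <- q) a.1 * b.1 * shifted t u0 (a.2 + b.2)
  = monomial_sum p x * (\sum_(b <- q) b.1 * shifted t u0 b.2)
    + \sum_(a <- p | ~~ `[< U a.2 >]) \sum_(b <- q | ~~ `[< U b.2 >])
        a.1 * b.1 * shifted t u0 (a.2 + b.2).
Proof.
move=> Sp Sq q0; rewrite (bigID (fun a : K * M => `[< U a.2 >])) /=; congr (_ + _).
  rewrite monomial_sum_unit // mulr_suml big_seq_cond [RHS]big_seq_cond.
  apply: eq_bigr => a /andP[_ /asboolP Ua]; rewrite mulr_sumr big_seq [RHS]big_seq.
  by apply: eq_bigr => b /Sq Sb; rewrite shifted_unit //; ring.
rewrite big_seq_cond [RHS]big_seq_cond; apply: eq_bigr => a /andP[/Sp Sa _].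
rewrite (bigID (fun b : K * M => `[< U b.2 >])) /= [X in X + _](_ : _ = 0) ?add0r //.
transitivity (a.1 * shifted t u0 a.2 * monomial_sum q x); last by rewrite q0 mulr0.
rewrite monomial_sum_unit // mulr_sumr; apply: eq_bigr => b /asboolP Ub.
by rewrite addrC shifted_unit //; ring.
Qed.

Definition decomposable (v : M) : Prop :=
  exists p q, [/\ S p, ~ U p, S q, ~ U q & v = p + q].

(** After projection to the degree of [u0], an element of m_x^2 involves only products of two
    nonunits. Their factors have smaller weight, which feeds the induction of
    [smooth_generators]. *)
Lemma shifted_max_ideal2 (s : seq (K * M)) : (forall a, a \in s -> S a.2) ->
  max_ideal2 A x (monomial_sum s) ->
  exists2 s' : seq (K * M), forall a, a \in s' -> decomposable a.2 &
    forall t u0, \sum_(a <- s) a.1 * shifted t u0 a.2 = \sum_(a <- s') a.1 * shifted t u0 a.2.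
Proof.
move=> Ss m2; have [r [k [F [G [Sr r0 hF hG E]]]]] := formal_max_ideal2 Ss m2.
have s0 : monomial_sum s x = 0.
  have [k' [f [g [H ->]]]] := m2; rewrite big1 // => i _; by rewrite (H i).1.2 mul0r.
pose nu (q : seq (K * M)) := [seq b <- q | ~~ `[< U b.2 >]].
pose mul c (p q : seq (K * M)) := [seq (c * (a.1 * b.1), a.2 + b.2) | a <- nu p, b <- nu q].
(* The value of [r] at [x] is what multiplies [s] in [shifted_product]; dividing by it isolates
   [s]. *)
pose rho := (monomial_sum r x)^-1.
have mulE c p q t u0 : \sum_(a <- mul c p q) a.1 * shifted t u0 a.2 =
   c * \sum_(a <- p | ~~ `[< U a.2 >]) \sum_(b <- q | ~~ `[< U b.2 >])
        a.1 * b.1 * shifted t u0 (a.2 + b.2).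
  rewrite /mul big_allpairs_dep /= big_filter mulr_sumr; apply: eq_bigr => a _.
  by rewrite big_filter mulr_sumr; apply: eq_bigr => b _; rewrite !mulrA.
have mulS c p q : (forall a, a \in p -> S a.2) -> (forall a, a \in q -> S a.2) ->
    forall a, a \in mul c p q -> decomposable a.2.
  move=> Sp Sq d /allpairsP[[a b]] /= [] + + ->; rewrite !mem_filter.
  move=> /andP[/asboolP na /Sp Sa] /andP[/asboolP nb /Sq Sb] /=.
  by exists a.2, b.2.
exists (mul (- rho) r s ++ flatten [seq mul rho (F i) (G i) | i <- index_enum 'I_k]).
  move=> a; rewrite mem_cat => /orP[|/flatten_mapP[i _]]; first exact: mulS.
  exact: (mulS _ _ _ (hF i).1 (hG i).1).
move=> t u0; rewrite big_cat /= mulE big_flatten big_map /=.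
rewrite (eq_bigr _ (fun i _ => mulE rho (F i) (G i) t u0)).
have := E _ (shifted_respectful t u0).
rewrite shifted_product //.
rewrite (eq_bigr _ (fun i _ => shifted_product t u0 (hF i).1 (hG i).1 (hG i).2)).
rewrite (eq_bigr (fun i => \sum_(a <- F i | ~~ `[< U a.2 >]) \sum_(b <- G i | ~~ `[< U b.2 >])
        a.1 * b.1 * shifted t u0 (a.2 + b.2))) => [|i _]; last by rewrite (hF i).2 mul0r add0r.
move=> /(congr1 (fun z => rho * z)); rewrite mulrDr mulrA mulVf // mul1r => E1; rewrite -mulr_sumr -E1.
by rewrite mulNr addrC addrK.
Qed.

Section Generation.
Variables (e : nat) (h : 'I_e -> M).
Hypotheses (Sh : forall i, S (h i)) (nUh : forall i, ~ U (h i)).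

Definition generated (v : M) : Prop :=
  exists (z : M) (al : 'I_e -> nat), U z /\ v = z + \sum_i h i *+ al i.

Definition graded_span (z : D) (f : T -> K) : Prop :=
  exists2 s : seq (K * M), (forall a, a \in s -> generated a.2 /\ deg a.2 = z)
    & f = monomial_sum s.

Lemma generatedD u v : generated u -> generated v -> generated (u + v).
Proof.
move=> [z [al [Uz ->]]] [z' [al' [Uz' ->]]]; exists (z + z'), (fun i => (al i + al' i)%N).
split; first exact: (gc_UD gc).
rewrite addrACA; congr (_ + _); rewrite -big_split; apply: eq_bigr => i _; by rewrite mulrnDr.
Qed.

Lemma generatedU u : U u -> generated u.
Proof. by move=> Uu; exists u, (fun=> 0%N); split=> //; rewrite big1 ?addr0. Qed.

Lemma generated_h i : generated (h i).
Proof.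
exists 0, (fun j => nat_of_bool (j == i)); split; first exact: (gc_U0 gc).
by rewrite add0r (bigD1 i) //= eqxx big1 ?addr0 // => j /negbTE ->.
Qed.

Lemma S_sum (al : 'I_e -> nat) : S (\sum_i h i *+ al i).
Proof.
elim/big_ind: _ => [|u v|i _]; [exact: S0 | exact: (gc_SD gc) |].
by elim: (al i) => [|k IH]; rewrite ?mulr0n ?mulrS; [exact: S0 | exact: (gc_SD gc)].
Qed.

Lemma generatedS u : generated u -> S u.
Proof.
by move=> [z [al [Uz ->]]]; apply: (gc_SD gc); [exact: (gc_US gc) | exact: S_sum].
Qed.

Lemma graded_span0 z : graded_span z (fun=> 0).
Proof. by exists [::] => //; apply/funext => t; rewrite /monomial_sum big_nil. Qed.

Lemma graded_spanD z f g : graded_span z f -> graded_span z g ->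
  graded_span z (fun t => f t + g t).
Proof.
move=> [s hs ->] [s' hs' ->]; exists (s ++ s') => [a|].
  by rewrite mem_cat => /orP[/hs|/hs'].
by apply/funext => t; rewrite /monomial_sum big_cat.
Qed.

Lemma graded_spanZ z c f : graded_span z f -> graded_span z (fun t => c * f t).
Proof.
move=> [s hs ->]; exists [seq (c * a.1, a.2) | a <- s] => [_ /mapP[a /hs ha ->] //|].
apply/funext => t; rewrite /monomial_sum big_map mulr_sumr.
by apply: eq_bigr => a _; rewrite mulrA.
Qed.

Lemma graded_spanM z z' f g : graded_span z f -> graded_span z' g ->
  graded_span (z + z') (fun t => f t * g t).
Proof.
move=> [s hs ->] [s' hs' ->]; exists [seq (a.1 * b.1, a.2 + b.2) | a <- s, b <- s'].
  move=> _ /allpairsP[[a b] /= [/hs[ga da] /hs'[gb db] ->]] /=.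
  by rewrite raddfD da db; split=> //; exact: generatedD.
by apply/funext => t; rewrite monomial_sumM // => a; [move/hs|move/hs'] => -[/generatedS].
Qed.

Lemma graded_span_sum z (s : seq (K * M)) (F : M -> T -> K) :
  (forall a, a \in s -> graded_span z (F a.2)) ->
  graded_span z (fun t => \sum_(a <- s) a.1 * F a.2 t).
Proof.
elim: s => [|a s IH] H.
  rewrite (_ : (fun t => _) = (fun=> 0)); first exact: graded_span0.
  by apply/funext => t; rewrite big_nil.
rewrite (_ : (fun t => _) = (fun t => a.1 * F a.2 t + \sum_(b <- s) b.1 * F b.2 t)).
  apply: graded_spanD; first by apply: graded_spanZ; apply: H; rewrite mem_head.
  by apply: IH => b sb; apply: H; rewrite inE sb orbT.
by apply/funext => t; rewrite big_cons.
Qed.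

Lemma graded_span_char v : generated v -> graded_span (deg v) (chi v).
Proof.
move=> gv; exists [:: (1, v)] => [a|]; first by rewrite inE => /eqP ->.
by apply/funext => t; rewrite /monomial_sum big_seq1 mul1r.
Qed.

Lemma graded_span_shifted u0 v : graded_span (deg v) (chi v) -> S v ->
  graded_span (deg u0) (fun t => shifted t u0 v).
Proof.
move=> gv Sv; rewrite /shifted; case: (boolP (unit_class u0 v)) => cl; last exact: graded_span0.
have [Uz dz] := unit_shiftP cl; apply: graded_spanZ.
have UN := gc_UN gc Uz.
rewrite (_ : chi (v - _) = (fun t => chi v t * chi (- unit_shift u0 v) t)).
  have -> : deg u0 = deg v + deg (- unit_shift u0 v) by rewrite raddfN dz addrK.
  by apply: graded_spanM => //; apply: graded_span_char; apply: generatedU.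
by apply/funext => t; rewrite (gc_chiD gc) //; exact: (gc_US gc).
Qed.

(** Candidates for a basis of m_x / m_x^2: the basic units, corrected by their values at [x],
    account for the directions along the piece and the nonunits for the transversal ones. *)
Definition cotangent_family (i : 'I_n0 + 'I_e) : T -> K :=
  match i with inl j => fun t => chi (w j) t - chi (w j) x | inr i => chi (h i) end.

Definition cotangent_free : Prop := forall a : 'I_n0 + 'I_e -> K,
  max_ideal2 A x (fun t => \sum_i a i * cotangent_family i t) -> forall i, a i = 0.

(** The middle block carries the constants subtracted from the units, as multiples of the character
    0. *)
Definition cotangent_list (a : 'I_n0 + 'I_e -> K) : seq (K * M) :=
  [seq (a (inl j), w j) | j <- index_enum 'I_n0] ++
  [seq (- a (inl j) * chi (w j) x, 0) | j <- index_enum 'I_n0] ++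
  [seq (a (inr i), h i) | i <- index_enum 'I_e].

Lemma cotangent_listE a (F : M -> K) : \sum_(b <- cotangent_list a) b.1 * F b.2 =
  \sum_j a (inl j) * (F (w j) - chi (w j) x * F 0) + \sum_i a (inr i) * F (h i).
Proof.
rewrite /cotangent_list !big_cat !big_map /= addrA -big_split; congr (_ + _).
by apply: eq_bigr => j _ /=; ring.
Qed.

Lemma cotangent_list_sum a :
  monomial_sum (cotangent_list a) = (fun t => \sum_i a i * cotangent_family i t).
Proof.
apply/funext => t; rewrite /monomial_sum (cotangent_listE a (fun u => chi u t)) big_sumType /=.
by congr (_ + _); apply: eq_bigr => j _; rewrite (gc_chi0 gc) mulr1.
Qed.

Lemma cotangent_listS a b : b \in cotangent_list a -> S b.2.
Proof.
rewrite !mem_cat => /or3P[] /mapP[i _ ->] //=; last exact: S0.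
by apply: (gc_US gc); exact: (gc_Uw gc).
Qed.

Lemma cotangent_family_max_ideal i : max_ideal A x (cotangent_family i).
Proof.
have [cA addA _] := gc_subalg gc; case: i => i /=; split.
- apply: (addA (chi (w i)) (fun=> - _)) => //; apply: (gc_span gc); apply: char_span_char.
  by apply: (gc_US gc); exact: (gc_Uw gc).
- by rewrite subrr.
- by apply: (gc_span gc); exact: char_span_char.
- exact: chi_x.
Qed.

(** The derivation [unit_deriv l] kills m_x^2, the constants, the nonunits and the other basic
    units, so it reads off the coefficient of [w l]. *)
Lemma cotangent_unit_coeff (a : 'I_n0 + 'I_e -> K) :
  max_ideal2 A x (fun t => \sum_i a i * cotangent_family i t) -> forall l, a (inl l) = 0.
Proof.
rewrite -cotangent_list_sum => m2 l.
have := unit_deriv_max_ideal2 l (@cotangent_listS a) m2; rewrite cotangent_listE.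
rewrite [X in _ + X]big1 => [|i _]; last first.
  by rewrite /unit_deriv; case: asboolP; rewrite ?mulr0 // => /nUh.
have U0 : unit_deriv l 0 = 0 by rewrite /unit_deriv raddf0 mul0r if_same.
rewrite (bigD1 l) //= big1 => [|j jl]; rewrite U0 mulr0 subr0 /unit_deriv asboolT ?(gc_kapw gc).
- rewrite eqxx mul1r !addr0 => /eqP; rewrite mulf_eq0 (negbTE (chi_unit x (gc_Uw gc l))) orbF.
  by move/eqP.
- exact: (gc_Uw gc).
- by rewrite (negbTE jl) mul0r mulr0.
- exact: (gc_Uw gc).
Qed.

Definition chart_coord (k : 'I_(n0 + e)) : T -> K :=
  match split k with inl j => chi (w j) | inr i => chi (h i) end.

Definition laurent_rep (f : T -> K) : Prop :=
  exists (k : nat) (P : {mpoly K[n0 + e]}), forall t,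
    (\prod_j chi (w j) t) ^+ k * f t = P.@[fun i => chart_coord i t].

Definition unit_poly : {mpoly K[n0 + e]} := \prod_(j < n0) 'X_(lshift e j).

Lemma unit_polyE t : unit_poly.@[fun i => chart_coord i t] = \prod_j chi (w j) t.
Proof.
rewrite rmorph_prod; apply: eq_bigr => j _; rewrite /= mevalXU /chart_coord.
by rewrite (unsplitK (inl j)).
Qed.

Lemma laurent_repC c : laurent_rep (fun=> c).
Proof. by exists 0%N, c%:MP => t; rewrite mevalC expr0 mul1r. Qed.

Lemma laurent_repM f g : laurent_rep f -> laurent_rep g -> laurent_rep (fun t => f t * g t).
Proof.
move=> [k [P hP]] [k' [P' hP']]; exists (k + k')%N, (P * P') => t.
by rewrite mevalM -hP -hP' exprD; ring.
Qed.

Lemma laurent_repD f g : laurent_rep f -> laurent_rep g -> laurent_rep (fun t => f t + g t).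
Proof.
move=> [k [P hP]] [k' [P' hP']]; exists (k + k')%N, (unit_poly ^+ k' * P + unit_poly ^+ k * P') => t.
rewrite mevalD !mevalM -hP -hP' !rmorphXn /= unit_polyE exprD; ring.
Qed.

Lemma laurent_rep_coord i : laurent_rep (chart_coord i).
Proof. by exists 0%N, 'X_i => t; rewrite mevalXU expr0 mul1r. Qed.

Lemma laurent_rep_natmul u k : S u -> laurent_rep (chi u) -> S (u *+ k) /\ laurent_rep (chi (u *+ k)).
Proof.
move=> Su ru; elim: k => [|k [Sk IH]].
  split; first exact: S0.
  rewrite (_ : chi _ = fun=> 1); first exact: laurent_repC.
  by apply/funext => t; rewrite mulr0n (gc_chi0 gc).
rewrite mulrS; split; first exact: (gc_SD gc).
rewrite (_ : chi _ = fun t => chi u t * chi (u *+ k) t); first exact: laurent_repM.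
by apply/funext => t; rewrite (gc_chiD gc).
Qed.

Lemma laurent_rep_sum (I : Type) (r : seq I) (F : I -> M) :
  (forall i, S (F i) /\ laurent_rep (chi (F i))) ->
  S (\sum_(i <- r) F i) /\ laurent_rep (chi (\sum_(i <- r) F i)).
Proof.
move=> H; elim: r => [|i r [Sr IH]].
  rewrite big_nil; split; first exact: S0.
  rewrite (_ : chi _ = fun=> 1); first exact: laurent_repC.
  by apply/funext => t; rewrite (gc_chi0 gc).
rewrite big_cons; have [Si ri] := H i; split; first exact: (gc_SD gc).
rewrite (_ : chi _ = fun t => chi (F i) t * chi (\sum_(i <- r) F i) t); first exact: laurent_repM.
by apply/funext => t; rewrite (gc_chiD gc).
Qed.

Lemma laurent_rep_generated v : generated v -> laurent_rep (chi v).
Proof.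
move=> [z [al [Uz ->]]].
have [Sh' rh'] : S (\sum_i h i *+ al i) /\ laurent_rep (chi (\sum_i h i *+ al i)).
  apply: laurent_rep_sum => i; apply: laurent_rep_natmul => //.
  have := laurent_rep_coord (rshift n0 i); by rewrite /chart_coord (unsplitK (inr i)).
rewrite (_ : chi _ = fun t => chi z t * chi (\sum_i h i *+ al i) t); last first.
  by apply/funext => t; rewrite (gc_chiD gc) //; exact: (gc_US gc).
apply: laurent_repM => //; rewrite (gc_Ubasis gc Uz).
have Uw := gc_Uw gc.
apply: (laurent_rep_sum _ _).2 => j.
have rw : laurent_rep (chi (w j)).
  have := laurent_rep_coord (lshift e j); by rewrite /chart_coord (unsplitK (inl j)).
have UNw := gc_UN gc (Uw j).
have rNw : laurent_rep (chi (- w j)).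
  (* The inverse of one basic unit is the product of the others over the product of all. *)
  exists 1%N, (\prod_(i < n0 | i != j) 'X_(lshift e i)) => t.
  rewrite expr1 (bigD1 j) //= mulrC mulrA -(gc_chiD gc); [|exact: (gc_US gc)..].
  rewrite addNr (gc_chi0 gc) mul1r rmorph_prod; apply: eq_bigr => i _.
  by rewrite /= mevalXU /chart_coord (unsplitK (inl i)).
case: (kap j z) => k; first by apply: laurent_rep_natmul => //; exact: (gc_US gc).
by rewrite NegzE mulrNz -mulNrz; apply: laurent_rep_natmul => //; exact: (gc_US gc).
Qed.

Lemma laurent_rep_monomial_sum (s : seq (K * M)) : (forall a, a \in s -> generated a.2) ->
  laurent_rep (monomial_sum s).
Proof.
elim: s => [|a s IH] H.
  rewrite (_ : monomial_sum _ = fun=> 0); first exact: laurent_repC.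
  by apply/funext => t; rewrite /monomial_sum big_nil.
rewrite (_ : monomial_sum _ = fun t => a.1 * chi a.2 t + monomial_sum s t).
  apply: laurent_repD; last by apply: IH => b sb; apply: H; rewrite inE sb orbT.
  apply: (laurent_repM (laurent_repC a.1)); apply: laurent_rep_generated.
  by apply: H; rewrite mem_head.
by apply/funext => t; rewrite /monomial_sum big_cons.
Qed.

Hypothesis gen : forall u, S u -> graded_span (deg u) (chi u).

Lemma laurent_rep_char u : S u -> laurent_rep (chi u).
Proof.
by move=> /gen[s hs ->]; apply: laurent_rep_monomial_sum => a /hs[].
Qed.

Lemma laurent_rep_span f : char_span f -> laurent_rep f.
Proof.
move=> [s Ss ->]; elim: s Ss => [|a s IH] H.
  rewrite (_ : monomial_sum _ = fun=> 0); first exact: laurent_repC.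
  by apply/funext => t; rewrite /monomial_sum big_nil.
rewrite (_ : monomial_sum _ = fun t => a.1 * chi a.2 t + monomial_sum s t).
  apply: laurent_repD; last by apply: IH => b sb; apply: H; rewrite inE sb orbT.
  apply: (laurent_repM (laurent_repC a.1)); apply: laurent_rep_char.
  by apply: H; rewrite mem_head.
by apply/funext => t; rewrite /monomial_sum big_cons.
Qed.

(** After clearing denominators, the [d] independent functions are fractions in at most [d]
    coordinates, so the coordinates are themselves independent. *)
Lemma chart_coord_alg_independent (d : nat) (f : 'I_d -> T -> K) : (n0 + e <= d)%N ->
  (forall i, A (f i)) -> alg_independent f -> alg_independent chart_coord.
Proof.
move=> le fA; have [tau [t1 t2 t3]] := common_clear fA.
have [k [Q hQ]] := laurent_rep_span t1.
have /choice[k' /choice[P hP]] i := laurent_rep_span (t3 i).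
have W0 t m : (\prod_j chi (w j) t) ^+ m != 0.
  rewrite expf_neq0 // prodf_seq_neq0; apply/allP => j _ /=.
  exact: chi_unit (gc_Uw gc j).
apply: (@generators_alg_independent _ _ _ _ _ _ (unit_poly ^+ (\sum_i k' i) * Q)
   (fun i => unit_poly ^+ (\sum_j k' j - k' i + k) * P i) le).
  by move=> t; rewrite mevalM rmorphXn /= unit_polyE -hQ !mulf_neq0.
move=> i t; rewrite !mevalM !rmorphXn /= unit_polyE -hQ -hP exprD.
rewrite -[in LHS](@subnK (k' i) (\sum_i k' i)) ?exprD; last by rewrite (bigD1 i) //= leq_addr.
ring.
Qed.

End Generation.

(** Take [h] of maximal length independent modulo m_x^2; the cotangent dimension bounds this length.
    A further nonunit [u] yields a relation in which the coefficient of [u] cannot vanish. The last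
    clause lets functionals that vanish on the basic units and on 0 be applied to it. *)
Lemma cotangent_family_maximal d : cotangent_dim A x d ->
  exists (e : nat) (h : 'I_e -> M), [/\ forall i, S (h i), forall i, ~ U (h i), (n0 + e <= d)%N
   & forall u, S u -> ~ U u -> exists (c : K) (a : 'I_e -> K) (h' : 'I_e.+1 -> M) (a' : 'I_n0 + 'I_e.+1 -> K),
     [/\ c != 0, forall i, S (h' i),
       max_ideal2 A x (fun t => \sum_i a' i * cotangent_family h' i t)
       & forall F, (forall j, F (w j) = 0) -> F 0 = 0 ->
         \sum_(b <- cotangent_list h' a') b.1 * F b.2 = c * F u + \sum_i a i * F (h i)]].
Proof.
move=> dim.
pose P e := `[< exists h : 'I_e -> M, [/\ forall i, S (h i), forall i, ~ U (h i) & cotangent_free h] >].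
have bound e : P e -> (n0 + e <= d)%N.
  move=> /asboolP[h [Sh nUh free]].
  have := cotangent_dim_ge (gc_subalg gc) dim (cotangent_family_max_ideal Sh nUh) free.
  by rewrite card_sum !card_ord.
have P0 : exists e, P e.
  exists 0%N; apply/asboolP; exists (fun=> 0); split=> [[]|[]|a m2 [l|[]]] //.
  by apply: cotangent_unit_coeff m2 l => -[].
have [e /asboolP[h [Sh nUh free]] maxe] := ex_maxnP P0 (fun e Pe => leq_trans (leq_addl n0 e) (bound e Pe)).
exists e, h; split=> //; first by apply: bound; apply/asboolP; exists h.
move=> u Su nUu.
pose h' (i : 'I_e.+1) := if unlift ord0 i is Some j then h j else u.
have h'0 : h' ord0 = u by rewrite /h' unlift_none.
have h'S i : h' (lift ord0 i) = h i by rewrite /h' liftK.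
have Sh' i : S (h' i) by rewrite /h'; case: unliftP.
have nUh' i : ~ U (h' i) by rewrite /h'; case: unliftP.
have [a' m2 [i ai]] : exists2 a', max_ideal2 A x (fun t => \sum_i a' i * cotangent_family h' i t)
    & exists i, a' i <> 0.
  apply: contrapT => H; suff /maxe : P e.+1 by rewrite ltnn.
  apply/asboolP; exists h'; split=> // a m2 i; apply: contrapT => ai.
  by apply: H; exists a => //; exists i.
exists (a' (inr ord0)), (fun i => a' (inr (lift ord0 i))), h', a'; split=> //.
- apply/eqP => a0; apply: ai; case: i => i.
    exact: (cotangent_unit_coeff Sh' nUh' m2).
  case: (unliftP ord0 i) => [j|] -> //.
  pose a (i : 'I_n0 + 'I_e) := match i with inl j => a' (inl j) | inr j => a' (inr (lift ord0 j)) end.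
  apply: (free a _ (inr j)); congr (max_ideal2 A x _): m2; apply/funext => t.
  rewrite !big_sumType /= big_ord_recl a0 mul0r add0r; congr (_ + _).
  by apply: eq_bigr => k _; rewrite h'S.
move=> F Fw F0; rewrite cotangent_listE big1 => [|j _]; last by rewrite Fw F0 mulr0 subr0 mulr0.
by rewrite add0r big_ord_recl h'0; congr (_ + _); apply: eq_bigr => k _; rewrite h'S.
Qed.

(** Graded Nakayama: modulo m_x^2 a nonunit [u] is a combination of the [h i]. Projecting this to
    the degree of [u] turns the m_x^2 part into products of characters of smaller weight, which are
    generated by induction. *)
Theorem smooth_generators : smooth_point A x ->
  exists (e : nat) (h : 'I_e -> M), [/\ forall i, S (h i), forall i, ~ U (h i),
    alg_independent (chart_coord h) & forall u, S u -> graded_span h (deg u) (chi u)].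
Proof.
move=> [d dim [[f [fA indep]] _]].
have [e [h [Sh nUh le ext]]] := cotangent_family_maximal dim.
suff gen u : S u -> graded_span h (deg u) (chi u).
  by exists e, h; split=> //; exact: (chart_coord_alg_independent Sh gen le fA indep).
have [N] := ubnP (`|wt (deg u)|%N); elim: N u => // N IH u leN Su.
have [Uu|nUu] := pselect (U u); first by apply: graded_span_char; exact: generatedU.
have [c [a [h' [a' [c0 Sh' m2 E]]]]] := ext u Su nUu.
rewrite -(cotangent_list_sum h' a') in m2.
have [s' ds' Es'] := shifted_max_ideal2 (@cotangent_listS _ _ Sh' a') m2.
(* As [u] is not a unit, [shifted t u] vanishes on all units; it maps [u] to [chi u t], so the
   relation can be solved for [chi u]. *)
have -> : chi u = (fun t => c^-1 * (\sum_(b <- s') b.1 * shifted t u b.2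
    + -1 * \sum_(b <- [seq (a i, h i) | i <- index_enum 'I_e]) b.1 * shifted t u b.2)).
  apply/funext => t; rewrite -Es' E ?shifted_self //.
  - by rewrite big_map /= mulN1r addrK mulKf.
  - by move=> j; apply: shifted_nonunit => //; exact: (gc_Uw gc).
  - by apply: shifted_nonunit => //; exact: (gc_U0 gc).
have wt_lt p : S p -> (0 <= wt (deg p)) by exact: (gc_wt_ge0 gc).
apply: graded_spanZ; apply: graded_spanD; last apply: graded_spanZ.
  apply: (graded_span_sum (F := fun v t => shifted t u v)) => b /ds'.
  move=> [p [q [Sp nUp Sq nUq Eb]]]; rewrite Eb.
  have [cl|ncl] := boolP (unit_class u (p + q)); last first.
    by rewrite /shifted (negbTE ncl); exact: graded_span0.
  have [Uz dz] := unit_shiftP cl.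
  have wu : wt (deg u) = wt (deg p) + wt (deg q).
    have := congr1 wt dz; rewrite !raddfD (gc_wtU gc Uz) addr0 => <-; by [].
  have pos v : S v -> ~ U v -> 0 < wt (deg v).
    move=> Sv nUv; rewrite lt_neqAle wt_lt // andbT eq_sym; apply/eqP => /(gc_wt_eq0 gc Sv) //.
  have wp := pos p Sp nUp; have wq := pos q Sq nUq.
  apply: (graded_span_shifted Sh); last exact: (gc_SD gc).
  have -> : deg (p + q) = deg p + deg q by exact: raddfD.
  rewrite (_ : chi (p + q) = fun t => chi p t * chi q t); last first.
    by apply/funext => t; rewrite (gc_chiD gc).
  by apply: graded_spanM => //; apply: IH => //; lia.
apply: (graded_span_sum (F := fun v t => shifted t u v)) => _ /mapP[i _ ->] /=.
by apply: graded_span_shifted => //; apply: graded_span_char; exact: generated_h.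
Qed.

End CharacterAlgebras.

(** * Generators as prime elements and their orders of vanishing *)

Section KillVariables.
Variables (K : fieldType) (d : nat).

Definition kill_vars (Z : pred 'I_d) (P : {mpoly K[d]}) : {mpoly K[d]} :=
  P \mPo [tuple if Z j then 0 else 'X_j | j < d].

Lemma kill_varsM Z P Q : kill_vars Z (P * Q) = kill_vars Z P * kill_vars Z Q.
Proof. exact: rmorphM. Qed.

Lemma kill_vars_exp Z P n : kill_vars Z (P ^+ n) = kill_vars Z P ^+ n.
Proof. exact: rmorphXn. Qed.

Lemma kill_varsX Z j : kill_vars Z 'X_j = if Z j then 0 else 'X_j.
Proof. by rewrite /kill_vars comp_mpolyXU -tnth_nth tnth_mktuple. Qed.

Lemma kill_vars_eq0 k P : kill_vars (pred1 k) P = 0 -> exists G, P = 'X_k * G.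
Proof.
pose good P := exists G, P = kill_vars (pred1 k) P + 'X_k * G.
have goodC c : good c%:MP by exists 0; rewrite mulr0 addr0 /kill_vars comp_mpolyC.
have goodX j : good 'X_j.
  rewrite /good kill_varsX /=; case: eqP => [->|_]; first by exists 1; rewrite add0r mulr1.
  by exists 0; rewrite mulr0 addr0.
have goodD F F' : good F -> good F' -> good (F + F').
  move=> [G EF] [G' EF']; exists (G + G').
  by rewrite [in LHS]EF [in LHS]EF' /kill_vars raddfD /= mulrDr addrACA.
have goodM F F' : good F -> good F' -> good (F * F').
  move=> [G EF] [G' EF']; exists (G * F' + kill_vars (pred1 k) F * G').
  rewrite kill_varsM {1}EF mulrDl {1}EF'; ring.
suff [G E] : good P by move=> P0; exists G; rewrite {1}E P0 add0r.
rewrite [P]mpolyE; elim/big_ind: _ => [||m _].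
- exact: (goodC 0).
- exact: goodD.
rewrite -mul_mpolyC; apply: (goodM) => //; rewrite mpolyXE_id; elim/big_ind: _ => [||i _].
- exact: (goodC 1).
- exact: goodM.
by elim: (m i) => [|n IH]; rewrite ?expr0 ?exprS; [exact: (goodC 1) | exact: goodM].
Qed.

End KillVariables.

Lemma int_le_muln (n : nat) (b : int) : 0 < b -> n%:Z <= b *+ n.
Proof. by move=> b0; rewrite -mulr_natl natz ler_peMr. Qed.

Section PrimeGenerators.
Variables (K : closedFieldType) (T : Type) (M D : zmodType).
Variables (deg : {additive M -> D}) (wt : {additive D -> int}).
Variables (S U : set M) (chi : M -> T -> K).
Variables (A : set (T -> K)) (n0 : nat) (w : 'I_n0 -> M) (kap : 'I_n0 -> {additive M -> int}).
Hypothesis gc : graded_characters deg wt S U chi A w kap.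
Variables (R : finType) (ord : R -> {additive M -> int}) (pt : R -> T) (fu gu : R -> M).
(* ord rho is the order of vanishing along the prime divisor of the ray rho, and pt rho
   a point of that divisor lying on no other one. *)
Hypotheses (ord_ge0 : forall rho u, S u -> 0 <= ord rho u)
  (ordB : forall u v, S u -> S v -> (forall rho, ord rho v <= ord rho u) -> S (u - v))
  (ordU : forall u, S u -> (forall rho, ord rho u = 0) -> U u)
  (chi_pt : forall rho u, S u -> chi u (pt rho) != 0 <-> ord rho u = 0)
  (Sfu : forall rho, S (fu rho)) (fu0 : forall rho, ord rho (fu rho) = 0)
  (fu_gt0 : forall rho rho', rho' != rho -> 0 < ord rho' (fu rho))
  (Sgu : forall rho, S (gu rho)) (gu1 : forall rho, ord rho (gu rho) = 1).
Variables (e : nat) (h : 'I_e -> M).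
Hypotheses (Sh : forall i, S (h i)) (nUh : forall i, ~ U (h i))
  (indep : alg_independent (chart_coord chi w h))
  (rep : forall u, S u -> laurent_rep chi w h (chi u)).

Let W := unit_poly K n0 e.
Let y t := fun i => chart_coord chi w h i t.

Lemma chiX u k t : S u -> S (u *+ k) /\ chi (u *+ k) t = chi u t ^+ k.
Proof.
move=> Su; elim: k => [|k [Sk IH]]; first by rewrite mulr0n (gc_chi0 gc); split=> //; exact: (S0 gc).
by rewrite mulrS exprS (gc_chiD gc) // IH; split=> //; exact: (gc_SD gc).
Qed.

Lemma mpoly_ident P Q : (forall t, P.@[y t] = Q.@[y t]) -> P = Q.
Proof.
move=> H; apply/eqP; rewrite -subr_eq0; apply/eqP; apply: indep => t.
by rewrite mevalB H subrr.
Qed.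

Lemma W_neq0 t : W.@[y t] != 0.
Proof.
rewrite unit_polyE prodf_seq_neq0; apply/allP => j _ /=; exact: (chi_unit gc _ (gc_Uw gc j)).
Qed.

Lemma W_neq0' : W != 0.
Proof. by rewrite prodf_seq_neq0; apply/allP => j _ /=; rewrite -msize_poly_eq0 msizeX. Qed.

Lemma kill_W (Z : pred 'I_(n0 + e)) : (forall j, ~~ Z (lshift e j)) -> kill_vars Z W = W.
Proof.
move=> HZ; rewrite /kill_vars rmorph_prod /=; apply: eq_bigr => j _.
by rewrite -/(kill_vars _ _) kill_varsX (negbTE (HZ j)).
Qed.

Lemma y_h t i : y t (rshift n0 i) = chi (h i) t.
Proof. by rewrite /y /chart_coord (unsplitK (inr i)). Qed.

(* Algebraic independence makes chi (h i) a prime element of a Laurent polynomial ring. *)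
Lemma prime_generator (P Q V : {mpoly K[n0 + e]}) (a b : nat) i :
  (forall t, W.@[y t] ^+ a * P.@[y t] * Q.@[y t] = W.@[y t] ^+ b * chi (h i) t * V.@[y t]) ->
  kill_vars (pred1 (rshift n0 i)) P = 0 \/ kill_vars (pred1 (rshift n0 i)) Q = 0.
Proof.
move=> E; have : W ^+ a * P * Q = W ^+ b * 'X_(rshift n0 i) * V.
  by apply: mpoly_ident => t; rewrite !mevalM !rmorphXn /= mevalXU y_h E.
move/(congr1 (kill_vars (pred1 (rshift n0 i)))); rewrite !kill_varsM kill_varsX /= eqxx mulr0 mul0r => /eqP.
rewrite kill_vars_exp kill_W => [|j]; last by rewrite /= eq_lrshift.
rewrite !mulf_eq0 expf_eq0 (negbTE W_neq0') andbF /=.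
by move=> /orP[] /eqP; [left|right].
Qed.

(** The hypothesis on [P] says that [chi (h i)] divides [chi u] up to units, and a divisor of a
    function that is nonzero at [pt rho] is nonzero there. *)
Lemma kill_generator_ord i u k P rho : S u ->
  (forall t, (\prod_j chi (w j) t) ^+ k * chi u t = P.@[y t]) ->
  kill_vars (pred1 (rshift n0 i)) P = 0 -> ord rho u = 0 -> ord rho (h i) = 0.
Proof.
move=> Su E /kill_vars_eq0[G EP] /(chi_pt rho Su) u0; apply/(chi_pt rho (Sh i)).
have := E (pt rho); rewrite EP mevalM mevalXU y_h -(unit_polyE chi w h) => h0.
have : W.@[y (pt rho)] ^+ k * chi u (pt rho) != 0 by rewrite mulf_neq0 ?expf_neq0 ?W_neq0.
by rewrite [X in X != 0]h0 mulf_eq0 negb_or => /andP[].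
Qed.

(** High powers of [fu rho] and [fu rho'] have a product divisible by the prime [chi (h i)], so one
    of the two is divisible. But [fu rho] does not vanish along [rho], nor [fu rho'] along [rho'],
    where [h i] does. *)
Lemma generator_support i rho rho' : 0 < ord rho (h i) -> 0 < ord rho' (h i) -> rho = rho'.
Proof.
move=> p p'; apply/eqP; apply: contraT => ne.
(* A common bound for all orders of [h i]. Every ray has positive order on one of the two functions,
   so their [n]-th powers together dominate [h i]. *)
pose n := (\sum_r `|ord r (h i)|)%N.
have hn r : ord r (h i) <= n%:Z.
  have : (`|ord r (h i)| <= n)%N by rewrite /n (bigD1 r) //= leq_addr.
  lia.
have [Sa _] := chiX n (pt rho) (Sfu rho); have [Sb _] := chiX n (pt rho) (Sfu rho').
have Sv : S (fu rho *+ n + fu rho' *+ n - h i).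
  apply: ordB => //; first exact: (gc_SD gc).
  move=> r; rewrite raddfD !raddfMn /=; apply: le_trans (hn r) _.
  have ge0 q : 0 <= ord r (fu q) by exact: ord_ge0.
  have [rr|rr] := eqVneq r rho.
    have : 0 < ord r (fu rho') by apply: fu_gt0; rewrite rr.
    by move/(int_le_muln n)/le_trans; apply; rewrite lerDr mulrn_wge0.
  have : 0 < ord r (fu rho) by apply: fu_gt0.
  by move/(int_le_muln n)/le_trans; apply; rewrite lerDl mulrn_wge0.
have [ka [Pa Ea]] := rep Sa; have [kb [Pb Eb]] := rep Sb; have [kv [Pv Ev]] := rep Sv.
have [|/(kill_generator_ord Sa Ea) k0|/(kill_generator_ord Sb Eb) k0] :=
  @prime_generator Pa Pb Pv kv (ka + kb) i.
- move=> t; rewrite -Ea -Eb -Ev -!(unit_polyE chi w h).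
  have := gc_chiD gc t (Sh i) Sv; rewrite addrC subrK (gc_chiD gc) // => E.
  rewrite exprD; set z := W.@[_]; transitivity (z ^+ kv * z ^+ ka * z ^+ kb *
    (chi (fu rho *+ n) t * chi (fu rho' *+ n) t)); first by rewrite /z /W; ring.
  by rewrite E /z /W; ring.
- by move: p; rewrite (k0 rho) ?ltxx // raddfMn /= fu0 mul0rn.
- by move: p'; rewrite (k0 rho') ?ltxx // raddfMn /= fu0 mul0rn.
Qed.

(** If [h i] has order [n] along [rho], then it divides the [n]-th power of [gu rho], hence by
    primality [gu rho] itself. For [n] at least 2, the quotient of that power by [h i] would still
    be divisible by [h i], although it has order zero along [rho]. *)
Lemma generator_multiplicity i rho : 0 < ord rho (h i) -> ord rho (h i) = 1.
Proof.
move=> p; have h0 r : r != rho -> ord r (h i) = 0.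
  move=> rr; have := ord_ge0 r (Sh i); rewrite le_eqVlt => /orP[/eqP //|p'].
  by rewrite (generator_support p' p) eqxx in rr.
pose n := `|ord rho (h i)|%N; have En : ord rho (h i) = n%:Z by rewrite /n gez0_abs // ltW.
have n0' : (0 < n)%N by rewrite En in p.
have [Sa _] := chiX n (pt rho) (Sgu rho).
have Sv : S (gu rho *+ n - h i).
  apply: ordB => // r; rewrite raddfMn /=; have [->|rr] := eqVneq r rho.
    by rewrite gu1 En natz.
  by rewrite h0 // mulrn_wge0 // ord_ge0.
have [kg [Pg Eg]] := rep (Sgu rho); have [kv [Pv Ev]] := rep Sv.
have Ech t : chi (gu rho) t ^+ n = chi (h i) t * chi (gu rho *+ n - h i) t.
  by rewrite -(gc_chiD gc) // addrC subrK (chiX n t (Sgu rho)).2.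
have kill0 : kill_vars (pred1 (rshift n0 i)) Pg = 0.
  have [|/eqP|/eqP] := @prime_generator (Pg ^+ n) 1 Pv kv (kg * n) i.
  - move=> t; rewrite meval1 mulr1 rmorphXn /= -Eg -Ev -!(unit_polyE chi w h).
    rewrite exprMn Ech -exprM; ring.
  - by rewrite kill_vars_exp expf_eq0 => /andP[_ /eqP].
  - by rewrite /kill_vars rmorph1 oner_eq0.
have [G EG] := kill_vars_eq0 kill0.
have E : W ^+ kv * 'X_(rshift n0 i) ^+ n.-1 * G ^+ n = W ^+ (kg * n) * Pv.
  have X0 : 'X_(rshift n0 i) != 0 :> {mpoly K[n0 + e]} by rewrite -msize_poly_eq0 msizeX.
  apply: (mulfI X0); apply: mpoly_ident => t; rewrite !mevalM !rmorphXn /= mevalXU y_h -Ev.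
  have := congr1 (fun z => z ^+ n) (Eg t : _ = Pg.@[y t]); rewrite EG mevalM mevalXU y_h !exprMn Ech -(unit_polyE chi w h).
  rewrite -exprM -[in X in _ = X * _](prednK n0') exprS => E.
  transitivity (W.@[y t] ^+ kv * (chi (h i) t * chi (h i) t ^+ n.-1 * G.@[y t] ^+ n)); first by ring.
  by rewrite -[X in _ * X]E /W; ring.
have [n1|n1] := leqP n 1; first by rewrite En; move: n0' n1; case: n {En Sa Sv Ev Ech E} => [|[]].
have v0 : ord rho (gu rho *+ n - h i) = 0 by rewrite raddfB raddfMn /= gu1 En; ring.
have := congr1 (fun F => F.@[y (pt rho)]) E; rewrite /= !mevalM !rmorphXn /= mevalXU y_h -Ev.
have -> : chi (h i) (pt rho) = 0.
  by apply: contrapT => /eqP /(chi_pt rho (Sh i)) /eqP; rewrite gt_eqF.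
move=> /esym; rewrite expr0n -(unit_polyE chi w h) (_ : (n.-1 == 0)%N = false); last first.
  by move: n1; case: n {En Sa Sv Ev Ech E v0 n0'} => [|[]].
have : W.@[y (pt rho)] ^+ (kg * n) * (W.@[y (pt rho)] ^+ kv * chi (gu rho *+ n - h i) (pt rho)) != 0.
  by rewrite !mulf_neq0 ?expf_neq0 ?W_neq0 //; apply/(chi_pt rho Sv).
by move=> h1 h2; rewrite [X in X != 0]h2 mulr0 mul0r eqxx in h1.
Qed.

Theorem generator_is_ray i : exists rho, forall rho', ord rho' (h i) = (rho' == rho)%:Z.
Proof.
have [rho p] : exists rho, 0 < ord rho (h i).
  apply: contrapT => H; apply: (nUh (i := i)); apply: ordU => // rho; apply/eqP.
  rewrite eq_le ord_ge0 // andbT leNgt; apply/negP => p; apply: H; by exists rho.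
exists rho => rho'; have [->|ne] := eqVneq; first exact: generator_multiplicity.
apply/eqP; rewrite eq_le ord_ge0 // andbT leNgt; apply/negP => p'.
by rewrite (generator_support p' p) eqxx in ne.
Qed.

End PrimeGenerators.

(** * Polyhedral cones and fans *)

Section Dot.
Variables (R : comPzRingType) (N : nat).
Implicit Types u x : 'cV[R]_N.

Lemma dotC u x : dot u x = dot x u.
Proof. by apply: eq_bigr => i _; rewrite mulrC. Qed.

Lemma dotDr u x y : dot u (x + y) = dot u x + dot u y.
Proof. by rewrite /dot -big_split; apply: eq_bigr => i _; rewrite mxE mulrDr. Qed.

Lemma dotZr u c x : dot u (c *: x) = c * dot u x.
Proof. by rewrite /dot mulr_sumr; apply: eq_bigr => i _; rewrite mxE mulrCA. Qed.

Lemma dotNr u x : dot u (- x) = - dot u x.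
Proof. by rewrite -scaleN1r dotZr mulN1r. Qed.

Lemma dot0r u : dot u 0 = 0.
Proof. by rewrite /dot big1 // => i _; rewrite mxE mulr0. Qed.

Lemma dot_sumr (I : Type) (s : seq I) (P : pred I) (F : I -> 'cV[R]_N) u :
  dot u (\sum_(i <- s | P i) F i) = \sum_(i <- s | P i) dot u (F i).
Proof. by elim/big_rec2: _ => [|i a b _ <-]; [exact: dot0r | rewrite dotDr]. Qed.

Lemma dotDl u x y : dot (u + x) y = dot u y + dot x y.
Proof. by rewrite dotC dotDr !(dotC y). Qed.

Lemma dotZl c u x : dot (c *: u) x = c * dot u x.
Proof. by rewrite dotC dotZr dotC. Qed.

Lemma dotNl u x : dot (- u) x = - dot u x.
Proof. by rewrite dotC dotNr dotC. Qed.

Lemma dotBl u x y : dot (u - x) y = dot u y - dot x y.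
Proof. by rewrite dotDl dotNl. Qed.

Lemma dotMnl u k x : dot (u *+ k) x = dot u x *+ k.
Proof. by rewrite -scaler_nat dotZl mulr_natl. Qed.

Lemma dot0l u : dot 0 u = 0.
Proof. by rewrite dotC dot0r. Qed.

Lemma dot_suml (I : Type) (s : seq I) (P : pred I) (F : I -> 'cV[R]_N) u :
  dot (\sum_(i <- s | P i) F i) u = \sum_(i <- s | P i) dot (F i) u.
Proof. by rewrite dotC dot_sumr; apply: eq_bigr => i _; rewrite dotC. Qed.

Lemma dot_delta i x : dot (delta_mx i 0) x = x i 0.
Proof.
rewrite /dot (bigD1 i) //= mxE !eqxx mul1r big1 ?addr0 // => j /negbTE ji.
by rewrite mxE ji mul0r.
Qed.

Lemma dot_is_zmod_morphism u : zmod_morphism (dot u).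
Proof. by move=> x y; rewrite dotDr dotNr. Qed.

HB.instance Definition _ u :=
  GRing.isZmodMorphism.Build 'cV[R]_N R (dot u) (dot_is_zmod_morphism u).

End Dot.

Lemma dot_self_gt0 (R : realFieldType) (N : nat) (x : 'cV[R]_N) : x != 0 -> 0 < dot x x.
Proof.
move=> x0; rewrite lt_neqAle sumr_ge0 ?andbT => [|i _]; last exact: sqr_ge0.
apply: contra x0 => /eqP/esym/eqP; rewrite psumr_eq0 => [|i _]; last exact: sqr_ge0.
move=> /allP h; apply/eqP/colP => i; rewrite mxE; apply/eqP.
by have := h i (mem_index_enum i); rewrite -expr2 sqrf_eq0.
Qed.

Lemma small_scale (R : realFieldType) (m : nat) (a b : 'I_m -> R) : (forall i, 0 < a i) ->
  exists2 eps, 0 < eps & forall i, 0 < a i - eps * b i.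
Proof.
elim: m a b => [|m IH] a b a0; first by exists 1 => // -[].
have [eps e0 H] := IH (fun i => a (lift ord0 i)) (fun i => b (lift ord0 i)) (fun i => a0 _).
pose q := a ord0 / (1 + `|b ord0|).
have b1 : 0 < 1 + `|b ord0| by rewrite ltr_pwDl.
have q0 : 0 < q by rewrite divr_gt0.
exists (Num.min eps (q / 2)); first by rewrite lt_min e0 divr_gt0.
have step (e' c d : R) : 0 < e' -> 0 < c - e' * d -> 0 < c -> forall e, 0 < e -> e <= e' -> 0 < c - e * d.
  move=> e'0 h c0 e ee0 le; case: (leP d 0) => d0; first by nra.
  by apply: lt_le_trans h _; nra.
move=> i; case: (unliftP ord0 i) => [j|] ->.
  by apply: (step eps) => //; rewrite ?ge_min ?lexx // lt_min e0 divr_gt0.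
apply: (step (q / 2)) => //; rewrite ?ge_min ?lexx ?orbT ?divr_gt0 // ?lt_min ?e0 ?divr_gt0 //.
have Ea : a ord0 = q * (1 + `|b ord0|) by rewrite /q divfK // gt_eqF.
rewrite Ea; have := ler_norm (b ord0); nra.
Qed.

(** Gordan's alternative by induction on the number of vectors. A functional positive on all but
    [p ord0] is adjusted according to its sign there: if negative, [p ord0] is eliminated as in
    Fourier-Motzkin elimination; if zero, a small multiple of [p ord0] is added. *)
Lemma gordan (R : realFieldType) (N m : nat) (p : 'I_m -> 'cV[R]_N) :
  (exists u, forall i, 0 < dot u (p i)) \/
  (exists a : 'I_m -> R, [/\ forall i, 0 <= a i, exists i, a i != 0 & \sum_i a i *: p i = 0]).
Proof.
elim: m p => [|m IH] p; first by left; exists 0 => -[].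
have [[u hu]|[a [a0 [i ai] sa]]] := IH (fun i => p (lift ord0 i)); last first.
  right; exists (fun i => if unlift ord0 i is Some j then a j else 0); split.
  - by move=> j; case: unliftP.
  - by exists (lift ord0 i); rewrite liftK.
  rewrite big_ord_recl unlift_none scale0r add0r -[RHS]sa.
  by apply: eq_bigr => j _; rewrite liftK.
case: (ltgtP 0 (dot u (p ord0))) => [pos|neg|zero].
- by left; exists u => i; case: (unliftP ord0 i) => [j|] ->.
(* With these coefficients [p (lift ord0 j) + kap j *: p ord0] is orthogonal to [u], so that adding
   multiples of [u] does not disturb its sign. *)
- pose kap j := dot u (p (lift ord0 j)) / - dot u (p ord0).
  have kap0 j : 0 < kap j by rewrite divr_gt0 // oppr_gt0.
  have [[u' hu']|[a [a0 [i ai] sa]]] := IH (fun j => p (lift ord0 j) + kap j *: p ord0).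
    have [eps e0 he] := small_scale kap hu'.
    (* The multiple of [u] is chosen so that the value on [p ord0] becomes [eps]. *)
    left; exists (u' + ((eps - dot u' (p ord0)) / dot u (p ord0)) *: u) => i.
    rewrite dotDl dotZl; case: (unliftP ord0 i) => [j|] ->; last first.
      by rewrite divfK ?lt_eqF // addrC subrK.
    have := he j; rewrite dotDr dotZr.
    suff -> : (eps - dot u' (p ord0)) / dot u (p ord0) * dot u (p (lift ord0 j))
        = - kap j * (eps - dot u' (p ord0)) by lra.
    by rewrite /kap; field; rewrite lt_eqF.
  right; exists (fun i => if unlift ord0 i is Some j then a j else \sum_j a j * kap j); split.
  - move=> j; case: unliftP => // _; apply: sumr_ge0 => k _; by rewrite mulr_ge0 // ltW.
  - by exists (lift ord0 i); rewrite liftK.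
  rewrite big_ord_recl unlift_none -[RHS]sa addrC scaler_suml -big_split.
  by apply: eq_bigr => j _ /=; rewrite liftK scalerDr scalerA.
have [p0|p0] := eqVneq (p ord0) 0.
  right; exists (fun i => (i == ord0)%:R); split=> [i||]; first by rewrite ler0n.
    by exists ord0; rewrite eqxx oner_neq0.
  by rewrite big_ord_recl p0 scaler0 add0r big1 // => i _; rewrite scale0r.
have [eps e0 he] := small_scale (fun j => - dot (p ord0) (p (lift ord0 j))) hu.
left; exists (u + eps *: p ord0) => i; rewrite dotDl dotZl.
case: (unliftP ord0 i) => [j|] ->; first by have := he j; lra.
by rewrite -zero add0r mulr_gt0 // dot_self_gt0.
Qed.

Section ConeBasics.
Variable N : nat.
Implicit Types (G C sigma : set 'cV[rat]_N).

Definition convex_cone C : Prop :=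
  [/\ C 0, forall x y, C x -> C y -> C (x + y) & forall c x, 0 <= c -> C x -> C (c *: x)].

Lemma cone_convex G : convex_cone (cone G).
Proof.
split.
- by exists 0%N, (fun=> 0), (fun=> 0); split=> [[]//|]; rewrite big_ord0.
- move=> x y [k [a [z [H ->]]]] [k' [a' [z' [H' ->]]]].
  exists (k + k')%N, (fun i => match split i with inl j => a j | inr j => a' j end),
    (fun i => match split i with inl j => z j | inr j => z' j end); split.
    by move=> i; case: (split i).
  rewrite big_split_ord /=; congr (_ + _); apply: eq_bigr => i _.
    by rewrite (unsplitK (inl i)).
  by rewrite (unsplitK (inr i)).
- move=> c x c0 [k [a [z [H ->]]]]; exists k, (fun i => c * a i), z; split.
    by move=> i; have [? ?] := H i; rewrite mulr_ge0.
  by rewrite scaler_sumr; apply: eq_bigr => i _; rewrite scalerA.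
Qed.

Lemma cone_gen G x : G x -> cone G x.
Proof.
move=> Gx; exists 1%N, (fun=> 1), (fun=> x); split=> [i|]; first by rewrite ler01.
by rewrite big_ord1 scale1r.
Qed.

Lemma convex_cone_sum C (I : Type) (s : seq I) (P : pred I) (F : I -> 'cV[rat]_N) :
  convex_cone C -> (forall i, P i -> C (F i)) -> C (\sum_(i <- s | P i) F i).
Proof. by move=> [C0 CD _] H; elim/big_ind: _. Qed.

Lemma cone_min G C : convex_cone C -> G `<=` C -> cone G `<=` C.
Proof.
move=> cC GC x [k [a [z [H ->]]]]; apply: (convex_cone_sum _ cC) => i _.
by case: cC => _ _ CZ; have [? ?] := H i; apply: CZ => //; exact: GC.
Qed.

Lemma cone_mono G G' : G `<=` G' -> cone G `<=` cone G'.
Proof.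
by move=> GG'; apply: cone_min; [exact: cone_convex | move=> x /GG' /cone_gen].
Qed.

Lemma convex_cone_ge0 u : convex_cone [set x : 'cV[rat]_N | 0 <= dot u x].
Proof.
split=> /= [|x y hx hy|c x c0 hx]; first by rewrite dot0r.
  by rewrite dotDr addr_ge0.
by rewrite dotZr mulr_ge0.
Qed.

Lemma rayP (x y : 'cV[rat]_N) : ray x y <-> exists2 c, 0 <= c & y = c *: x.
Proof.
split=> [|[c c0 ->]]; last first.
  have [_ _ CZ] := cone_convex [set x]; apply: CZ => //; exact: cone_gen.
apply: (@cone_min _ [set y | exists2 c, 0 <= c & y = c *: x]).
  split=> /=; first by exists 0; rewrite ?scale0r.
    move=> z z' [c c0 ->] [c' c0' ->]; exists (c + c'); by rewrite ?addr_ge0 ?scalerDl.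
  move=> b z b0 [c c0 ->]; exists (b * c); by rewrite ?mulr_ge0 ?scalerA.
by move=> z ->; exists 1; rewrite ?ler01 ?scale1r.
Qed.

Lemma polyhedral_convex sigma : polyhedral sigma -> convex_cone sigma.
Proof. by move=> [G _ ->]; exact: cone_convex. Qed.

Lemma irredundant_generators sigma : polyhedral sigma ->
  exists2 s : seq 'cV[rat]_N, sigma = cone [set` s] &
    forall g, g \in s -> ~ cone [set` rem g s] g.
Proof.
move=> [G /finite_seqP[s0 ->] ->].
have [n le] := ubnP (size s0); elim: n s0 le => // n IH s le.
have [irr|] := pselect (forall g, g \in s -> ~ cone [set` rem g s] g); first by exists s.
move=> /existsNP[g /not_implyP[gs /contrapT gc]].
have -> : cone [set` s] = cone [set` rem g s].
  apply/seteqP; split; last by apply: cone_mono => x /= /mem_rem.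
  apply: cone_min; first exact: cone_convex.
  move=> x /= xs; have [->//|xg] := eqVneq x g; apply: cone_gen => /=.
  by move: xs; rewrite (perm_mem (perm_to_rem gs)) inE (negbTE xg).
by apply: IH; rewrite size_rem //; case: s gs le {gc}.
Qed.

(** Irredundant generators span exposed rays. Project the others along [g] and apply Gordan's
    alternative: either a functional vanishes on [g] and is positive on the others, or a nonnegative
    combination of the others equals [b *: g]. The latter contradicts pointedness if [b] is at most
    0 and irredundance otherwise. *)
Lemma generated_by_exposed_rays sigma : polyhedral sigma -> pointed_cone sigma ->
  sigma = cone [set g | [/\ sigma g, g <> 0 & face (ray g) sigma]].
Proof.
move=> ps pt; have cs := polyhedral_convex ps; have [C0 CD CZ] := cs.
have [s Es irr] := irredundant_generators ps.
have sg g : g \in s -> sigma g by move=> gs; rewrite Es; exact: cone_gen.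
have nz g : g \in s -> g <> 0.
  move=> gs g0; apply: (irr g gs); rewrite {2}g0.
  by have [] := cone_convex [set` rem g s].
apply/seteqP; split; last by apply: cone_min => // g [].
rewrite {1}Es; apply: cone_mono => g /= gs; split; [exact: sg | exact: nz |].
pose s' := rem g s.
have s's i : s'`_i \in s \/ s'`_i = 0.
  have [lt|ge] := ltnP i (size s'); last by right; rewrite nth_default.
  by left; apply: (@mem_rem _ g); rewrite mem_nth.
have gg0 : 0 < dot g g by apply: dot_self_gt0; apply/eqP; exact: nz.
pose pr y := y - (dot y g / dot g g) *: g.
have [[u hu]|[a [a0 [i ai] sa]]] := gordan (fun i : 'I_(size s') => pr s'`_i).
  pose u' := u - (dot u g / dot g g) *: g.
  have u'g : dot u' g = 0 by rewrite dotBl dotZl divfK ?subrr // gt_eqF.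
  have u's (i : 'I_(size s')) : 0 < dot u' s'`_i.
    have := hu i; rewrite /pr /u' dotBl dotZl dotDr dotNr dotZr.
    suff -> : dot s'`_i g / dot g g * dot u g = dot u g / dot g g * dot g s'`_i by [].
    rewrite (dotC _ g); ring.
  pose C := [set x : 'cV[rat]_N | exists c z, [/\ 0 <= c, z = 0 \/ 0 < dot u' z & x = c *: g + z]].
  have cC : convex_cone C.
    split=> /=.
    - by exists 0, 0; split; rewrite ?scale0r ?addr0 //; left.
    - move=> _ _ [c [z [c0 hz ->]]] [c' [z' [c0' hz' ->]]]; exists (c + c'), (z + z'); split.
      + exact: addr_ge0.
      + case: hz hz' => [->|hz] [->|hz']; rewrite ?add0r ?addr0; [by left|by right..|].
        by right; rewrite dotDr addr_gt0.
      by rewrite scalerDl addrACA.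
    move=> b _ b0 [c [z [c0 hz ->]]]; exists (b * c), (b *: z); split.
    - exact: mulr_ge0.
    - move: b0; rewrite le_eqVlt => /orP[/eqP <-|b0]; first by left; rewrite scale0r.
      case: hz => [->|hz]; first by left; rewrite scaler0.
      by right; rewrite dotZr mulr_gt0.
    by rewrite scalerDr scalerA.
  have sC x : sigma x -> C x.
    rewrite Es; apply: cone_min => // y /= ys.
    have [->|yg] := eqVneq y g; first by exists 1, 0; split; rewrite ?ler01 ?scale1r ?addr0 //; left.
    have ys' : y \in s' by move: ys; rewrite (perm_mem (perm_to_rem gs)) inE (negbTE yg).
    exists 0, y; split; rewrite ?scale0r ?add0r //; right.
    have lt : (index y s' < size s')%N by rewrite index_mem.
    by have := u's (Ordinal lt); rewrite /= nth_index.
  exists u'; split=> [x /sC[c [z [c0 hz ->]]]|].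
    rewrite dotDr dotZr u'g mulr0 add0r; case: hz => [->|/ltW //]; by rewrite dot0r.
  apply/seteqP; split=> [x /rayP[c c0 ->]|x [/sC[c [z [c0 hz ->]]] /=]].
    by split; [apply: CZ => //; exact: sg | rewrite /= dotZr u'g mulr0].
  rewrite dotDr dotZr u'g mulr0 add0r; case: hz => [-> _|hz hz0].
    by rewrite addr0; apply/rayP; exists c.
  by rewrite hz0 ltxx in hz.
pose b := \sum_i a i * (dot s'`_i g / dot g g).
have sab : \sum_i a i *: s'`_i = b *: g.
  apply/eqP; rewrite -subr_eq0 -[X in _ == X]sa; apply/eqP.
  rewrite /b scaler_suml -sumrB; apply: eq_bigr => j _.
  by rewrite /pr scalerBr scalerA.
have sumC (P : pred 'I_(size s')) (C : set 'cV[rat]_N) : convex_cone C ->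
    (forall y, y \in s' -> C y) -> C (\sum_(j | P j) a j *: s'`_j).
  move=> cC H; apply: convex_cone_sum => // j _; case: (cC) => _ _ CZ'.
  by apply: CZ' => //; apply: H; rewrite mem_nth.
have [b0|b0] := leP b 0.
  have ys : s'`_i \in s by apply: (@mem_rem _ g); rewrite mem_nth.
  case: (nz _ ys); suff /eqP : a i *: s'`_i = 0 by rewrite scaler_eq0 (negbTE ai) => /eqP.
  apply: pt; first by apply: CZ => //; exact: sg.
  have -> : - (a i *: s'`_i) = \sum_(j | j != i) a j *: s'`_j + (- b) *: g.
    by rewrite scaleNr -sab [X in _ = _ - X](bigD1 i) //= opprD addrCA subrr addr0.
  apply: CD; first by apply: (sumC _ _ cs) => y /mem_rem /sg.
  by apply: CZ; [rewrite oppr_ge0 | exact: sg].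
have Eg : g = b^-1 *: \sum_i a i *: s'`_i by rewrite sab scalerA mulVf ?scale1r // gt_eqF.
case: (irr g gs); rewrite [X in cone _ X]Eg.
have [_ _ CZ'] := cone_convex [set` rem g s].
apply: CZ'; first by rewrite invr_ge0 ltW.
by apply: (sumC _ _ (cone_convex _)) => y ys; exact: cone_gen.
Qed.

End ConeBasics.

Lemma eq_cols (R : Type) (m n : nat) (A B : 'M[R]_(m, n)) :
  (forall j, col j A = col j B) -> A = B.
Proof. by move=> h; apply/matrixP => i j; have /colP/(_ i) := h j; rewrite !mxE. Qed.

Section LatticeVectors.
Variable N : nat.
Implicit Types u x y : 'cV[int]_N.

Lemma toQ0 : toQ (0 : 'cV[int]_N) = 0.
Proof. by apply/colP => i; rewrite !mxE. Qed.

Lemma toQZ k x : toQ (k *: x) = k%:~R *: toQ x.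
Proof. by apply/colP => i; rewrite !mxE intrM. Qed.

Lemma toQ_inj : injective (@toQ N).
Proof. by move=> x y /colP h; apply/colP => i; have := h i; rewrite !mxE => /intr_inj. Qed.

Lemma dot_toQ u x : dot (toQ u) (toQ x) = (dot u x)%:~R.
Proof. by rewrite /dot rmorph_sum /=; apply: eq_bigr => i _; rewrite !mxE intrM. Qed.

Lemma clear_denominators (u : 'cV[rat]_N) :
  exists (k : int) (w : 'cV[int]_N), 0 < k /\ toQ w = k%:~R *: u.
Proof.
exists (\prod_i denq (u i 0)), (\col_i (numq (u i 0) * \prod_(j | j != i) denq (u j 0))).
split; first by apply: prodr_gt0 => i _; exact: denq_gt0.
apply/colP => i; rewrite !mxE /= [in RHS](bigD1 i) //= !intrM numqE; ring.
Qed.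

(** Bezout: the least positive value of an integral functional on [x] divides all entries of [x], by
    division with remainder, and is therefore 1. *)
Lemma primitive_functional x : primitive_vec x -> exists u, dot u x = 1.
Proof.
move=> [x0 prim].
pose P n := `[< exists u, dot u x = n.+1%:Z >].
have exP : exists n, P n.
  have [i xi] : exists i, x i 0 != 0.
    apply: contrapT => H; apply: x0; apply/colP => i; rewrite mxE; apply: contrapT => /eqP xi.
    by apply: H; exists i.
  exists `|x i 0|.-1; apply/asboolP; exists (Num.sg (x i 0) *: delta_mx i 0).
  by rewrite dotZl dot_delta -normrEsg prednK ?absz_gt0 // abszE.
have [n /asboolP[u un] minn] := ex_minnP exP.
have dvd i : (n.+1%:Z %| (x i 0)%R)%Z.
  apply/dvdz_mod0P; have n0 : n.+1%:Z != 0 by [].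
  have := ltz_pmod (x i 0) (isT : 0 < n.+1%:Z); have := modz_ge0 (x i 0) n0.
  have := divz_eq (x i 0) n.+1; set q := divz _ _; case: (modz _ _) => [[//|k]|//] => Ex _ lt.
  suff /minn : P k by lia.
  apply/asboolP; exists (delta_mx i 0 - q *: u); rewrite dotBl dotZl un dot_delta Ex; lia.
have n1 : `|n.+1%:Z| = 1 :> int.
  apply: (prim _ (\col_i divz (x i 0) n.+1%:Z)).
  by apply/colP => i; rewrite !mxE mulrC divzK.
by exists u; rewrite un; exact: n1.
Qed.

Lemma primitive_ray_eq x y (c : rat) : primitive_vec x -> primitive_vec y -> 0 <= c ->
  toQ y = c *: toQ x -> y = x.
Proof.
move=> px py c0 E; have [u ux] := primitive_functional px; have [w wy] := primitive_functional py.
have Ec : c = (dot u y)%:~R by rewrite -dot_toQ E dotZr dot_toQ ux mulr1.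
have Ey : y = dot u y *: x by apply: toQ_inj; rewrite toQZ -Ec.
have := py.2 _ _ Ey; have : 0 <= dot u y by rewrite -(ler0z rat) -Ec.
by move=> h; rewrite ger0_norm // => h1; rewrite Ey h1 scale1r.
Qed.

(** In the Smith normal form [L D R], the columns of the inverse of [R] at the zero columns of [D]
    form a basis of the kernel, and the corresponding rows of [R] are the dual coordinates. *)
Lemma kernel_basis (m : nat) (B : 'M[int]_(m, N)) :
  exists (n0 : nat) (w kap : 'I_n0 -> 'cV[int]_N),
    [/\ forall j, B *m w j = 0,
        forall u, B *m u = 0 -> u = \sum_j dot (kap j) u *: w j
      & forall i j, dot (kap j) (w i) = (i == j)%:Z].
Proof.
have [L Lu [R Ru [d _ EB]]] := int_Smith_normal_form B.
(* The zero columns of the diagonal matrix: zero diagonal entries, and positions beyond its last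
   row. *)
pose J : {set 'I_N} := [set j : 'I_N | (d`_j == 0) || (m <= j)%N]%SET.
exists #|J|, (fun j => col (enum_val j) (invmx R)), (fun j => (row (enum_val j) R)^T).
have dotE j u : dot ((row (enum_val j) R)^T) u = (R *m u) (enum_val j : 'I_N) 0.
  by rewrite !mxE /dot; apply: eq_bigr => i _; rewrite !mxE.
split=> [j|u Bu|i j].
- rewrite EB -!mulmxA; set D := \matrix_(_, _) _.
  have -> : R *m col (enum_val j) (invmx R) = delta_mx (enum_val j) 0.
    by rewrite colE mulmxA mulmxV // mul1mx.
  suff -> : D *m delta_mx (enum_val j) 0 = 0 :> 'cV_m by rewrite mulmx0.
  rewrite -colE; apply/colP => i; rewrite !mxE.
  case: eqP; last by rewrite mulr0n.
  move=> ij; rewrite mulr1n; have := enum_valP j; rewrite inE => /orP[/eqP d0|le].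
    by rewrite ij d0.
  have := ltn_ord i; by rewrite ij ltnNge le.
- move: Bu; rewrite EB -!mulmxA -[X in _ = X](mulmx0 _ L) => /(can_inj (mulKmx Lu)) Du.
  have Ru0 (j : 'I_N) : j \notin J -> (R *m u) j 0 = 0.
    rewrite inE negb_or -ltnNge => /andP[dj jm].
    move/colP/(_ (Ordinal jm)): Du; rewrite mxE (bigD1 j) //= big1 => [|i ij]; last first.
      by rewrite mxE /= eq_sym (negbTE (ij : (i : nat) != j)) mulr0n mul0r.
    by rewrite !mxE /= eqxx addr0 => /eqP; rewrite mulf_eq0 (negbTE dj) /= => /eqP.
  rewrite -{1}[u](mulKmx Ru) -[in LHS](mul1mx (R *m u)).
  rewrite [LHS]mulmxA mulmx1; apply/colP => i; rewrite mxE summxE.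
  rewrite (bigID (mem J)) /= [X in _ + X]big1 ?addr0 => [|j jJ]; last by rewrite Ru0 ?mulr0.
  rewrite big_enum_val /=; apply: eq_bigr => j _.
  by rewrite dotE !mxE mulrC.
- rewrite dotE colE mulmxA mulmxV // mul1mx mxE eqxx andbT.
  by rewrite (inj_eq enum_val_inj) eq_sym natz.
Qed.

End LatticeVectors.

(** * Rays of a fan, regular cones and the class group *)

Section FanRays.
Variables (N : nat) (I : finType) (v : I -> 'cV[int]_N) (Sigma : set (set 'cV[rat]_N)).
Hypotheses (fan : is_fan Sigma) (raysE : rays Sigma = [set ray (toQ (v a)) | a in [set: I]])
  (vinj : injective v) (vprim : forall a, primitive_vec (v a)).
Implicit Types sigma tau : set 'cV[rat]_N.

Definition ray_mem sigma (a : I) : bool := `[< sigma (toQ (v a)) >].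

Lemma ray_memP sigma a : reflect (sigma (toQ (v a))) (ray_mem sigma a).
Proof. exact: asboolP. Qed.

(** Exposed rays of a cone are faces, hence rays of the fan, hence spanned by columns of the
    generator matrix. *)
Lemma fan_cone_generated sigma : Sigma sigma ->
  sigma = cone [set toQ (v a) | a in [set a | sigma (toQ (v a))]].
Proof.
move=> Ss; have [_ fan2 fan3 _] := fan; have [ps pt] := fan2 _ Ss.
have cs := polyhedral_convex ps.
apply/seteqP; split; last by apply: cone_min => // _ [a /= sa <-].
rewrite {1}(generated_by_exposed_rays ps pt); apply: cone_min; first exact: cone_convex.
move=> g /= [sg g0 fg].
have : rays Sigma (ray g) by split; [exact: fan3 fg | exists g].
rewrite raysE => -[a _ E].
have : ray g (toQ (v a)) by rewrite -E; apply/rayP; exists 1; rewrite ?ler01 ?scale1r.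
move=> /rayP[c c0 Ea].
have : ray (toQ (v a)) g by rewrite E; apply/rayP; exists 1; rewrite ?ler01 ?scale1r.
move=> /rayP[c' c0' ->].
have [_ _ CZ] := cone_convex [set toQ (v a) | a in [set a | sigma (toQ (v a))]].
apply: CZ => //; apply: cone_gen; exists a => //=.
by rewrite Ea; case: cs => _ _ CZ'; exact: CZ'.
Qed.

Lemma dual_charsP sigma u : Sigma sigma ->
  dual_chars sigma u <-> forall a, sigma (toQ (v a)) -> 0 <= dot u (v a).
Proof.
move=> Ss; split=> [h a sa|h x]; first by rewrite -(ler0z rat) -dot_toQ; exact: h.
rewrite (fan_cone_generated Ss); apply: (@cone_min _ _ [set x | 0 <= dot (toQ u) x]).
  exact: convex_cone_ge0.
by move=> _ [a /= sa <-]; rewrite dot_toQ ler0z; exact: h.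
Qed.

Lemma perp_charsP sigma u : Sigma sigma ->
  perp_chars sigma u <-> forall a, sigma (toQ (v a)) -> dot u (v a) = 0.
Proof.
move=> Ss; split=> [h a sa|h x].
  by apply/eqP; rewrite -(intr_eq0 rat) -dot_toQ; apply/eqP; exact: h.
rewrite (fan_cone_generated Ss) => xs; apply/eqP; rewrite eq_le; apply/andP; split.
  rewrite -oppr_ge0 -dotNl; move: x xs.
  apply: (@cone_min _ _ [set x | 0 <= dot (- toQ u) x]); first exact: convex_cone_ge0.
  by move=> _ [a /= sa <-]; rewrite dotNl dot_toQ h // oppr0.
move: x xs; apply: (@cone_min _ _ [set x | 0 <= dot (toQ u) x]); first exact: convex_cone_ge0.
by move=> _ [a /= sa <-]; rewrite dot_toQ h.
Qed.

Lemma ray_in_fan a : Sigma (ray (toQ (v a))).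
Proof.
have : rays Sigma (ray (toQ (v a))) by rewrite raysE; exists a.
by case.
Qed.

Lemma toQ_v_neq0 a : toQ (v a) <> 0.
Proof. by rewrite -toQ0 => /toQ_inj; case: (vprim a). Qed.

Lemma ray_mem_ray a b : ray (toQ (v a)) (toQ (v b)) -> b = a.
Proof. by move=> /rayP[c c0 E]; apply: vinj; exact: primitive_ray_eq c0 E. Qed.

Lemma ray_face sigma a : Sigma sigma -> sigma (toQ (v a)) -> face (ray (toQ (v a))) sigma.
Proof.
move=> Ss sa; have [_ fan2 _ fan4] := fan; have [ps _] := fan2 _ Ss.
have [+ _] := fan4 _ _ Ss (ray_in_fan a).
suff -> : sigma `&` ray (toQ (v a)) = ray (toQ (v a)) by [].
apply/seteqP; split=> x; first by case.
move=> rx; split=> //; have /rayP[c c0 ->] := rx.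
by have [_ _ CZ] := polyhedral_convex ps; exact: CZ.
Qed.

(** A multiple of the functional that cuts out the ray as a face; it is strictly positive on the
    other columns because distinct primitive vectors lie on distinct rays. *)
Lemma facet_character sigma a : Sigma sigma -> sigma (toQ (v a)) ->
  exists u, dot u (v a) = 0 /\ forall b, sigma (toQ (v b)) -> b != a -> 0 < dot u (v b).
Proof.
move=> Ss sa; have [u [u0 Eu]] := ray_face Ss sa.
have [k [w [k0 Ew]]] := clear_denominators u.
have Edot x : (dot w x)%:~R = k%:~R * dot u (toQ x) by rewrite -dot_toQ Ew dotZl.
have ra : ray (toQ (v a)) (toQ (v a)) by apply/rayP; exists 1; rewrite ?ler01 ?scale1r.
exists w; split.
  by apply/eqP; rewrite -(intr_eq0 rat) Edot; move: ra; rewrite Eu => -[_ /= ->]; rewrite mulr0.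
move=> b sb ba; rewrite -(ltr0z rat) Edot mulr_gt0 ?ltr0z // lt_neqAle u0 // andbT eq_sym.
apply: contra ba => /eqP ub; apply/eqP; apply: ray_mem_ray; rewrite Eu; split=> //.
Qed.

(** The common form to which both regularity and the class group condition are reduced. *)
Definition has_dual_basis sigma : Prop := forall a, sigma (toQ (v a)) ->
  exists u, forall b, sigma (toQ (v b)) -> dot u (v b) = (b == a)%:Z.

Lemma unimodular_column_primitive (B : 'M[int]_N) j : B \in unitmx -> primitive_vec (col j B).
Proof.
move=> Bu; have E : invmx B *m col j B = delta_mx j 0 by rewrite colE mulmxA mulVmx // mul1mx.
split=> [b0|k x kx].
  move: E; rewrite b0 mulmx0 => /colP/(_ j); rewrite !mxE !eqxx; by [].
have /colP/(_ j) : k *: (invmx B *m x) = delta_mx j 0 by rewrite scalemxAr -kx E.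
rewrite !mxE !eqxx => kz; set z := (X in k * X = _) in kz.
by have := congr1 absz kz; rewrite abszM => /eqP; rewrite muln_eq1 => /andP[/eqP k1 _]; rewrite -abszE k1.
Qed.

(** A column in [sigma] spans an exposed ray, so one of the basis vectors it is combined from lies
    on that ray and equals it by primitivity. The rows of the inverse matrix are then the dual
    functionals. *)
Lemma regular_has_dual_basis sigma : Sigma sigma -> regular_cone sigma -> has_dual_basis sigma.
Proof.
move=> Ss [B [J [Bu Es]]] a sa.
have colJ b : sigma (toQ (v b)) -> exists j, v b = col j B.
  move=> sb; have [u [u0 Eu]] := ray_face Ss sb.
  have ub : dot u (toQ (v b)) = 0.
    have : ray (toQ (v b)) (toQ (v b)) by apply/rayP; exists 1; rewrite ?ler01 ?scale1r.
    by rewrite Eu => -[].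
  have := sb; rewrite Es => -[k [al [y [H E]]]].
  have sy i : sigma (y i) by rewrite Es; apply: cone_gen; case: (H i).
  have [i ayi] : exists i, al i *: y i != 0.
    apply: contrapT => no; apply: (@toQ_v_neq0 b); rewrite E big1 // => i _.
    by apply: contrapT => /eqP ne; apply: no; exists i.
  move: ub; rewrite E dot_sumr => /eqP; rewrite psumr_eq0 => [/allP/(_ i (mem_index_enum i))|j _].
    rewrite dotZr mulf_eq0 => /orP[/eqP a0|/eqP uy]; first by rewrite a0 scale0r eqxx in ayi.
    have : ray (toQ (v b)) (y i) by rewrite Eu.
    have [_ [j _ <-]] := H i => /rayP[c c0 Ec]; exists j; symmetry.
    exact: primitive_ray_eq (vprim b) (unimodular_column_primitive j Bu) c0 Ec.
  by rewrite dotZr mulr_ge0 ?(H j).1 ?u0.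
have [j Ej] := colJ a sa.
exists (row j (invmx B))^T => b /colJ[j' Ej'].
have -> : dot (row j (invmx B))^T (v b) = (invmx B *m v b) j 0.
  by rewrite !mxE /dot; apply: eq_bigr => i _; rewrite !mxE.
have E i : invmx B *m col i B = delta_mx i 0 by rewrite colE mulmxA mulVmx // mul1mx.
rewrite Ej' E mxE eqxx andbT -natz; congr (nat_of_bool _)%:R.
apply/eqP/eqP => [jj|ba]; first by apply: vinj; rewrite Ej Ej' jj.
move: (E j') (E j); rewrite -Ej' -Ej ba => ->.
by move=> /colP/(_ j'); rewrite !mxE !eqxx !andbT; case: eqP.
Qed.

Lemma int_inverse_dim (p q : nat) (B : 'M[int]_(p, q)) (B' : 'M[int]_(q, p)) :
  B *m B' = 1%:M -> (p <= q)%N.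
Proof.
move=> /(congr1 (map_mx (intr : int -> rat))); rewrite map_mxM map_mx1 => E.
by rewrite -(mxrank1 rat p) -E (leq_trans (mxrankM_maxl _ _)) // rank_leq_col.
Qed.

(** The dual functionals split the lattice: a basis of their common kernel completes the rays of
    [sigma] to a lattice basis. *)
Lemma dual_basis_regular sigma : Sigma sigma -> has_dual_basis sigma -> regular_cone sigma.
Proof.
move=> Ss dual.
pose Q := [pred a | ray_mem sigma a].
have Qs (i : 'I_#|Q|) : sigma (toQ (v (enum_val i))).
  exact: (elimT (ray_memP _ _) (enum_valP i)).
have /choice[de hde] (i : 'I_#|Q|) : exists u, forall b, sigma (toQ (v b)) ->
    dot u (v b) = (b == enum_val i)%:Z by exact: dual.
pose De : 'M[int]_(#|Q|, N) := \matrix_(i, j) de i j 0.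
pose V : 'M[int]_(N, #|Q|) := \matrix_(i, j) v (enum_val j) i 0.
have DV : De *m V = 1%:M.
  apply/matrixP => i j; rewrite !mxE; transitivity (dot (de i) (v (enum_val j))).
    by apply: eq_bigr => k _; rewrite !mxE.
  by rewrite hde // (inj_eq enum_val_inj) eq_sym natz.
have [n0 [w [kap [h1 h2 h3]]]] := kernel_basis De.
pose W : 'M[int]_(N, n0) := \matrix_(i, j) w j i 0.
pose Ka : 'M[int]_(n0, N) := \matrix_(i, j) kap i j 0.
have colW j : col j W = w j by apply/colP => i; rewrite !mxE.
have DW : De *m W = 0.
  by apply: eq_cols => j; rewrite -[LHS]/(col j _) colE -mulmxA -colE colW h1 col0.
have KW : Ka *m W = 1%:M.
  apply/matrixP => i j; rewrite !mxE; transitivity (dot (kap i) (w j)).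
    by apply: eq_bigr => k _; rewrite !mxE.
  by rewrite h3 eq_sym natz.
have WK (u : 'cV[int]_N) : De *m u = 0 -> W *m (Ka *m u) = u.
  move=> /h2 {2}->; apply/colP => i; rewrite mxE summxE; apply: eq_bigr => j _.
  rewrite !mxE mulrC; congr (_ * _); by apply: eq_bigr => k _; rewrite mxE.
(* The lower block of the inverse takes kernel coordinates after the projection [1%:M - V *m De]
   onto the kernel. *)
pose B := row_mx V W; pose B' := col_mx De (Ka *m (1%:M - V *m De)).
have B'B : B' *m B = 1%:M.
  have E1 : (1%:M - V *m De) *m V = 0 by rewrite mulmxBl mul1mx -mulmxA DV mulmx1 subrr.
  have E2 : (1%:M - V *m De) *m W = W by rewrite mulmxBl mul1mx -mulmxA DW mulmx0 subr0.
  by rewrite mul_col_row DV DW -!mulmxA E1 E2 mulmx0 KW -scalar_mx_block.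
have BB' : B *m B' = 1%:M.
  apply: eq_cols => j; rewrite mul_row_col !colE mulmxDl -!mulmxA WK.
    by rewrite mulmxBl !mul1mx -mulmxA addrC subrK.
  by rewrite mulmxA mulmxBr mulmx1 mulmxA DV mul1mx subrr mul0mx.
(* Two-sided invertibility over the integers forces the completed matrix to be square. *)
have EN : N = (#|Q| + n0)%N.
  by apply/eqP; rewrite eqn_leq (int_inverse_dim BB') (int_inverse_dim B'B).
pose Bs : 'M[int]_N := \matrix_(i, j) B i (cast_ord EN j).
have Bu : Bs \in unitmx.
  have [|_ //] := @mulmx1_unit _ _ (\matrix_(i, j) B' (cast_ord EN i) j : 'M[int]_N) Bs.
  apply/matrixP => i j; have /matrixP/(_ (cast_ord EN i) (cast_ord EN j)) := B'B.
  rewrite !mxE (inj_eq (@cast_ord_inj _ _ EN)) => <-.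
  by apply: eq_bigr => k _; rewrite !mxE.
have colB (i : 'I_#|Q|) : col (cast_ord (esym EN) (lshift n0 i)) Bs = v (enum_val i).
  by apply/colP => k; rewrite mxE mxE cast_ordKV row_mxEl mxE.
exists Bs, [set cast_ord (esym EN) (lshift n0 i) | i in 'I_#|Q|]%SET; split=> //.
rewrite {1}(fan_cone_generated Ss); congr cone; apply/seteqP; split=> x.
  move=> [a /= /ray_memP sa <-].
  exists (cast_ord (esym EN) (lshift n0 (enum_rank_in (A := Q) sa a))); last first.
    by rewrite colB enum_rankK_in.
  by apply/imsetP; exists (enum_rank_in (A := Q) sa a).
by move=> [_ /= /imsetP[i _ ->] <-]; rewrite colB; exists (enum_val i) => //=.
Qed.

Lemma regular_coneP sigma : Sigma sigma -> regular_cone sigma <-> has_dual_basis sigma.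
Proof. by move=> Ss; split; [exact: regular_has_dual_basis | exact: dual_basis_regular]. Qed.

Lemma lin_lattice_gamma sigma (w : {ffun I -> int}) :
  lin_lattice (gamma_face v sigma) w <-> forall a, sigma (toQ (v a)) -> w a = 0.
Proof.
split=> [[k [al [y [H E]]]] a sa|H].
  have y0 i : y i a = 0.
    have [k' [al' [y' [H' ->]]]] := H i; rewrite sum_ffunE big1 // => j _.
    have [_ [b /= nb <-]] := H' j; rewrite !ffunE; case: eqP => [ab|_]; last by rewrite scaler0.
    by case: nb; rewrite -ab.
  apply/eqP; rewrite -(intr_eq0 rat); apply/eqP.
  have := congr1 (fun f : {ffun I -> rat^o} => f a) E; rewrite ffunE => ->.
  by rewrite sum_ffunE big1 // => i _; rewrite ffunE y0 scaler0.
exists #|I|, (fun i => (w (enum_val i))%:~R),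
  (fun i => if ray_mem sigma (enum_val i) then 0 else basis_vec (enum_val i)); split.
  move=> i; case: ifP => [_|/ray_memP ns].
    by exists 0%N, (fun=> 0), (fun=> 0); split; [case | rewrite big_ord0].
  exists 1%N, (fun=> 1), (fun=> basis_vec (enum_val i)); split; last by rewrite big_ord1 scale1r.
  by move=> _; split; [exact: ler01 | exists (enum_val i)].
apply/ffunP => a; rewrite ffunE sum_ffunE (bigD1 (enum_rank a)) //= big1 => [|i ia].
  rewrite addr0 enum_rankK !ffunE; case: ifP => [/ray_memP sa|_]; last first.
    by rewrite ffunE eqxx; rewrite [_ *: _]mulr1.
  by rewrite H // ffunE scaler0.
rewrite ffunE; case: ifP => _; first by rewrite ffunE scaler0.
rewrite ffunE (negbTE (_ : a != enum_val i)) ?scaler0 //.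
by apply: contra ia => /eqP ->; rewrite enum_valK.
Qed.

(** The class of a basis vector [ea] has a representative vanishing on the rays of [sigma] exactly
    if some [u] pairs with these rays like [ea]. Conversely, such [u] correct any vector to one
    vanishing there. *)
Lemma Qproj_fullP sigma :
  [set: ClK v] = Qproj v @` lin_lattice (gamma_face v sigma) <-> has_dual_basis sigma.
Proof.
split=> [E a sa|dual].
  pose ea : {ffun I -> int} := [ffun b => (b == a)%:Z].
  have : [set: ClK v] (Qproj v ea) by [].
  rewrite E => -[z /lin_lattice_gamma z0 /eqP].
  rewrite eq_sym /Qproj eqmodE => /asboolP[u Eu]; exists u => b sb.
  have := congr1 (fun f : {ffun I -> int} => f b) Eu; rewrite !ffunE => <-.
  by rewrite (z0 b sb) subr0.
apply/seteqP; split=> // X _.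
have /choice[de hde] (a : I) : exists u, sigma (toQ (v a)) -> forall b, sigma (toQ (v b)) ->
    dot u (v b) = (b == a)%:Z.
  have [/dual[u hu]|na] := pselect (sigma (toQ (v a))); first by exists u.
  by exists 0.
pose z := repr X; pose u := \sum_(a | ray_mem sigma a) z a *: de a.
exists (z - [ffun a => dot u (v a)]).
  apply/lin_lattice_gamma => a sa; rewrite !ffunE.
  have -> : dot u (v a) = z a; last by rewrite subrr.
  rewrite dot_suml (bigD1 a) /=; last exact/ray_memP.
  rewrite dotZl hde // eqxx mulr1 big1 ?addr0 // => b /andP[/ray_memP sb ba].
  by rewrite dotZl hde // eq_sym (negbTE ba) mulr0.
rewrite /Qproj -[RHS]reprK; apply/eqP; rewrite eqmodE; apply/asboolP.
exists (- u); apply/ffunP => a; rewrite !ffunE dotNl /z; ring.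
Qed.

End FanRays.

(** * Points of tori and linear arrangements *)

Lemma closed_field_root (K : closedFieldType) (t : K) (k : nat) : (0 < k)%N ->
  exists z, z ^+ k = t.
Proof.
move=> k0; have : size ('X^k - t%:P) != 1%N by rewrite size_XnsubC // eqSS -lt0n.
by move=> /closed_rootP[z]; rewrite rootE !hornerE subr_eq0 => /eqP; exists z.
Qed.

Lemma exprz_prod (K : fieldType) (I : Type) (s : seq I) (e : I -> int) (z : K) : z != 0 ->
  z ^ (\sum_(i <- s) e i) = \prod_(i <- s) z ^ e i.
Proof.
move=> z0; elim: s => [|i s IH]; first by rewrite !big_nil expr0z.
by rewrite !big_cons expfzDr // IH.
Qed.

Lemma prod_exprz (K : fieldType) (I : Type) (s : seq I) (F : I -> K) (k : int) :
  (\prod_(i <- s) F i) ^ k = \prod_(i <- s) F i ^ k.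
Proof.
elim: s => [|i s IH]; first by rewrite !big_nil exp1rz.
by rewrite !big_cons expfzMl IH.
Qed.

Lemma multiplicative_char (K : fieldType) (N : nat) (phi : 'cV[int]_N -> K) :
  (forall u w, phi (u + w) = phi u * phi w) -> (forall u, phi u != 0) ->
  (forall u k, phi (k *: u) = phi u ^ k) /\
  forall u, phi u = \prod_i phi (delta_mx i 0) ^ u i 0.
Proof.
move=> phiD phi0.
have phi_0 : phi 0 = 1 by apply: (mulfI (phi0 0)); rewrite mulr1 -phiD addr0.
have phiN u : phi (- u) = (phi u)^-1.
  by apply: (mulfI (phi0 u)); rewrite divff // -phiD subrr.
have phiZ u k : phi (k *: u) = phi u ^ k.
  have nat_case j : phi (j%:Z *: u) = phi u ^+ j.
    elim: j => [|j IH]; first by rewrite scale0r.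
    have -> : j.+1%:Z = 1 + j%:Z by rewrite -PoszD add1n.
    by rewrite scalerDl scale1r phiD IH exprS.
  case: k => j; first exact: nat_case.
  by rewrite NegzE scaleNr phiN nat_case exprnN.
split=> // u.
have {1}-> : u = \sum_i u i 0 *: delta_mx i 0.
  apply/colP => j; rewrite summxE (bigD1 j) //= !mxE !eqxx mulr1 big1 ?addr0 // => i ij.
  by rewrite !mxE eq_sym (negbTE ij) mulr0.
elim/big_rec2: _ => // i a b _ <-; by rewrite phiD phiZ.
Qed.

Section MonomialEvaluation.
Variables (K : closedFieldType) (N : nat) (I : finType) (v : I -> 'cV[int]_N).
Implicit Types (z : I -> K) (u : 'cV[int]_N).

Definition ev z u : K := \prod_a z a ^ dot u (v a).

Lemma ev0 z : ev z 0 = 1.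
Proof. by rewrite /ev big1 // => a _; rewrite dot0l expr0z. Qed.

Lemma evD z u w :
  (forall a, z a = 0 -> 0 <= dot u (v a)) -> (forall a, z a = 0 -> 0 <= dot w (v a)) ->
  ev z (u + w) = ev z u * ev z w.
Proof.
move=> hu hw; rewrite -big_split; apply: eq_bigr => a _ /=; rewrite dotDl.
have [z0|z0] := eqVneq (z a) 0; last by rewrite expfzDr.
have := hu a z0; have := hw a z0; case: (dot u _) => // i; case: (dot w _) => // j _ _.
by rewrite -PoszD -!exprnP exprD.
Qed.

Lemma evZ z q u : ev z (q *: u) = ev z u ^ q.
Proof.
by rewrite /ev prod_exprz; apply: eq_bigr => a _; rewrite dotZl exprz_exp mulrC.
Qed.

Lemma ev_mul z z' u : ev (fun a => z a * z' a) u = ev z u * ev z' u.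
Proof. by rewrite -big_split; apply: eq_bigr => a _ /=; rewrite expfzMl. Qed.

Lemma ev_neq0 z u : (forall a, z a = 0 -> dot u (v a) = 0) -> ev z u != 0.
Proof.
move=> h; apply/prodf_neq0 => a _; have [z0|z0] := eqVneq (z a) 0.
  by rewrite h // expr0z oner_neq0.
by rewrite expfz_neq0.
Qed.

Lemma ev_eq0 z u a : z a = 0 -> dot u (v a) != 0 -> ev z u = 0.
Proof. by move=> z0 h; rewrite /ev (bigD1 a) //= z0 exp0rz (negbTE h) mul0r. Qed.

Hypothesis vspan : linQ [set toQ (v a) | a in [set: I]] = [set: 'cV[rat]_N].

(** As the columns span rationally, pairing with them has a rational left inverse; [q] is a common
    denominator of it. *)
Lemma lattice_multiple : exists (q : nat) (m : 'I_N -> I -> int), (0 < q)%N /\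
  forall k u, \sum_a m k a * dot u (v a) = q%:Z * u k 0.
Proof.
have H (k : 'I_N) : exists y : I -> rat, \sum_a y a *: toQ (v a) = toQ (delta_mx k 0).
  have : linQ [set toQ (v a) | a in [set: I]] (toQ (delta_mx k 0)) by rewrite vspan.
  move=> [j [al [y [Hy ->]]]].
  have /choice[b hb] i : exists b, toQ (v b) = y i by have [b _ <-] := Hy i; exists b.
  exists (fun a => \sum_(i | b i == a) al i); under eq_bigr do rewrite scaler_suml.
  rewrite (exchange_big_dep xpredT) //=; apply: eq_bigr => i _.
  by rewrite (big_pred1 (b i)) ?hb // => a /=; rewrite eq_sym.
have [y hy] := choice H.
pose dn (k : 'I_N) (a : I) := denq (y k a).
pose q := \prod_k \prod_a dn k a.
pose m k a := numq (y k a) * \prod_(i | i != k) \prod_b dn i b * \prod_(b | b != a) dn k b.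
have q0 : 0 < q by apply: prodr_gt0 => k _; apply: prodr_gt0 => a _; exact: denq_gt0.
exists `|q|%N, m; split; first by rewrite absz_gt0 gt_eqF.
move=> k u; rewrite (gtz0_abs q0).
have mE a : (m k a)%:~R = q%:~R * y k a.
  rewrite /m /q [in RHS](bigD1 k) //= [in X in _ = (X * _)%:~R * _](bigD1 a) //= !intrM numqE /dn.
  ring.
apply: (@intr_inj rat); rewrite rmorph_sum intrM /=.
have -> : (u k 0)%:~R = dot (toQ u) (toQ (delta_mx k 0)) :> rat.
  by rewrite dot_toQ dotC dot_delta.
rewrite -hy dot_sumr mulr_sumr; apply: eq_bigr => a _.
by rewrite intrM mE dotZr dot_toQ mulrA.
Qed.

(** Cox's map is onto the torus: take [q]-th roots of the values on the standard basis and
    distribute them by the left inverse of [lattice_multiple]. *)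
Lemma torus_surjective (phi : 'cV[int]_N -> K) :
  (forall u w, phi (u + w) = phi u * phi w) -> (forall u, phi u != 0) ->
  exists2 zeta : I -> K, (forall a, zeta a != 0) & forall u, ev zeta u = phi u.
Proof.
move=> phiD phi0; have [q [m [q0 hm]]] := lattice_multiple.
have /choice[eps heps] (k : 'I_N) := closed_field_root (phi (delta_mx k 0)) q0.
have eps0 k : eps k != 0.
  by apply: contraNneq (phi0 (delta_mx k 0)) => e0; rewrite -heps e0 expr0n gtn_eqF.
exists (fun a => \prod_k eps k ^ m k a).
  by move=> a; apply/prodf_neq0 => k _; rewrite expfz_neq0.
move=> u; rewrite (multiplicative_char phiD phi0).2 /ev.
under eq_bigr do rewrite prod_exprz.
rewrite exchange_big; apply: eq_bigr => k _ /=; rewrite -heps.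
rewrite -[eps k ^+ q]/(eps k ^ q%:Z) exprz_exp -hm exprz_prod //.
by apply: eq_bigr => a _; rewrite exprz_exp.
Qed.

End MonomialEvaluation.

(** * The row space of the arrangement matrix and the row monomials *)

Section ArrangementSpace.
Variables (K : closedFieldType) (c r : nat) (A : 'M[K]_(c.+1, r.+1)).
Hypothesis (genA : forall f : 'I_c.+1 -> 'I_r.+1, injective f -> \rank (colsub f A) = c.+1).

(** The parametric form of the equations g_t in terms of the row monomials, by [barXP]. *)
Definition in_rowspace (x : 'I_r.+1 -> K) : Prop :=
  exists rho : 'rV[K]_c.+1, forall i, x i = (rho *m A) 0 i.

Lemma in_rowspaceZ b x : in_rowspace x -> in_rowspace (fun i => b * x i).
Proof.
move=> [rho h]; exists (b *: rho) => i; by rewrite h -scalemxAl [RHS]mxE.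
Qed.

Lemma rowspace_relation (iota : 'I_c.+2 -> 'I_r.+1) : exists2 b : 'I_c.+2 -> K,
  (exists q, b q != 0) & forall x, in_rowspace x -> \sum_q b q * x (iota q) = 0.
Proof.
have [|b b0 hb] := @nontrivial_relation K 'I_c.+2 'I_c.+1 (fun q j => A j (iota q)).
  by rewrite !card_ord.
exists b; first by case: b0 => q bq; exists q.
move=> x [rho hx]; under eq_bigr do rewrite hx mxE mulr_sumr.
rewrite exchange_big big1 // => j _; under eq_bigr do rewrite mulrCA.
by rewrite -mulr_sumr hb mulr0.
Qed.

(** Any [c.+1] columns form an invertible matrix, so these entries are coordinates on the row space.
    If a coefficient [cf i k] vanished, exchanging column [f k] for column [i] would give dependent
    columns. *)
Lemma rowspace_coords (f : 'I_c.+1 -> 'I_r.+1) : injective f ->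
  exists cf : 'I_r.+1 -> 'I_c.+1 -> K,
    [/\ forall x, in_rowspace x <-> forall i, x i = \sum_k cf i k * x (f k),
        forall k k', cf (f k) k' = (k' == k)%:R
      & forall i k, (forall k', f k' != i) -> cf i k != 0].
Proof.
move=> finj; pose Af := colsub f A.
have Au : Af \in unitmx by rewrite -row_full_unit /row_full genA.
pose cf i k := (invmx Af *m col i A) k 0.
have cfE x i : \sum_k cf i k * x (f k) = ((\row_k x (f k)) *m invmx Af *m A) 0 i.
  transitivity (((\row_k x (f k)) *m (invmx Af *m col i A)) 0 0).
    by rewrite [RHS]mxE; apply: eq_bigr => k _; rewrite mxE mulrC.
  by rewrite colE !mulmxA -colE mxE.
have cf_f k : invmx Af *m col (f k) A = delta_mx k 0.
  have -> : col (f k) A = col k Af by apply/colP => j; rewrite !mxE.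
  by rewrite colE mulmxA mulVmx // mul1mx.
exists cf; split.
- move=> x; split=> [[rho hx] i|hx].
    rewrite cfE (_ : \row_k x (f k) = rho *m Af) ?mulmxK // ?hx //.
    by apply/rowP => k; rewrite mxE hx !mxE; apply: eq_bigr => j _; rewrite !mxE.
  by exists ((\row_k x (f k)) *m invmx Af) => i; rewrite -cfE -hx.
- by move=> k k'; rewrite /cf cf_f mxE eqxx andbT.
move=> i k nif; apply/eqP => cf0.
pose f' k' := if k' == k then i else f k'.
have f'inj : injective f'.
  move=> a b; rewrite /f'; case: eqP => [->|_]; case: eqP => [->|_] //.
  - by move=> E; have := nif b; rewrite -E eqxx.
  - by move=> E; have := nif a; rewrite E eqxx.
  - exact: finj.
have : colsub f' A \in unitmx by rewrite -row_full_unit /row_full genA.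
rewrite -row_free_unit => fr.
have : row k (invmx Af) = 0.
  apply: (row_free_inj fr); rewrite /= mul0mx; apply/rowP => j.
  transitivity ((invmx Af *m col (f' j) A) k 0).
    by rewrite !mxE; apply: eq_bigr => q _; rewrite !mxE.
  rewrite [RHS]mxE /f'; case: eqP => [_|/eqP jk]; first exact: cf0.
  by rewrite cf_f mxE eqxx andbT eq_sym (negbTE jk).
move=> /(congr1 (fun B => B *m Af)); rewrite mul0mx -row_mul mulVmx // => /rowP/(_ k).
by rewrite !mxE eqxx => /eqP; rewrite oner_eq0.
Qed.

Lemma set_injection (C : {set 'I_r.+1}) : #|C| = c.+1 ->
  exists f : 'I_c.+1 -> 'I_r.+1, injective f /\ forall i, i \in C <-> exists k, f k = i.
Proof.
move=> EC; exists (fun k => enum_val (cast_ord (esym EC) k)); split.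
  by move=> a b /enum_val_inj /cast_ord_inj.
move=> i; split=> [iC|[k <-]]; last exact: enum_valP.
by exists (cast_ord EC (enum_rank_in iC i)); rewrite cast_ordK enum_rankK_in.
Qed.

(** Use the entries in [J] and one further [i0] as coordinates, set those in [Z] to zero and the
    others to powers of [eps]. Each remaining entry is a polynomial in [eps], nonzero because of its
    coefficient at [i0], so a generic [eps] works. *)
Lemma rowspace_zero_pattern (J : {set 'I_r.+1}) (Z : pred 'I_r.+1) : (c <= r)%N -> #|J| = c ->
  (forall i, Z i -> i \in J) ->
  exists2 x, in_rowspace x & forall i, x i = 0 <-> Z i.
Proof.
move=> cr EJ ZJ.
have [i0 i0J] : exists i0, i0 \notin J.
  apply: contrapT => H; suff : (r.+1 <= #|J|)%N by rewrite EJ leqNgt ltnS cr.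
  rewrite -[X in (X <= _)%N]card_ord; apply: subset_leq_card; apply/fintype.subsetP => i _.
  by apply: contrapT => /negP iJ; apply: H; exists i.
have [|f [finj fC]] := @set_injection (i0 |: J)%SET; first by rewrite cardsU1 i0J EJ.
have [cf [cf1 cf2 cf3]] := rowspace_coords finj.
have [k0 fk0] : exists k, f k = i0 by apply/fC; rewrite !inE eqxx.
pose P i : {poly K} := \sum_(k < c.+1 | ~~ Z (f k)) cf i k *: 'X^k.
have Z0 : ~~ Z (f k0) by rewrite fk0; apply: contra i0J; exact: ZJ.
have P0 i : (forall k, f k != i) -> P i != 0.
  move=> nif; apply: contra_neq (cf3 i k0 nif) => /(congr1 (fun q : {poly K} => q`_k0)).
  rewrite coef0 coef_sum (bigD1 k0) //= coefZ coefXn eqxx mulr1 big1 ?addr0 // => k /andP[_ kk].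
  by rewrite coefZ coefXn eq_sym (negbTE (kk : (k : nat) != k0)) mulr0.
have [eps e0 he] : exists2 eps, eps != 0 & (\prod_(i | [forall k, f k != i]) P i).[eps] != 0.
  by apply: closed_field_nonroot; rewrite prodf_seq_neq0; apply/allP => i _; apply/implyP => /forallP; exact: P0.
pose y k := if Z (f k) then 0 else eps ^+ k.
pose x i := \sum_k cf i k * y k.
have xf k : x (f k) = y k.
  rewrite /x (bigD1 k) //= cf2 eqxx mul1r big1 ?addr0 // => k' /negbTE kk.
  by rewrite cf2 kk mul0r.
exists x; first by apply/cf1 => i; apply: eq_bigr => k _; rewrite xf.
move=> i; have [/existsP[k /eqP <-]|ni] := boolP [exists k, f k == i].
  rewrite xf /y; case: ifP => // Zk; split=> // /eqP; by rewrite expf_eq0 (negbTE e0) andbF.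
have nif : [forall k, f k != i] by rewrite -negb_exists.
have xi : x i != 0.
  have -> : x i = (P i).[eps].
    rewrite /P horner_sum /x [RHS]big_mkcond; apply: eq_bigr => k _ /=; rewrite /y.
    by case: (Z (f k)); rewrite /= ?mulr0 // hornerZ hornerXn.
  by move: he; rewrite horner_prod prodf_seq_neq0 => /allP/(_ i (mem_index_enum i)); rewrite nif.
split=> [x0|/ZJ iJ]; first by rewrite x0 eqxx in xi.
have : exists k, f k = i by apply/fC; rewrite !inE iJ orbT.
by move=> [k fk]; case/negP: ni; apply/existsP; exists k; rewrite fk.
Qed.

End ArrangementSpace.

Section Indices.
Variables (r : nat) (n : 'I_r.+1 -> nat) (m s : nat).
Variables (l : forall i : 'I_r.+1, 'I_(n i) -> nat) (d : col_index n m -> 'cV[int]_s).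
Let I := col_index n m.
Let v : I -> 'cV[int]_(r + s) := P_col l d.

Definition l_at (i : 'I_r.+1) (a : I) : nat :=
  match a with inl p => if tag p == i then l (tagged p) else 0%N | inr _ => 0%N end.

(** With value 0 in row 0, the differences [ebar i - ebar k] are the exponents of the ratios of row
    monomials, uniformly in all rows. *)
Definition ebar (i : 'I_r.+1) : 'cV[int]_(r + s) :=
  if unlift ord0 i is Some k then delta_mx (lshift s k) 0 else 0.

Lemma dot_ebar i k a : dot (ebar i - ebar k) (v a) = (l_at i a)%:Z - (l_at k a)%:Z.
Proof.
suff H i' : dot (ebar i') (v a) = (l_at i' a)%:Z - (l_at ord0 a)%:Z by rewrite dotBl !H; ring.
rewrite /ebar; case: (unliftP ord0 i') => [k'|] ->; last by rewrite dot0l subrr.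
rewrite dot_delta /v /P_col col_mxEu; case: a => [[i0 j]|b] /=; last by rewrite mxE.
have l0 : (lift ord0 k' == ord0) = false by rewrite eq_sym (negbTE (neq_lift _ _)).
rewrite mxE; case: (eqVneq i0 ord0) => [E|i00].
  have -> : (i0 == lift ord0 k') = false by rewrite {1}E eq_sym l0.
  by rewrite sub0r.
by case: ifP => _; rewrite subr0.
Qed.

Lemma monom_TE (K : fieldType) (z : I -> K) i : monom_T l z i = \prod_a z a ^+ l_at i a.
Proof.
rewrite big_sumType /= [X in _ * X]big1 ?mulr1 //.
have := sig_big_dep (op := GRing.mul) (idx := 1 : K) predT (fun _ => predT)
   (fun i' (j : 'I_(n i')) => z (idx_ij m j) ^+ (if i' == i then l j else 0%N)).
rewrite (bigD1 i) //= [X in _ * X]big1 ?mulr1 => [|k ki]; last first.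
  by rewrite big1 // => j _; rewrite (negbTE ki) expr0.
rewrite eqxx /monom_T => ->; apply: eq_bigr => -[i' j] _ //=.
Qed.

(** Symmetric coordinates of the Z^r part of [u]. Row 0 receives minus the sum of the others, so
    that this part is the exponent of a product of powers of row monomials with exponents summing to
    zero. *)
Definition hcoef (i : 'I_r.+1) (u : 'cV[int]_(r + s)) : int :=
  if unlift ord0 i is Some k then u (lshift s k) 0 else - \sum_k u (lshift s k) 0.

(** Writes [hcoef] as a pairing, so that its vanishing can serve as a lattice constraint. *)
Definition hvec (i : 'I_r.+1) : 'cV[int]_(r + s) :=
  if unlift ord0 i is Some k then delta_mx (lshift s k) 0 else - \sum_k delta_mx (lshift s k) 0.

Lemma hcoefE i u : hcoef i u = dot (hvec i) u.
Proof.
rewrite /hcoef /hvec; case: unlift => [k|]; first by rewrite dot_delta.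
by rewrite dotNl dot_suml; congr GRing.opp; apply: eq_bigr => k _; rewrite dot_delta.
Qed.

Lemma hcoefD i u w : hcoef i (u + w) = hcoef i u + hcoef i w.
Proof. by rewrite !hcoefE dotDr. Qed.

Lemma hcoefN i u : hcoef i (- u) = - hcoef i u.
Proof. by rewrite !hcoefE dotNr. Qed.

Lemma hcoef_sum u : \sum_i hcoef i u = 0.
Proof.
rewrite big_ord_recl {1}/hcoef unlift_none.
rewrite [X in _ + X](eq_bigr (fun k => u (lshift s k) 0)) ?addNr // => k _.
by rewrite /hcoef liftK.
Qed.

Lemma hcoef_decomp u : u = \sum_i hcoef i u *: ebar i + col_mx 0 (dsubmx u).
Proof.
rewrite -{1}[u]vsubmxK -[in X in _ = X + _](vsubmxK (\sum_i _ *: _)) add_col_mx addr0.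
have -> : dsubmx (\sum_i hcoef i u *: ebar i) = 0.
  apply/colP => k; rewrite !mxE summxE big1 // => i _; rewrite mxE /ebar.
  by case: unlift => [k'|]; rewrite !mxE ?eq_rlshift ?mulr0.
rewrite add0r; congr col_mx; apply/colP => k; rewrite !mxE summxE.
rewrite big_ord_recl mxE /ebar unlift_none mxE mulr0 add0r (bigD1 k) //= big1 => [|j jk].
  by rewrite liftK !mxE !eqxx mulr1 addr0 /hcoef liftK.
by rewrite mxE liftK mxE eq_lshift eq_sym (negbTE jk) mulr0.
Qed.

Lemma dot_hcoef u a : dsubmx u = 0 -> dot u (v a) = \sum_i hcoef i u * (l_at i a)%:Z.
Proof.
move=> u0; rewrite {1}(hcoef_decomp u) u0 col_mx0 addr0 dot_suml.
transitivity (\sum_i (hcoef i u * (l_at i a)%:Z - hcoef i u * (l_at ord0 a)%:Z)).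
  apply: eq_bigr => i _; rewrite dotZl -mulrBr -dot_ebar; congr (_ * dot _ _).
  by rewrite {3}/ebar unlift_none subr0.
by rewrite sumrB -mulr_suml hcoef_sum mul0r subr0.
Qed.

Lemma dot_hcoef_idx u i (j : 'I_(n i)) : dsubmx u = 0 ->
  dot u (v (idx_ij m j)) = hcoef i u * (l j)%:Z.
Proof.
move=> /dot_hcoef ->; rewrite (bigD1 i) //= eqxx big1 ?addr0 // => k ki.
by rewrite eq_sym (negbTE ki) mulr0.
Qed.

Lemma dot_hcoef_inr u (k : 'I_m) : dsubmx u = 0 -> dot u (v (inr k)) = 0.
Proof. by move=> /dot_hcoef ->; rewrite big1 // => i _; rewrite mulr0. Qed.

Lemma hcoef_ebar i k k' : hcoef k' (ebar i - ebar k) = (k' == i)%:Z - (k' == k)%:Z.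
Proof.
suff H i' : hcoef k' (ebar i') = (k' == i')%:Z - (k' == ord0)%:Z by rewrite hcoefD hcoefN !H; ring.
rewrite /ebar; case: (unliftP ord0 i') => [q|] ->; last first.
  by rewrite subrr /hcoef; case: unlift => [k''|]; rewrite ?mxE // big1 ?oppr0 // => j _; rewrite mxE.
rewrite /hcoef; case: (unliftP ord0 k') => [q'|] ->.
  by rewrite mxE eqxx andbT eq_lshift (inj_eq lift_inj) natz [lift _ _ == ord0]eq_sym (negbTE (neq_lift _ _)) subr0.
rewrite (negbTE (neq_lift _ _)) eqxx (bigD1 q) //= big1 ?addr0 ?mxE ?eqxx // => j jq.
by rewrite mxE eq_lshift (negbTE jq).
Qed.

Lemma ebar_dsubmx i k : dsubmx (ebar i - ebar k) = 0.
Proof.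
suff H i' : dsubmx (ebar i') = 0 by rewrite linearB /= !H subrr.
apply/colP => j; rewrite !mxE /ebar; case: unlift => [k'|]; by rewrite !mxE ?eq_rlshift.
Qed.

End Indices.

(** * Affine charts *)

Lemma int_domination (U G : int) (k : nat) : 0 < U -> (`|G| <= k)%N -> 0 <= G + U * k%:Z.
Proof. move=> U0 Gk; have : - k%:Z <= G by lia. nia. Qed.

Section Geometry.
Variables (K : closedFieldType) (c r : nat) (n : 'I_r.+1 -> nat) (m s : nat).
Variables (A : 'M[K]_(c.+1, r.+1)) (l : forall i : 'I_r.+1, 'I_(n i) -> nat).
Variables (d : col_index n m -> 'cV[int]_s) (Sigma : set (set 'cV[rat]_(r + s))).
Hypothesis gav : explicit_gav A l d Sigma.
Let I : finType := col_index n m.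
Let v : I -> 'cV[int]_(r + s) := P_col l d.
Let X := X_var A l d Sigma.
Implicit Types (z : I -> K) (sigma tau : set 'cV[rat]_(r + s)).

Lemma gav_rank (f : 'I_c.+1 -> 'I_r.+1) : injective f -> \rank (colsub f A) = c.+1.
Proof. by case: gav => -[_ _ h _] _; exact: h. Qed.

Lemma gav_cr : (0 < c <= r)%N. Proof. by case: gav => -[]. Qed.

Lemma gav_n i : (0 < n i)%N. Proof. by case: gav => -[]. Qed.

Lemma gav_l i (j : 'I_(n i)) : (0 < l j)%N. Proof. by case: gav => -[_ _ _ h] _; exact: h. Qed.

Lemma gav_inj : injective v. Proof. by case: gav => _ []. Qed.

Lemma gav_prim a : primitive_vec (v a). Proof. by case: gav => _ [_ _ h _ _]; exact: h. Qed.

Lemma gav_span : linQ [set toQ (v a) | a in [set: I]] = [set: 'cV[rat]_(r + s)].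
Proof. by case: gav => _ []. Qed.

Lemma gav_fan : is_fan Sigma. Proof. by case: gav => _ [_ _ _ _ []]. Qed.

Lemma gav_rays : rays Sigma = [set ray (toQ (v a)) | a in [set: I]].
Proof. by case: gav => _ [_ _ _ _ []]. Qed.

(** The first [c.+1] columns determine the only candidate [rho]. A vanishing determinant yields a
    relation between the rows of the bordered matrix, in which the row of monomials occurs since the
    first [c.+1] columns of [A] are independent. So [rho] is also correct at column [c + t]. *)
Lemma barXP z : barX A l z <-> in_rowspace A (monom_T l z).
Proof.
pose f (t : nat) (k : 'I_(c.+1 + 1)) : 'I_r.+1 := inord (if (k <= c)%N then k : nat else c + t)%N.
pose Xr : 'rV[K]_r.+1 := \row_i monom_T l z i.
have cr : (c <= r)%N by case/andP: gav_cr.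
pose f0 (k : 'I_c.+1) : 'I_r.+1 := inord k.
have f0E (k : 'I_c.+1) : f0 k = k :> nat by rewrite inordK // ltnS (leq_trans (leq_ord k)).
have f0inj : injective f0 by move=> a b /(congr1 val) /=; rewrite !f0E => /val_inj.
have A0u : colsub f0 A \in unitmx by rewrite -row_full_unit /row_full gav_rank.
have ff0 t (k : 'I_c.+1) : f t (lshift 1 k) = f0 k by rewrite /f /= -ltnS ltn_ord.
have fmax t : f t (rshift c.+1 ord0) = inord (c + t) by rewrite /f /= addn0 ltnn.
have sub t (w : 'rV[K]_(c.+1 + 1)) k :
    (w *m colsub (f t) (col_mx A Xr)) 0 k = (lsubmx w *m A) 0 (f t k) + rsubmx w 0 0 * Xr 0 (f t k).
  transitivity ((w *m col_mx A Xr) 0 (f t k)).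
    by rewrite mxE [RHS]mxE; apply: eq_bigr => j _; rewrite mxE.
  by rewrite -{1}[w]hsubmxK mul_row_col mxE [X in _ + X]mxE big_ord1.
split=> [bar|[rho hx] t ht].
  pose rho := colsub f0 Xr *m invmx (colsub f0 A).
  exists rho => i.
  have [ic|ci] := leqP i c.
    have -> : i = f0 (inord i) by apply: ord_inj; rewrite f0E inordK.
    have -> : (rho *m A) 0 (f0 (inord i)) = (rho *m colsub f0 A) 0 (inord i).
      by rewrite !mxE; apply: eq_bigr => j _; rewrite !mxE.
    by rewrite mulmxKV // !mxE.
  have ht : (0 < i - c <= r - c)%N by rewrite subn_gt0 ci leq_sub2r // leq_ord.
  have Ei t : t = (i - c)%N -> f t (rshift c.+1 ord0) = i.
    by move=> ->; rewrite fmax subnKC ?inord_val // ltnW.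
  have /eqP/det0P[w w0 hw] := bar _ ht.
  have {}hw : w *m colsub (f (i - c)%N) (col_mx A Xr) = 0 := hw.
  have wk k : (lsubmx w *m A) 0 (f (i - c)%N k) + rsubmx w 0 0 * Xr 0 (f (i - c)%N k) = 0.
    by rewrite -sub hw mxE.
  set la := rsubmx w 0 0 in wk.
  have [la0|la0] := eqVneq la 0.
    case/eqP: w0; have l0 : lsubmx w = 0.
      apply: (can_inj (mulmxK A0u)); rewrite mul0mx; apply/rowP => k.
      have := wk (lshift 1 k); rewrite la0 mul0r addr0 ff0 => wk0; rewrite [RHS]mxE; apply: etrans wk0.
      by rewrite mxE [RHS]mxE; apply: eq_bigr => j _; rewrite !mxE.
    rewrite -[w]hsubmxK l0 (_ : rsubmx w = 0) ?row_mx0 //.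
    by apply/rowP => k; rewrite ord1 -/la la0 mxE.
  have Erho : rho = - la^-1 *: lsubmx w.
    apply: (can_inj (mulmxK A0u)); rewrite /rho mulmxKV //; apply/rowP => k.
    have := wk (lshift 1 k); rewrite ff0 => /eqP; rewrite addrC addr_eq0 => /eqP h.
    rewrite -scalemxAl [LHS]mxE [RHS]mxE; apply: (mulfI la0).
    rewrite h mulNr mulrN mulVKf //; congr (- _); rewrite mxE [RHS]mxE; apply: eq_bigr => j _; by rewrite !mxE.
  have := wk (rshift c.+1 ord0); rewrite Ei // => /eqP; rewrite addrC addr_eq0 => /eqP h.
  have -> : monom_T l z i = Xr 0 i by rewrite mxE.
  by apply: (mulfI la0); rewrite h Erho -scalemxAl [in RHS]mxE mulNr mulrN mulVKf.
apply/eqP/det0P; exists (row_mx (- rho) 1%:M).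
  apply/eqP => /rowP/(_ (rshift c.+1 ord0)); rewrite row_mxEr !mxE eqxx => /eqP.
  by rewrite oner_eq0.
apply/rowP => k; rewrite sub row_mxKl row_mxKr mulNmx !mxE eqxx mul1r hx [X in _ + X]mxE.
by rewrite addNr.
Qed.

Lemma cone_mono_face sigma tau : face tau sigma -> tau `<=` sigma.
Proof. by move=> [u [_ ->]] x []. Qed.

Lemma face_refl sigma : face sigma sigma.
Proof.
exists 0; split=> [x _|]; first by rewrite dot0l.
by apply/seteqP; split=> [x sx|x []//]; split=> //=; rewrite dot0l.
Qed.

Lemma smallest_cone z sigma : Sigma sigma -> (forall a, z a = 0 -> sigma (toQ (v a))) ->
  let tau := \bigcap_(s in cones_over v Sigma z) s in
  [/\ Sigma tau, face tau sigma & forall a, z a = 0 -> tau (toQ (v a))].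
Proof.
move=> Ss zs tau; have [/finite_seqP[ss Ess] _ fan3 fan4] := gav_fan.
pose cov := cones_over v Sigma z.
(* A fan is closed under pairwise intersection only, so the covering cones are intersected along the
   finite list. *)
have step (q : seq (set 'cV[rat]_(r + s))) rho : cov rho ->
    exists2 t, cov t & t = rho `&` [set x | forall s', s' \in q -> cov s' -> s' x].
  elim: q rho => [|s' q IH] rho hrho; first by exists rho => //; apply/seteqP; split=> // x [].
  have [cs'|ncs'] := pselect (cov s'); last first.
    have [t ct Et] := IH rho hrho; exists t => //; rewrite Et.
    apply/seteqP; split=> x [rx H]; split=> // s''; last by move=> sq; apply: H; rewrite inE sq orbT.
    by rewrite inE => /orP[/eqP -> //|]; exact: H.
  have cov' : cov (rho `&` s').
    split; first by have [+ _] := fan4 _ _ hrho.1 cs'.1; exact: fan3 hrho.1.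
    by move=> a za; split; [exact: hrho.2 | exact: cs'.2].
  have [t ct Et] := IH _ cov'; exists t => //; rewrite Et.
  apply/seteqP; split=> x; last first.
    move=> [rx H]; split; last by move=> s'' sq; apply: H; rewrite inE sq orbT.
    by split=> //; apply: H => //; rewrite mem_head.
  move=> [[rx sx] H]; split=> // s''; rewrite inE => /orP[/eqP -> //|]; exact: H.
have [|t ct Et] := @step ss sigma; first by split.
have Etau : tau = t.
  rewrite Et; apply/seteqP; split=> x.
    by move=> H; split=> [|s' _ cs']; apply: H => //; split.
  move=> [sx H] s' cs'; apply: H => //; have := cs'.1; by rewrite Ess.
have ts : tau `<=` sigma by rewrite Etau Et => x [].
split; [by rewrite Etau; case: ct | | by rewrite Etau; case: ct].
have := (fan4 _ _ Ss ct.1).1; rewrite -Etau; congr face.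
by apply/seteqP; split=> [x []//|x tx]; split=> //; exact: ts.
Qed.

(** The points of hat X lying over the chart of [sigma]. *)
Definition chart_lift sigma z : Prop :=
  barX A l z /\ forall a, z a = 0 -> sigma (toQ (v a)).

Lemma chart_point sigma z : Sigma sigma -> chart_lift sigma z ->
  exists y : affine_chart X sigma, forall u, dual_chars sigma u -> pchar_at (val y) u = ev v z u.
Proof.
move=> Ss [bz zs]; have [S' fa _] := smallest_cone Ss zs.
have hx : affine_chart X sigma (cox_map v Sigma z).
  split=> //; exists z => //; split=> //; by exists sigma; split.
exists (exist (fun y => y \in affine_chart X sigma) _ (mem_set hx)) => u du /=; rewrite mem_set //.
by move=> x tx; apply: du; exact: (cone_mono_face fa).
Qed.

Lemma chart_pointP sigma (y : affine_chart X sigma) :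
  exists2 z, chart_lift sigma z & forall u, dual_chars sigma u -> pchar_at (val y) u = ev v z u.
Proof.
case: y => y yP /=; have [[z [bz [rho [Sr zr]]] Ey] fa] := set_mem yP.
have [S' _ ze] := smallest_cone Sr zr.
move: fa; rewrite -Ey /= => fa; exists z.
  by split=> // a /ze; exact: (cone_mono_face fa).
move=> u du; rewrite mem_set // => x tx; apply: du; exact: (cone_mono_face fa).
Qed.

Lemma chart_lift_dual sigma z u a : Sigma sigma -> chart_lift sigma z -> dual_chars sigma u ->
  z a = 0 -> 0 <= dot u (v a).
Proof.
move=> Ss [_ h] du /h sa; exact: (dual_charsP gav_fan gav_rays u Ss).1 du a sa.
Qed.

Lemma dual_charsD sigma u w : dual_chars sigma u -> dual_chars sigma w -> dual_chars sigma (u + w).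
Proof.
move=> du dw x sx; have -> : toQ (u + w) = toQ u + toQ w by apply/colP => i; rewrite !mxE intrD.
by rewrite dotDl addr_ge0 ?du ?dw.
Qed.

Lemma dual_chars0 sigma : dual_chars sigma 0.
Proof. by move=> x _; rewrite toQ0 dot0l. Qed.

Lemma pchar0 sigma (y : affine_chart X sigma) : pchar_at (val y) 0 = 1.
Proof. by have [z _ ->] := chart_pointP y; [exact: ev0 | exact: dual_chars0]. Qed.

Lemma pcharD sigma (y : affine_chart X sigma) u w : Sigma sigma -> dual_chars sigma u ->
  dual_chars sigma w -> pchar_at (val y) (u + w) = pchar_at (val y) u * pchar_at (val y) w.
Proof.
move=> Ss du dw; have [z hz E] := chart_pointP y; rewrite !E //; last exact: dual_charsD.
by apply: evD => a; exact: (chart_lift_dual Ss hz).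
Qed.

Lemma chart_ringP sigma (f : affine_chart X sigma -> K) :
  chart_ring (Y := X) (sigma := sigma) f <->
  exists2 q : seq (K * 'cV[int]_(r + s)), forall a, a \in q -> dual_chars sigma a.2
    & f = fun y => \sum_(a <- q) a.1 * pchar_at (val y) a.2.
Proof.
split=> [[k [a [u [du ->]]]]|[q dq ->]].
  exists [seq (a i, u i) | i <- index_enum 'I_k] => [_ /mapP[i _ ->]|]; first exact: du.
  by apply/funext => y; rewrite big_map.
exists (size q), (fun i => (nth (0, 0) q i).1), (fun i => (nth (0, 0) q i).2); split.
  by move=> i; apply: dq; rewrite mem_nth.
by apply/funext => y; rewrite (big_nth (0, 0)) big_mkord.
Qed.

Lemma chart_ring_subalgebra sigma : Sigma sigma -> subalgebra (chart_ring (Y := X) (sigma := sigma)).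
Proof.
move=> Ss; split.
- move=> b; apply/chart_ringP; exists [:: (b, 0)] => [a|].
    by rewrite inE => /eqP ->; exact: dual_chars0.
  by apply/funext => y; rewrite big_seq1 pchar0 mulr1.
- move=> f g /chart_ringP[q dq ->] /chart_ringP[q' dq' ->]; apply/chart_ringP.
  exists (q ++ q') => [a|]; first by rewrite mem_cat => /orP[/dq|/dq'].
  by apply/funext => y; rewrite big_cat.
move=> f g /chart_ringP[q dq ->] /chart_ringP[q' dq' ->]; apply/chart_ringP.
exists [seq (a.1 * b.1, a.2 + b.2) | a <- q, b <- q'].
  by move=> _ /allpairsP[[a b] /= [/dq Sa /dq' Sb ->]]; exact: dual_charsD.
apply/funext => y; rewrite big_allpairs_dep /= mulr_suml big_seq [RHS]big_seq.
apply: eq_bigr => a /dq Sa; rewrite mulr_sumr big_seq [RHS]big_seq.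
by apply: eq_bigr => b /dq' Sb; rewrite pcharD //; ring.
Qed.

Lemma chart_ring_char sigma u : dual_chars sigma u ->
  chart_ring (Y := X) (sigma := sigma) (fun y => pchar_at (val y) u).
Proof.
move=> du; apply/chart_ringP; exists [:: (1, u)] => [a|]; first by rewrite inE => /eqP ->.
by apply/funext => y; rewrite big_seq1 mul1r.
Qed.

(** A point of the piece is a torus translate of the distinguished point: its smallest chart is that
    of [sigma], and the characters that are not units on this chart vanish at it. *)
Lemma piece_smoothP sigma x : Sigma sigma -> piece A l d Sigma sigma x ->
  exists y : affine_chart X sigma, [/\ val y = x,
    smooth_at X x <-> smooth_point (chart_ring (Y := X) (sigma := sigma)) y
    & forall u, dual_chars sigma u -> ~ perp_chars sigma u -> pchar_at (val y) u = 0].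
Proof.
move=> Ss [Xx [t _ Ex]]; move: Xx; rewrite -Ex => Xx.
have hx : affine_chart X sigma (torus_act t (distinguished_point K sigma)).
  by split=> //; exact: face_refl.
exists (exist (fun y => y \in affine_chart X sigma) _ (mem_set hx)); split=> //=.
  split=> [[y Ey sm]|sm]; last by exists (exist (fun y => y \in affine_chart X sigma) _ (mem_set hx)).
  by rewrite (_ : exist (fun y => y \in affine_chart X sigma) _ _ = y) //; exact: val_inj.
by move=> u _ nu; rewrite memNset // mulr0.
Qed.

(** Choose a vector of the row space that vanishes exactly in the rows met by [Z], and realize each
    nonzero entry by a root in the first variable of its row, with all other nonzero coordinates
    equal to 1. *)
Lemma big_leaf_pattern (Z : pred I) :
  (forall i, exists j : 'I_(n i), Z (idx_ij m j)) \/
  (exists2 J : {set 'I_r.+1}, #|J| = c & forall i (j : 'I_(n i)), Z (idx_ij m j) -> i \in J) ->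
  exists2 z, barX A l z & forall a, z a = 0 <-> Z a.
Proof.
move=> hZ; pose row_hit i := [exists j : 'I_(n i), Z (idx_ij m j)].
have [x Lx x0] : exists2 x, in_rowspace A x & forall i, x i = 0 <-> row_hit i.
  case: hZ => [hb|[J EJ hJ]].
    exists (fun=> 0); first by exists 0 => i; rewrite mul0mx mxE.
    by move=> i; split=> // _; apply/existsP; exact: hb.
  apply: (rowspace_zero_pattern gav_rank _ EJ); first by case/andP: gav_cr.
  by move=> i /existsP[j /hJ].
have /choice[rt hrt] i : exists w, w ^+ l (Ordinal (gav_n i)) = x i.
  by apply: closed_field_root; exact: gav_l.
pose z (a : I) : K := if Z a then 0 else
  if a is inl p then
    if row_hit (tag p) then 1 else if (tagged p == 0 :> nat)%N then rt (tag p) else 1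
  else 1.
exists z.
  apply/barXP; rewrite (_ : monom_T l z = x) //; apply/funext => i; rewrite /monom_T.
  have [hit|nhit] := boolP (row_hit i).
    rewrite (iffRL (x0 i) hit); have /existsP[j Zj] := hit.
    by rewrite (bigD1 j) //= /z Zj expr0n gtn_eqF ?gav_l // mul0r.
  have nZ j : Z (idx_ij m (i := i) j) = false.
    by apply: contraNF nhit => Zj; apply/existsP; exists j.
  rewrite (bigD1 (Ordinal (gav_n i))) //= big1 => [|j jne].
    by rewrite /z nZ /= -/(row_hit i) (negbTE nhit) mulr1 hrt.
  by rewrite /z nZ /= -/(row_hit i) (negbTE nhit) (negbTE (jne : (j : nat) != 0%N)) expr1n.
move=> a; rewrite /z; case: (boolP (Z a)) => // nZ; split=> // /eqP.
case: a nZ => [[i j]|k] nZ /=; last by rewrite oner_eq0.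
case: ifP => [_|nhit]; first by rewrite oner_eq0.
case: ifP => [_ /eqP rt0|_]; last by rewrite oner_eq0.
have := hrt i; rewrite rt0 expr0n gtn_eqF ?gav_l // => /esym/x0.
by move: nhit; rewrite /row_hit /= => ->.
Qed.

Lemma piece_point sigma z : Sigma sigma -> barX A l z ->
  (forall a, z a = 0 <-> sigma (toQ (v a))) -> piece A l d Sigma sigma (cox_map v Sigma z).
Proof.
move=> Ss bz zs; have zs1 a : z a = 0 -> sigma (toQ (v a)) by move/zs.
split; first by exists z => //; split=> //; exists sigma; split.
have [St fa tz] := smallest_cone Ss zs1.
set tau := \bigcap_(s in _) s in St fa tz.
have Et : tau = sigma.
  apply/seteqP; split; first exact: (cone_mono_face fa).
  rewrite {1}(fan_cone_generated gav_fan gav_rays Ss); apply: cone_min.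
    by have [_ f2 _ _] := gav_fan; exact: polyhedral_convex (f2 _ St).1.
  by move=> _ [a /= /zs za <-]; exact: tz.
(* The torus element is the image of [z] with its vanishing coordinates left out. *)
pose t (i : 'I_(r + s)) : K := \prod_(a | ~~ ray_mem v sigma a) z a ^ v a i 0.
have za a : ~~ ray_mem v sigma a -> z a != 0.
  by move=> /ray_memP na; apply/eqP => /zs.
exists t; first by move=> i; apply/prodf_neq0 => a /za za0; rewrite expfz_neq0.
rewrite /torus_act /cox_map -/tau Et; congr ToricPoint; apply/funext => u /=.
have tE : \prod_i t i ^ u i 0 = \prod_(a | ~~ ray_mem v sigma a) z a ^ dot u (v a).
  under eq_bigr => i _ do rewrite -[t i]/(\prod_(a | _) _) big_mkcond prod_exprz.
  rewrite exchange_big [RHS]big_mkcond; apply: eq_bigr => a _.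
  case: ifP => [/za za0|_]; last by rewrite big1 // => i _; rewrite exp1rz.
  rewrite /dot exprz_prod //; apply: eq_bigr => i _; by rewrite exprz_exp mulrC.
have [up|nup] := pselect (perp_chars sigma u).
  have ud : dual_chars sigma u by move=> x /up ->.
  rewrite !mem_set // mulr1 tE [RHS](bigID (ray_mem v sigma)) /= [X in _ = X * _]big1 ?mul1r // => a /ray_memP sa.
  by rewrite (iffLR (perp_charsP gav_fan gav_rays u Ss) up) // expr0z.
rewrite (memNset nup) mulr0; have [ud|nud] := pselect (dual_chars sigma u); last by rewrite memNset.
rewrite mem_set //; have [a [sa ua]] : exists a, sigma (toQ (v a)) /\ dot u (v a) <> 0.
  apply: contrapT => no; apply: nup; apply/(perp_charsP gav_fan gav_rays u Ss) => a sa.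
  by apply: contrapT => ua; apply: no; exists a.
by symmetry; apply: (ev_eq0 (v := v) (a := a)); [exact/zs | exact/eqP].
Qed.

(** Nonemptiness is needed to pass from smoothness of the whole piece to a smooth point in it. *)
Lemma big_leaf_piece sigma : Sigma sigma -> big_cone l d sigma \/ leaf_cone c l d sigma ->
  exists x, piece A l d Sigma sigma x.
Proof.
move=> Ss bl; have [|z bz hz] := @big_leaf_pattern (ray_mem v sigma).
  case: bl => [big|[J [EJ hJ]]]; [left|right].
    by move=> i; have [j sj] := big i; exists j; apply/ray_memP.
  by exists J => // i j /ray_memP; exact: hJ.
exists (cox_map v Sigma z); apply: piece_point => // a.
by split=> [/hz/ray_memP|/ray_memP/hz].
Qed.

Lemma leaf_rows (i0 : 'I_r.+1) : exists2 J : {set 'I_r.+1}, #|J| = c & i0 \in J.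
Proof.
have /andP[c0 cr] := gav_cr.
have : (c.-1 <= #|[set~ i0]%SET|)%N by rewrite cardsC1 card_ord; lia.
case/card_geqP => q [uq sq qs]; exists (i0 |: [set i in q])%SET; last by rewrite !inE eqxx.
rewrite cardsU1 inE cardsE (card_uniqP uq) sq.
have -> : i0 \notin q by apply/negP => /qs; rewrite !inE eqxx.
by rewrite add1n prednK.
Qed.

(** A generic point of the divisor of [a]: a single row always fits into an index set of size [c],
    since [c] is positive. *)
Lemma ray_point sigma a : Sigma sigma -> sigma (toQ (v a)) ->
  exists y : affine_chart X sigma, forall u, dual_chars sigma u ->
    pchar_at (val y) u != 0 <-> dot u (v a) = 0.
Proof.
move=> Ss sa; have [|z bz hz] := @big_leaf_pattern (pred1 a).
  right; have [J EJ iJ] := leaf_rows (if a is inl p then tag p else ord0).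
  by exists J => // i j /eqP E; move: iJ; rewrite -E.
have [|y hy] := @chart_point sigma z Ss; first by split=> // b /hz /eqP ->.
exists y => u du; rewrite hy //; split=> [e0|e0].
  apply/eqP; apply: contraT => ua; move: e0; rewrite (ev_eq0 (a := a)) ?eqxx //.
  by apply/hz; rewrite /= eqxx.
by apply: ev_neq0 => b /hz /eqP ->.
Qed.

Lemma torus_point sigma : Sigma sigma ->
  exists y : affine_chart X sigma, forall u, dual_chars sigma u -> pchar_at (val y) u != 0.
Proof.
move=> Ss; have [|z bz hz] := @big_leaf_pattern xpred0.
  by right; have [J EJ _] := leaf_rows ord0; exists J.
have [|y hy] := @chart_point sigma z Ss; first by split=> // b /hz.
by exists y => u du; rewrite hy //; apply: ev_neq0 => b /hz.
Qed.

Lemma monom_T_mul z z' i : monom_T l (fun a => z a * z' a) i = monom_T l z i * monom_T l z' i.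
Proof. by rewrite /monom_T -big_split; apply: eq_bigr => j _; rewrite exprMn. Qed.

Lemma monom_T_ratio z i k : (forall a, z a = 0 -> l_at l k a = 0%N) ->
  monom_T l z i = monom_T l z k * ev v z (ebar s i - ebar s k).
Proof.
move=> z0; rewrite !monom_TE /ev -big_split; apply: eq_bigr => a _ /=; rewrite dot_ebar.
have [/z0 ->|za] := eqVneq (z a) 0; first by rewrite subr0 mul1r.
by rewrite !exprnP -expfzDr // addrC subrK.
Qed.

Lemma torus_lift (phi : 'cV[int]_(r + s) -> K) :
  (forall u w, phi (u + w) = phi u * phi w) -> (forall u, phi u != 0) ->
  exists zeta : I -> K, [/\ forall a, zeta a != 0, forall u, ev v zeta u = phi u
    & forall i k, monom_T l zeta i = monom_T l zeta k * phi (ebar s i - ebar s k)].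
Proof.
move=> phiD phi0; have [zeta z0 hz] := torus_surjective gav_span phiD phi0.
exists zeta; split=> // i k; rewrite -hz; apply: monom_T_ratio => a /eqP.
by rewrite (negbTE (z0 a)).
Qed.

Lemma facet_dual sigma a : Sigma sigma -> sigma (toQ (v a)) ->
  exists u, [/\ dual_chars sigma u, dot u (v a) = 0
    & forall b, sigma (toQ (v b)) -> b != a -> 0 < dot u (v b)].
Proof.
move=> Ss sa; have [u [u0 hu]] := facet_character gav_fan gav_rays gav_inj gav_prim Ss sa.
exists u; split=> //; apply/(dual_charsP gav_fan gav_rays u Ss) => b sb.
by have [->|ba] := eqVneq b a; [rewrite u0 | apply: ltW; exact: hu].
Qed.

(** A functional with value 1 on the primitive column becomes nonnegative on the other rays after
    adding a large multiple of a character that vanishes on this ray and is positive on the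
    others. *)
Lemma primitive_dual sigma a : Sigma sigma -> sigma (toQ (v a)) ->
  exists2 u, dual_chars sigma u & dot u (v a) = 1.
Proof.
move=> Ss sa; have [u [du u0 hu]] := facet_dual Ss sa.
have [g ga] := primitive_functional (gav_prim a).
pose k := (\sum_b `|dot g (v b)|)%N; exists (g + u *+ k); last by rewrite dotDl dotMnl u0 mul0rn addr0.
apply/(dual_charsP gav_fan gav_rays _ Ss) => b sb; rewrite dotDl dotMnl.
have [->|ba] := eqVneq b a; first by rewrite u0 mul0rn addr0 ga.
have : (`|dot g (v b)| <= k)%N by rewrite /k (bigD1 b) //= leq_addr.
have := hu b sb ba; rewrite -mulr_natr natz; move: (dot u (v b)) (dot g (v b)) => U G.
exact: int_domination.
Qed.

End Geometry.

(** * Generators of the chart at a smooth point *)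

Section SmoothStructure.
Variables (K : closedFieldType) (c r : nat) (n : 'I_r.+1 -> nat) (m s : nat).
Variables (A : 'M[K]_(c.+1, r.+1)) (l : forall i : 'I_r.+1, 'I_(n i) -> nat).
Variables (d : col_index n m -> 'cV[int]_s) (Sigma : set (set 'cV[rat]_(r + s))).
Hypothesis gav : explicit_gav A l d Sigma.
Let I : finType := col_index n m.
Let v : I -> 'cV[int]_(r + s) := P_col l d.
Let X := X_var A l d Sigma.
Let M : zmodType := 'cV[int]_(r + s).
Variable sigma : set 'cV[rat]_(r + s).
Hypothesis Ss : Sigma sigma.

Variables (P : finType) (xp : P -> 'cV[int]_(r + s)).
(** Cuts the characters down to a sublattice. There are no constraints for big cones; for leaf cones
    they remove the components in the outer rows. *)
Definition constrained (u : M) : Prop := forall p, dot (xp p) u = 0.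
Definition chart_monoid : set M := [set u | dual_chars sigma u /\ constrained u].
Definition chart_units : set M := [set u | perp_chars sigma u /\ constrained u].
Definition chart_char (u : M) (y : affine_chart X sigma) : K := pchar_at (val y) u.

Variables (D : zmodType) (deg : {additive M -> D}) (wt : {additive D -> int}).
Hypotheses (wt_ge0 : forall u, chart_monoid u -> 0 <= wt (deg u))
  (wt_eq0 : forall u, chart_monoid u -> wt (deg u) = 0 -> chart_units u)
  (wtU : forall u, chart_units u -> wt (deg u) = 0)
  (degU : forall u w, chart_units u -> chart_units w -> deg u = deg w -> u = w)
  (homogeneous : forall q : seq (K * M), (forall a, a \in q -> chart_monoid a.2) ->
    (forall y, monomial_sum chart_char q y = 0) ->
    forall z y, \sum_(a <- q | deg a.2 == z) a.1 * chart_char a.2 y = 0)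
  (clearing : forall f, chart_ring (Y := X) (sigma := sigma) f ->
     exists tau, [/\ char_span chart_monoid chart_char tau, forall t, tau t != 0
     & char_span chart_monoid chart_char (fun t => tau t * f t)])
  (project : forall u, exists2 u', constrained u' & forall a, sigma (toQ (v a)) ->
     dot u' (v a) = dot u (v a)).

Let dualP u := dual_charsP (gav_fan gav) (gav_rays gav) u Ss.
Let perpP u := perp_charsP (gav_fan gav) (gav_rays gav) u Ss.

Lemma constrainedD u w : constrained u -> constrained w -> constrained (u + w).
Proof. by move=> hu hw p; rewrite dotDr hu hw addr0. Qed.

Lemma constrainedN u : constrained u -> constrained (- u).
Proof. by move=> hu p; rewrite dotNr hu oppr0. Qed.

(** The units are the kernel of the integral matrix whose rows are the rays of [sigma] and the
    constraints. *)
Lemma units_basis : exists (n0 : nat) (w kap : 'I_n0 -> 'cV[int]_(r + s)),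
  [/\ forall j, chart_units (w j), forall u, chart_units u -> u = \sum_j w j *~ dot (kap j) u
    & forall i j, dot (kap j) (w i) = (i == j)%:Z].
Proof.
pose rows : (I + P) -> 'cV[int]_(r + s) := fun k => match k with
  | inl a => if ray_mem v sigma a then v a else 0 | inr p => xp p end.
pose B : 'M[int]_(#|{: I + P}|, r + s) := \matrix_(i, j) rows (enum_val i) j 0.
have BP u : B *m u = 0 <-> chart_units u.
  have E i : (B *m u) i 0 = dot (rows (enum_val i)) u.
    by rewrite mxE; apply: eq_bigr => j _; rewrite mxE.
  split=> [B0|[up uc]].
    have H k : dot (rows k) u = 0 by rewrite -[k]enum_rankK -E B0 mxE.
    split; last by move=> p; exact: (H (inr p)).
    apply/perpP => a /ray_memP sa; rewrite dotC; have := H (inl a); by rewrite /= sa.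
  apply/colP => i; rewrite E mxE; case: (enum_val i) => [a|p] /=; last exact: uc.
  case: ifP => [/ray_memP sa|_]; last exact: dot0l.
  by rewrite dotC; exact: (perpP u).1 up a sa.
have [n0 [w [kap [h1 h2 h3]]]] := kernel_basis B.
exists n0, w, kap; split=> // [j|u /BP/h2 Eu]; first exact/BP.
by rewrite {1}Eu; apply: eq_bigr => j _; rewrite -scaler_int intz.
Qed.

Lemma chart_graded n0 (w kap : 'I_n0 -> 'cV[int]_(r + s)) :
  (forall j, chart_units (w j)) -> (forall u, chart_units u -> u = \sum_j w j *~ dot (kap j) u) ->
  (forall i j, dot (kap j) (w i) = (i == j)%:Z) ->
  graded_characters deg wt chart_monoid chart_units chart_char
    (chart_ring (Y := X) (sigma := sigma)) w (fun j => dot (kap j)).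
Proof.
move=> Uw basis kw.
have perp_dual u : perp_chars sigma u -> dual_chars sigma u by move=> h x /h ->.
split=> //.
- by split=> [x _|p]; rewrite ?toQ0 ?dot0l ?dot0r.
- move=> u u' [pu cu] [pu' cu']; split; last exact: constrainedD.
  by apply/perpP => a sa; rewrite dotDl (perpP u).1 // (perpP u').1 // addr0.
- move=> u [pu cu]; split; last exact: constrainedN.
  by apply/perpP => a sa; rewrite dotNl (perpP u).1 // oppr0.
- by move=> u [pu cu]; split=> //; exact: perp_dual.
- by move=> u u' [pu cu] [pu' cu']; split; [exact: dual_charsD | exact: constrainedD].
- by move=> t; exact: pchar0.
- by move=> u u' t [du _] [du' _]; exact: pcharD.
- exact: chart_ring_subalgebra.
- move=> f [q hq ->]; apply/chart_ringP; exists q => // a /hq; by case.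
Qed.

Let R : finType := {a : I | ray_mem v sigma a}.

(** [smooth_generators] supplies the [h i] and [generator_is_ray] identifies their orders. The
    auxiliary characters needed there are moved into the sublattice by [project], which preserves
    the pairings with the rays of [sigma]. *)
Theorem smooth_structure (x : affine_chart X sigma) :
  (forall u, dual_chars sigma u -> ~ perp_chars sigma u -> pchar_at (val x) u = 0) ->
  smooth_point (chart_ring (Y := X) (sigma := sigma)) x ->
  exists (n0 : nat) (w kap : 'I_n0 -> 'cV[int]_(r + s)) (e : nat) (h : 'I_e -> 'cV[int]_(r + s)),
  [/\ graded_characters deg wt chart_monoid chart_units chart_char
       (chart_ring (Y := X) (sigma := sigma)) w (fun j => dot (kap j)),
     alg_independent (chart_coord chart_char w h),
     forall i, chart_monoid (h i),
     forall u, chart_monoid u -> graded_span deg chart_units chart_char h (deg u) (chart_char u)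
   & forall i, exists2 a, sigma (toQ (v a)) & forall b, sigma (toQ (v b)) -> dot (h i) (v b) = (b == a)%:Z].
Proof.
move=> x0 sm.
have [n0 [w [kap [Uw basis kw]]]] := units_basis.
have gc := chart_graded Uw basis kw.
have x0' u : chart_monoid u -> ~ chart_units u -> chart_char u x = 0.
  by move=> [du cu] nu; apply: x0 => // pu; apply: nu.
have [e [h [Sh nUh indep gen]]] := smooth_generators gc x0' sm.
exists n0, w, kap, e, h; split=> // i.
have sR (rho : R) : sigma (toQ (v (val rho))) by apply/ray_memP; exact: valP rho.
pose ord (rho : R) : {additive M -> int} := dot (v (val rho)).
have ordE rho u : ord rho u = dot u (v (val rho)) by exact: dotC.
have /choice[pt hpt] (rho : R) := ray_point gav Ss (sR rho).
have /choice[fu hfu] (rho : R) : exists u, [/\ chart_monoid u, dot u (v (val rho)) = 0 &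
    forall b, sigma (toQ (v b)) -> b != val rho -> 0 < dot u (v b)].
  have [u [du u0 hu]] := facet_dual gav Ss (sR rho); have [u' cu' Eu'] := project u.
  exists u'; split; [split=> // | by rewrite Eu' | by move=> b sb; rewrite Eu' //; exact: hu].
  by apply/dualP => a sa; rewrite Eu' //; exact: (dualP u).1.
have /choice[gu hgu] (rho : R) : exists u, chart_monoid u /\ dot u (v (val rho)) = 1.
  have [u du u1] := primitive_dual gav Ss (sR rho); have [u' cu' Eu'] := project u.
  exists u'; split; last by rewrite Eu'.
  by split=> //; apply/dualP => a sa; rewrite Eu' //; exact: (dualP u).1.
have [||||||||||rho hrho] := @generator_is_ray K _ M D deg wt chart_monoid chart_units chart_char _
  n0 w (fun j => dot (kap j)) gc R ord pt fu gu _ _ _ _ _ _ _ _ _ e h Sh nUh indep _ i.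
- by move=> rho u [du _]; rewrite ordE; exact: (dualP u).1.
- move=> u u' [du cu] [du' cu'] H; split.
    apply/dualP => a sa; rewrite dotBl subr_ge0.
    by have := H (exist _ a (introT (ray_memP v sigma a) sa)); rewrite !ordE.
  by apply: constrainedD => //; exact: constrainedN.
- move=> u [du cu] H; split=> //; apply/perpP => a sa.
  by have := H (exist _ a (introT (ray_memP v sigma a) sa)); rewrite !ordE.
- by move=> rho u [du _]; rewrite ordE; exact: hpt.
- by move=> rho; case: (hfu rho).
- by move=> rho; rewrite ordE; case: (hfu rho).
- move=> rho rho' ne; rewrite ordE; case: (hfu rho) => _ _; apply=> //.
- by move=> rho; case: (hgu rho).
- by move=> rho; rewrite ordE; case: (hgu rho).
- move=> u Su; exact: (laurent_rep_char gc Sh gen).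
exists (val rho) => // b sb.
have := hrho (exist _ b (introT (ray_memP v sigma b) sb)); rewrite ordE /= => ->.
by rewrite -val_eqE.
Qed.

End SmoothStructure.

(** * Smooth points over leaf cones *)

Lemma big_pred_const (K : fieldType) (I : eqType) (D : Type) (s : seq I) (P : pred I) (F : I -> K)
    (g : I -> D) (G : D -> K) (z : D) : (forall a, a \in s -> P a -> g a = z) ->
  \sum_(a <- s | P a) F a = 0 -> \sum_(a <- s | P a) F a * G (g a) = 0.
Proof.
move=> H s0; rewrite big_seq_cond (eq_bigr (fun a => F a * G z)); last first.
  by move=> a /andP[sa Pa]; rewrite H.
by rewrite -big_seq_cond -mulr_suml s0 mul0r.
Qed.

Section Leaf.
Variables (K : closedFieldType) (c r : nat) (n : 'I_r.+1 -> nat) (m s : nat).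
Variables (A : 'M[K]_(c.+1, r.+1)) (l : forall i : 'I_r.+1, 'I_(n i) -> nat).
Variables (d : col_index n m -> 'cV[int]_s) (Sigma : set (set 'cV[rat]_(r + s))).
Hypothesis gav : explicit_gav A l d Sigma.
Let I : finType := col_index n m.
Let v : I -> 'cV[int]_(r + s) := P_col l d.
Let X := X_var A l d Sigma.
Let M : zmodType := 'cV[int]_(r + s).
Variable sigma : set 'cV[rat]_(r + s).
Hypothesis Ss : Sigma sigma.
Variables (J : {set 'I_r.+1}) (i0 : 'I_r.+1).
Hypotheses (EJ : #|J| = c) (hJ : forall i (j : 'I_(n i)), sigma (v_ij l d j) -> i \in J)
  (i0J : i0 \notin J).
Variables (f : 'I_c.+1 -> 'I_r.+1) (cf : 'I_r.+1 -> 'I_c.+1 -> K) (k0 : 'I_c.+1).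
Hypotheses (finj : injective f) (fC : forall i, (i \in J) || (i == i0) <-> exists k, f k = i)
  (fk0 : f k0 = i0)
  (cf1 : forall x, in_rowspace A x <-> forall i, x i = \sum_k cf i k * x (f k))
  (cf2 : forall k k', cf (f k) k' = (k' == k)%:R)
  (cf3 : forall i k, (forall k', f k' != i) -> cf i k != 0).

Let dualP u := dual_charsP (gav_fan gav) (gav_rays gav) u Ss.
Let perpP u := perp_charsP (gav_fan gav) (gav_rays gav) u Ss.

(* On the chart, the characters ebar i - ebar i0 of the outer rows are units which are
   linear combinations of those of the inner rows; characters with no outer component
   satisfy no linear relation, and they span the chart ring up to these units. *)
Definition outer_row (i : 'I_r.+1) : bool := (i \notin J) && (i != i0).
Definition leaf_constraint (i : 'I_r.+1) : 'cV[int]_(r + s) := if outer_row i then hvec s i else 0.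
Let S : set M := chart_monoid sigma leaf_constraint.
Let U : set M := chart_units sigma leaf_constraint.
Let chi := chart_char (A := A) (l := l) (d := d) (Sigma := Sigma) (sigma := sigma).

Lemma leaf_constrained u :
  constrained leaf_constraint u <-> forall i, outer_row i -> hcoef i u = 0.
Proof.
split=> [h i oi|h i]; first by have := h i; rewrite /leaf_constraint oi hcoefE.
by rewrite /leaf_constraint; case: ifP => [/h|_]; rewrite ?dot0l ?hcoefE.
Qed.

Lemma sigma_row a i : sigma (toQ (v a)) -> i \notin J -> l_at l i a = 0%N.
Proof.
case: a => [[i' j]|k] //= sa; case: eqP => // E /negP[]; rewrite -E; exact: hJ sa.
Qed.

Lemma outer_unit i a : outer_row i -> sigma (toQ (v a)) -> dot (ebar s i - ebar s i0) (v a) = 0.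
Proof. by move=> /andP[iJ _] sa; rewrite dot_ebar !sigma_row. Qed.

Lemma f_inner k : f k \in J \/ f k = i0.
Proof.
have : (f k \in J) || (f k == i0) by apply/fC; exists k.
by case/orP => [|/eqP]; [left|right].
Qed.

Lemma ratio_monoid i : i \in J \/ i = i0 -> S (ebar s i - ebar s i0).
Proof.
move=> hi; split; last first.
  apply/leaf_constrained => k /andP[kJ ki0]; rewrite hcoef_ebar (negbTE ki0) subr0.
  case: hi => [iJ|->]; last by rewrite (negbTE ki0).
  by case: eqP kJ => // ->; rewrite iJ.
by apply/dualP => a sa; rewrite dot_ebar (sigma_row sa i0J) subr0.
Qed.

(** The ratios of the outer rows to row [i0] span a complement of the sublattice, with the
    coefficients [hcoef] as coordinates. *)
Lemma leaf_project u : exists2 u', constrained leaf_constraint u' &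
  u = u' + \sum_(i | outer_row i) hcoef i u *: (ebar s i - ebar s i0).
Proof.
exists (u - \sum_(i | outer_row i) hcoef i u *: (ebar s i - ebar s i0)); last by rewrite subrK.
apply/leaf_constrained => k ok; rewrite hcoefD hcoefN [hcoef k (\sum_(_ | _) _)]hcoefE dot_sumr.
rewrite (bigD1 k) //= big1 => [|i /andP[oi ik]]; last first.
  have /andP[_ ki0] := ok.
  by rewrite dotZr -hcoefE hcoef_ebar (negbTE ki0) eq_sym (negbTE ik) subrr mulr0.
have /andP[_ ki0] := ok.
by rewrite addr0 dotZr -[dot _ _]hcoefE hcoef_ebar (negbTE ki0) eqxx subr0 mulr1 subrr.
Qed.

Lemma leaf_project_dot u : exists2 u', constrained leaf_constraint u' &
  forall a, sigma (toQ (v a)) -> dot u' (v a) = dot u (v a).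
Proof.
have [u' cu' Eu] := leaf_project u; exists u' => // a sa.
rewrite [in RHS]Eu dotDl dot_suml big1 ?addr0 // => i oi.
by rewrite dotZl outer_unit ?mulr0.
Qed.

Definition leaf_ratio (i : 'I_r.+1) (y : affine_chart X sigma) : K :=
  \sum_k cf i k * chi (ebar s (f k) - ebar s i0) y.

(** Divide the linear relation for row [i] by the monomial of row [i0], which has no zeros on the
    chart because [sigma] has no ray in that row. *)
Lemma leaf_ratioE i y : pchar_at (val y) (ebar s i - ebar s i0) = leaf_ratio i y \/ ~~ outer_row i.
Proof.
case: (boolP (outer_row i)) => [oi|]; [left|by right].
have [z hz E] := chart_pointP gav y.
have dE k : k = i \/ k \in J \/ k = i0 -> dual_chars sigma (ebar s k - ebar s i0).
  move=> [->|/ratio_monoid[]//]; apply/dualP => a sa; by rewrite outer_unit.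
have z0 a : z a = 0 -> l_at l i0 a = 0%N by move=> /hz.2 sa; exact: sigma_row.
have m0 : monom_T l z i0 != 0.
  rewrite monom_TE; apply/prodf_neq0 => a _; have [/z0 ->|za] := eqVneq (z a) 0.
    by rewrite expr0 oner_neq0.
  by rewrite expf_neq0.
have mE k : monom_T l z k = monom_T l z i0 * ev v z (ebar s k - ebar s i0) by exact: monom_T_ratio.
rewrite E; last by apply: dE; left.
apply: (mulfI m0); rewrite -mE /leaf_ratio mulr_sumr.
rewrite (iffLR (cf1 _) ((barXP gav z).1 hz.1) i); apply: eq_bigr => k _.
rewrite mulrCA [chi _ _]/(chart_char _ _) /chart_char E -?mE //; apply: dE; right.
exact: f_inner.
Qed.

Lemma outer_char_neq0 i y : outer_row i -> leaf_ratio i y != 0.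
Proof.
move=> oi; have [<-|] := leaf_ratioE i y; last by rewrite oi.
have [z hz ->] := chart_pointP gav y; last by apply/dualP => a sa; rewrite outer_unit.
by apply: ev_neq0 => a /hz.2 sa; exact: outer_unit.
Qed.

Lemma leaf_span_subalgebra : subalgebra (char_span S chi).
Proof.
apply: char_span_subalgebra.
- by split; [exact: dual_chars0 | move=> p; rewrite dot0r].
- by move=> u w [du cu] [dw cw]; split; [exact: dual_charsD | exact: constrainedD].
- by move=> y; exact: (pchar0 gav).
- by move=> u w y [du _] [dw _]; exact: (pcharD gav).
Qed.

Lemma leaf_ratio_span i : char_span S chi (leaf_ratio i).
Proof.
have sA := leaf_span_subalgebra; have [cA _ mA] := sA.
apply: (subalgebra_sum sA) => k; apply: (mA (fun=> cf i k)) => //; apply: char_span_char.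
exact/ratio_monoid/f_inner.
Qed.

(** Split off the outer part of [u]. The factor makes all exponents of outer ratios nonnegative, and
    each outer ratio is then replaced by its linear expression in inner ones. *)
Lemma clear_char k u : dual_chars sigma u -> (forall i, `|hcoef i u| <= k%:Z) ->
  char_span S chi (fun y => (\prod_(i | outer_row i) leaf_ratio i y) ^+ k * pchar_at (val y) u).
Proof.
move=> du hk; have sA := leaf_span_subalgebra; have [_ _ mA] := sA.
have [u' cu' Eu] := leaf_project u.
have du' : dual_chars sigma u'.
  apply/dualP => a sa; have := (dualP u).1 du a sa; rewrite [in X in X -> _]Eu dotDl dot_suml.
  by rewrite [X in _ + X]big1 ?addr0 // => i oi; rewrite dotZl outer_unit ?mulr0.
rewrite (_ : (fun y => _) = (fun y => chi u' y *
    \prod_(i | outer_row i) leaf_ratio i y ^+ `|k%:Z + hcoef i u|)).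
  apply: mA; first exact: char_span_char.
  apply: (subalgebra_prod sA) => i _; apply: (subalgebra_exp sA); exact: leaf_ratio_span.
apply/funext => y; have [z hz E] := chart_pointP gav y.
have do_ i : outer_row i -> dual_chars sigma (ebar s i - ebar s i0).
  by move=> oi; apply/dualP => a sa; rewrite outer_unit.
rewrite /chi /chart_char !E //.
have zz0 a w : (forall b, sigma (toQ (v b)) -> dot w (v b) = 0) -> z a = 0 -> 0 <= dot w (v a).
  by move=> h /hz.2/h ->.
rewrite [in LHS]Eu evD; first last.
- move=> a; apply: zz0 => b sb; rewrite dot_suml big1 // => i oi; by rewrite dotZl outer_unit ?mulr0.
- move=> a; exact: (chart_lift_dual gav Ss hz).
rewrite mulrCA; congr (_ * _).
pose good w val := (forall b, sigma (toQ (v b)) -> dot w (v b) = 0) /\ ev v z w = val.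
have [_ ->] : good (\sum_(i | outer_row i) hcoef i u *: (ebar s i - ebar s i0))
    (\prod_(i | outer_row i) leaf_ratio i y ^ hcoef i u).
  apply: (big_rec2 good) => [|i val w oi [hw Ew]].
    by split=> [b _|]; [exact: dot0l | exact: ev0].
  split=> [b sb|]; first by rewrite dotDl hw // addr0 dotZl outer_unit ?mulr0.
  rewrite evD => [|a|a]; [| by apply: zz0 => b sb; rewrite dotZl outer_unit ?mulr0 | exact: zz0].
  rewrite Ew; congr (_ * _); have [<-|] := leaf_ratioE i y; last by rewrite oi.
  by rewrite (E _ (do_ _ oi)) evZ.
rewrite -prodrXl -big_split; apply: eq_bigr => i oi /=.
have h := hk i; rewrite !exprnP -expfzDr ?outer_char_neq0 // gez0_abs //; lia.
Qed.

Lemma leaf_clear g : chart_ring (Y := X) (sigma := sigma) g ->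
  exists k : nat, char_span S chi (fun y => (\prod_(i | outer_row i) leaf_ratio i y) ^+ k * g y).
Proof.
move=> /chart_ringP[q dq ->].
pose k := (\sum_(a <- q) \sum_i `|hcoef i a.2|)%N; exists k.
have hk a i : a \in q -> `|hcoef i a.2| <= k%:Z.
  move=> aq; have : (`|hcoef i a.2| <= k)%N; last by rewrite -abszE lez_nat.
  by rewrite /k (big_rem a) //= (bigD1 i) //= -!addnA leq_addr.
have sA := leaf_span_subalgebra; have [cA addA mA] := sA.
move: k hk => k; elim: q dq => [|a q IH] dq hk.
  rewrite (_ : (fun y => _) = (fun=> 0)) //; apply/funext => y; by rewrite big_nil mulr0.
rewrite (_ : (fun y => _) = (fun y => a.1 * ((\prod_(i | outer_row i) leaf_ratio i y) ^+ k * pchar_at (val y) a.2)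
   + (\prod_(i | outer_row i) leaf_ratio i y) ^+ k * \sum_(b <- q) b.1 * pchar_at (val y) b.2)).
  apply: addA; last by apply: IH => [b bq|b i bq]; [apply: dq | apply: hk]; rewrite inE bq orbT.
  apply: (mA (fun=> a.1)) => //; apply: clear_char => [|i]; [apply: dq | apply: hk]; exact: mem_head.
by apply/funext => y; rewrite big_cons mulrDr; congr (_ + _); ring.
Qed.

(** The constrained characters are linearly independent functions. Along a family of torus points
    whose inner rows and last [s] coordinates are powers of [eps], with outer rows prescribed by the
    linear relations, each such character is a power of [eps], and a separating weight makes these
    powers distinct. *)
Lemma leaf_homogeneous (q : seq (K * M)) : (forall a, a \in q -> S a.2) ->
  (forall y, monomial_sum chi q y = 0) ->
  forall z y, \sum_(a <- q | a.2 == z) a.1 * chi a.2 y = 0.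
Proof.
move=> Sq q0 z y.
(* Row [i0] is normalized to 1 and gets weight zero; its coefficient is recovered from the sum of
   all [hcoef] being zero. *)
pose wv (u : M) : 'cV[int]_(r.+1 + s) :=
  col_mx (\col_i (if i == i0 then 0 else hcoef i u)) (dsubmx u).
have [lam [lam0 laminj]] := separating_weight [seq wv a.2 | a <- q].
pose lam1 i := absz (lam (lshift s i) 0).
have lam1E i : (lam1 i)%:Z = lam (lshift s i) 0 by rewrite gtz0_abs.
pose ex (i : 'I_r.+1) := if i == i0 then 0%N else lam1 i.
(* The value of row [i] along the family. For outer rows its constant coefficient is [cf i k0],
   which is nonzero; the other exponents are positive since the weights are. *)
pose p i : {poly K} := \sum_k cf i k *: 'X^(ex (f k)).
have outf i : outer_row i -> forall k', f k' != i.
  move=> /andP[iJ ii0] k'; apply/eqP => E; have : (i \in J) || (i == i0) by apply/fC; exists k'.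
  by rewrite (negbTE iJ) (negbTE ii0).
have p0 i : outer_row i -> p i != 0.
  move=> /outf/(cf3 k0); apply: contra_neq => /(congr1 (fun q : {poly K} => q`_0%N)).
  rewrite coef0 coef_sum (bigD1 k0) //= coefZ coefXn fk0 /ex eqxx mulr1 big1 ?addr0 // => k kk0.
  have fk : f k != i0 by rewrite -fk0 (inj_eq finj).
  rewrite coefZ coefXn (negbTE fk); have := lam0 (lshift s (f k)); rewrite -lam1E.
  by case: (lam1 _) => // j _; rewrite mulr0.
(* Excludes the parameters at which an outer row would vanish. *)
pose g := \prod_(i | outer_row i) p i.
have g0 : g != 0 by rewrite prodf_seq_neq0; apply/allP => i _; apply/implyP; exact: p0.
pose e u : int := dot lam (wv u).
have key eps : eps != 0 -> g.[eps] != 0 -> \sum_(a <- q) a.1 * eps ^ e a.2 = 0.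
  move=> eps0 geps; pose x i := (p i).[eps].
  have xE i : x i = \sum_k cf i k * eps ^+ ex (f k).
    by rewrite /x /p horner_sum; apply: eq_bigr => k _; rewrite hornerZ hornerXn.
  have xf k : x (f k) = eps ^+ ex (f k).
    rewrite xE (bigD1 k) //= cf2 eqxx mul1r big1 ?addr0 // => k' kk.
    by rewrite cf2 (negbTE kk) mul0r.
  have xJ i : ~~ outer_row i -> x i = eps ^+ ex i.
    move=> no; have [k <-] : exists k, f k = i; last exact: xf.
    by apply/fC; move: no; rewrite negb_and !negbK.
  have x0 i : x i != 0.
    have [oi|/xJ ->] := boolP (outer_row i); last by rewrite expf_neq0.
    by move: geps; rewrite horner_prod prodf_seq_neq0 => /allP/(_ i (mem_index_enum i)); rewrite oi.
  pose phi u : K := (\prod_i x i ^ hcoef i u) * eps ^ dot (dsubmx lam) (dsubmx u).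
  have phiD u w : phi (u + w) = phi u * phi w.
    rewrite /phi mulrACA -big_split raddfD dotDr expfzDr //; congr (_ * _).
    by apply: eq_bigr => i _; rewrite hcoefD expfzDr.
  have phi0 u : phi u != 0 by rewrite mulf_neq0 ?expfz_neq0 //; apply/prodf_neq0 => i _; rewrite expfz_neq0.
  have [zeta [z0 zev zmon]] := torus_lift gav phiD phi0.
  have phir i : phi (ebar s i - ebar s i0) = x i.
    rewrite /phi ebar_dsubmx dot0r expr0z mulr1.
    transitivity (\prod_j (x j ^ (j == i)%:Z / x j ^ (j == i0)%:Z)).
      by apply: eq_bigr => j _; rewrite hcoef_ebar expfzDr // invr_expz.
    rewrite big_split /= prodfV (bigD1 i) //= eqxx big1 => [|j /negbTE ->]; last exact: expr0z.
    rewrite (bigD1 i0) //= eqxx big1 => [|j /negbTE ->]; last exact: expr0z.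
    rewrite !mulr1 !expr1z [x i0]xJ; last by rewrite /outer_row eqxx andbF.
    by rewrite /ex eqxx expr0 divr1.
  have bz : barX A l zeta.
    apply/(barXP gav).
    have -> : monom_T l zeta = fun i => monom_T l zeta i0 * x i.
      by apply/funext => i; rewrite (zmon i i0) phir.
    by apply: in_rowspaceZ; apply/cf1 => i; rewrite xE; apply: eq_bigr => k _; rewrite xf.
  have [|y' hy'] := @chart_point _ _ _ _ _ _ _ _ _ _ gav sigma zeta Ss.
    by split=> // a za; have := z0 a; rewrite za eqxx.
  rewrite -[RHS](q0 y'); rewrite /monomial_sum big_seq [RHS]big_seq.
  apply: eq_bigr => a /Sq[da /leaf_constrained ca]; congr (_ * _).
  rewrite /chi /chart_char hy' // zev /phi /e.
  have -> : dot lam (wv a.2) = \sum_i (if i == i0 then 0 else lam (lshift s i) 0 * hcoef i a.2)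
      + dot (dsubmx lam) (dsubmx a.2).
    rewrite /dot big_split_ord /=; congr (_ + _); apply: eq_bigr => i _.
      by rewrite col_mxEu mxE; case: eqP => // _; rewrite mulr0.
    by rewrite col_mxEd [dsubmx lam _ _]mxE.
  rewrite expfzDr // exprz_prod //; congr (_ * _); apply: eq_bigr => i _.
  have [oi|no] := boolP (outer_row i).
    by rewrite ca // mulr0 if_same.
  rewrite xJ // /ex; case: eqP => [_|_]; first by rewrite expr0 exp1rz expr0z.
  by rewrite -lam1E -exprz_exp.
have H := laurent_vanish g0 key.
have [[a0 [a0q az]]|no] := pselect (exists a0, a0 \in q /\ a0.2 = z); last first.
  rewrite big_seq_cond big1 // => a /andP[aq /eqP az]; case: no; by exists a.
apply: (@big_pred_const _ _ _ q _ (fun a => a.1) (fun a => a.2) (fun u => chi u y) z).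
  by move=> a _ /eqP.
rewrite -[RHS](H (e z)); rewrite big_seq_cond [RHS]big_seq_cond; apply: eq_bigl => a.
case: (boolP (a \in q)) => //= aq; apply/eqP/eqP => [-> //|].
rewrite /e -az => E.
have : wv a.2 = wv a0.2.
  apply: (laminj _ _ (map_f (fun b : K * M => wv b.2) aq) (map_f (fun b : K * M => wv b.2) a0q)).
  exact: E.
move=> /eq_col_mx[/colP E1 E2].
have hE i : hcoef i a.2 = hcoef i a0.2.
  have [->|ii0] := eqVneq i i0; last by have := E1 i; rewrite !mxE (negbTE ii0).
  have S0 u : hcoef i0 u = - \sum_(i | i != i0) hcoef i u.
    by apply/eqP; rewrite -addr_eq0; have := hcoef_sum u; rewrite (bigD1 i0) //= => ->.
  rewrite !S0; congr (- _); apply: eq_bigr => j ji0.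
  by have := E1 j; rewrite !mxE (negbTE ji0).
rewrite (hcoef_decomp a.2) (hcoef_decomp a0.2) E2; congr (_ + _).
by apply: eq_bigr => i _; rewrite hE.
Qed.

(** Here the degree is the character itself, so every character in the sublattice is a unit plus a
    sum of [h i]. Applied to a character of order 1 along the ray [a], this gives some [h i] with
    nonzero order along [a], and this [h i] is dual to [a]. *)
Theorem leaf_smooth_dual_basis (x : affine_chart X sigma) :
  (forall u, dual_chars sigma u -> ~ perp_chars sigma u -> pchar_at (val x) u = 0) ->
  smooth_point (chart_ring (Y := X) (sigma := sigma)) x -> has_dual_basis v sigma.
Proof.
move=> x0 sm.
(* Pairing with an interior vector of [sigma], the sum of its rays: a character of the dual cone has
   weight zero only if it is orthogonal to all rays. *)
pose wt : {additive M -> int} := dot (\sum_(a | ray_mem v sigma a) v a).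
have wtE u : wt u = \sum_(a | ray_mem v sigma a) dot u (v a).
  by rewrite /wt /= dot_suml; apply: eq_bigr => a _; rewrite dotC.
have ge0 u a : S u -> ray_mem v sigma a -> 0 <= dot u (v a).
  by move=> [du _] /ray_memP; exact: (dualP u).1.
have [|||||||n0 [w [kap [e [h [gc indep Sh gen hray]]]]]] :=
  @smooth_structure _ _ _ _ _ _ _ _ _ _ gav sigma Ss _ leaf_constraint _ idfun wt _ _ _ _ _ _ _ x x0 sm.
- by move=> u Su; rewrite [wt _]wtE; apply: sumr_ge0 => a; exact: ge0.
- move=> u Su; rewrite [wt _]wtE => /eqP; rewrite psumr_eq0 => [/allP H|a]; last exact: ge0.
  split; last by case: Su.
  apply/perpP => a /ray_memP sa; have := H a (mem_index_enum a); by rewrite sa => /eqP.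
- move=> u [pu _]; rewrite [wt _]wtE big1 // => a /ray_memP; exact: (perpP u).1.
- by [].
- exact: leaf_homogeneous.
- move=> g /leaf_clear[k hk]; have sA := leaf_span_subalgebra.
  exists (fun y => (\prod_(i | outer_row i) leaf_ratio i y) ^+ k); split=> //.
    apply: (subalgebra_exp sA); apply: (subalgebra_prod sA) => i _; exact: leaf_ratio_span.
  by move=> y; rewrite expf_neq0 //; apply/prodf_neq0 => i; exact: outer_char_neq0.
- exact: leaf_project_dot.
move=> a sa; have [u du ua] := primitive_dual gav Ss sa.
have [u' cu' Eu'] := leaf_project_dot u.
have Su' : S u' by split=> //; apply/dualP => b sb; rewrite Eu' //; exact: (dualP u).1.
have [q hq Eq] := gen u' Su'.
have [yt hyt] := torus_point gav Ss.
(* The representation is not empty because a character has no zeros on the torus. *)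
case: q hq Eq => [|b q] hq Eq.
  have := hyt u' Su'.1; rewrite -[pchar_at _ _]/(chart_char u' yt) Eq /monomial_sum big_nil.
  by rewrite eqxx.
have [[z [al [[pz _] Eb]]] /= Ebu] := hq b (mem_head _ _).
have : dot u' (v a) != 0 by rewrite Eu' // ua.
rewrite -Ebu Eb dotDl (perpP z).1 // add0r dot_suml.
have [[i hi] _|no] := pselect (exists i, dot (h i) (v a) != 0); last first.
  by rewrite big1 ?eqxx // => i _; rewrite dotMnl; have [->|ne] := eqVneq (dot (h i) (v a)) 0; [exact: mul0rn | case: no; exists i].
exists (h i) => b' sb'; have [a' sa' ha'] := hray i; rewrite ha' //.
by move: hi; rewrite ha' //; case: (eqVneq a a') => [->|].
Qed.

End Leaf.

(** * Smooth points over big cones *)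

Section Big.
Variables (K : closedFieldType) (c r : nat) (n : 'I_r.+1 -> nat) (m s : nat).
Variables (A : 'M[K]_(c.+1, r.+1)) (l : forall i : 'I_r.+1, 'I_(n i) -> nat).
Variables (d : col_index n m -> 'cV[int]_s) (Sigma : set (set 'cV[rat]_(r + s))).
Hypothesis gav : explicit_gav A l d Sigma.
Let I : finType := col_index n m.
Let v : I -> 'cV[int]_(r + s) := P_col l d.
Let X := X_var A l d Sigma.
Let M : zmodType := 'cV[int]_(r + s).
Variable sigma : set 'cV[rat]_(r + s).
Hypotheses (Ss : Sigma sigma) (big : big_cone l d sigma).

Let dualP u := dual_charsP (gav_fan gav) (gav_rays gav) u Ss.
Let perpP u := perp_charsP (gav_fan gav) (gav_rays gav) u Ss.

Let no_constraint (p : void) : 'cV[int]_(r + s) := 0.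
Let S : set M := chart_monoid sigma no_constraint.
Let U : set M := chart_units sigma no_constraint.
Let chi := chart_char (A := A) (l := l) (d := d) (Sigma := Sigma) (sigma := sigma).
Let deg : {additive M -> 'cV[int]_s} := @dsubmx int r s 1.

(** Makes the Z^s degree injective on units: in each row [sigma] has a ray, on which a character of
    degree zero takes the value [hcoef] times a positive exponent. *)
Lemma big_row_char_eq0 (u : M) : dsubmx u = 0 ->
  (forall a, sigma (toQ (v a)) -> dot u (v a) = 0) -> u = 0.
Proof.
move=> u0 H; rewrite (hcoef_decomp u) u0 col_mx0 addr0 big1 // => i _.
have [j sj] := big i; have := H _ sj; rewrite dot_hcoef_idx // => /eqP.
rewrite mulf_eq0 => /orP[/eqP ->|]; first by rewrite scale0r.
by rewrite eqz_nat gtn_eqF // (gav_l gav).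
Qed.

(* The rays of a big cone have a positive combination orthogonal to all characters of
   degree zero, so that degrees of characters in S are nonnegatively weighted. *)
Lemma balanced_weights : exists om : I -> int, (forall a, 0 < om a) /\
  forall u : M, dsubmx u = 0 -> \sum_(a | ray_mem v sigma a) om a * dot u (v a) = 0.
Proof.
pose lw (a : I) : nat := if a is inl p then l (tagged p) else 1%N.
pose k i := (\sum_(a | ray_mem v sigma a) (l_at l i a != 0))%N.
(* For a ray of row [i] in [sigma], [om] times its exponent is [Lam] divided by [k i], the number of
   such rays; so each row sums to the same [Lam]. *)
pose om (a : I) : nat := ((\prod_(b | ray_mem v sigma b && (b != a)) lw b) *
  (if a is inl p then \prod_(i | i != tag p) k i else 1))%N.
have lw0 a : (0 < lw a)%N by case: a => // p; exact: gav_l gav _ _.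
have k0 i : (0 < k i)%N.
  have [j sj] := big i; rewrite /k (bigD1 (idx_ij m j)) /=; last exact/ray_memP.
  by rewrite eqxx -lt0n (gav_l gav).
exists (fun a => (om a)%:Z); split.
  move=> a; rewrite ltz_nat muln_gt0 prodn_cond_gt0 //; case: a => [p|//].
  by rewrite prodn_cond_gt0.
pose Lam := ((\prod_(a | ray_mem v sigma a) lw a) * \prod_i k i)%N.
have sumE i : (\sum_(a | ray_mem v sigma a) om a * l_at l i a = Lam)%N.
  transitivity (\sum_(a | ray_mem v sigma a) (l_at l i a != 0) *
     ((\prod_(b | ray_mem v sigma b) lw b) * \prod_(i' | i' != i) k i'))%N.
    apply: eq_bigr => -[p|k'] sa; rewrite /= ?muln0 //.
    case: eqP => [E|_]; last by rewrite muln0.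
    by rewrite -E -lt0n (gav_l gav) mul1n /om [in RHS](bigD1 (inl p)) //= mulnC mulnA.
  by rewrite -big_distrl /= -/(k i) mulnCA /Lam; congr (_ * _)%N; rewrite [RHS](bigD1 i).
move=> u u0; transitivity (\sum_i hcoef i u * Lam%:Z); last by rewrite -mulr_suml hcoef_sum mul0r.
under eq_bigr => a _ do rewrite dot_hcoef // mulr_sumr.
rewrite exchange_big; apply: eq_bigr => i _ /=.
rewrite -(sumE i) (big_morph Posz PoszD (erefl _)) mulr_sumr; apply: eq_bigr => a _.
by rewrite PoszM mulrCA.
Qed.

(** The torus acting on X preserves the chart: moving a point along [eps ^ lam] multiplies all row
    monomials by one common factor and each character by a power of [eps] determined by its
    degree. *)
Lemma big_homogeneous (q : seq (K * M)) : (forall a, a \in q -> S a.2) ->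
  (forall y, monomial_sum chi q y = 0) ->
  forall z y, \sum_(a <- q | deg a.2 == z) a.1 * chi a.2 y = 0.
Proof.
move=> Sq q0 z y; have [z0 hz0 Ez0] := chart_pointP gav y.
have [lam [_ laminj]] := separating_weight [seq deg a.2 | a <- q].
pose e (u : M) : int := dot lam (deg u).
have key eps : eps != 0 -> (1 : {poly K}).[eps] != 0 ->
    \sum_(a <- q) (a.1 * ev v z0 a.2) * eps ^ e a.2 = 0.
  move=> eps0 _; pose phi u : K := eps ^ e u.
  have phiD u w : phi (u + w) = phi u * phi w by rewrite /phi /e raddfD dotDr expfzDr.
  have phi0 u : phi u != 0 by rewrite expfz_neq0.
  have [zeta [ze0 zev zmon]] := torus_lift gav phiD phi0.
  have bz : barX A l (fun a => zeta a * z0 a).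
    apply/(barXP gav).
    have -> : monom_T l (fun a => zeta a * z0 a) = fun i => monom_T l zeta ord0 * monom_T l z0 i.
      apply/funext => i; rewrite monom_T_mul (zmon i ord0) /phi /e /deg /= ebar_dsubmx dot0r.
      by rewrite expr0z mulr1.
    by apply: in_rowspaceZ; apply/(barXP gav); case: hz0.
  have [|y' hy'] := @chart_point _ _ _ _ _ _ _ _ _ _ gav sigma (fun a => zeta a * z0 a) Ss.
    by split=> // a /eqP; rewrite mulf_eq0 (negbTE (ze0 a)) => /eqP; exact: hz0.2.
  have Ea a : a \in q -> a.1 * ev v z0 a.2 * eps ^ e a.2 = a.1 * chi a.2 y'.
    move=> /Sq[da _]; rewrite /chi /chart_char (hy' _ da) ev_mul zev /phi.
    by rewrite mulrAC -mulrA.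
  by rewrite (eq_big_seq _ Ea); exact: q0.
have H := laurent_vanish (oner_neq0 _) key.
have [[a0 [a0q az]]|no] := pselect (exists a0, a0 \in q /\ deg a0.2 = z); last first.
  rewrite big_seq_cond big1 // => a /andP[aq /eqP az]; case: no; by exists a.
rewrite -[RHS](H (dot lam z)) big_seq_cond [RHS]big_seq_cond.
apply: eq_big => [a|a /andP[aq _]]; last first.
  by rewrite /chi /chart_char Ez0 //; case: (Sq a aq).
case: (boolP (a \in q)) => //= aq; apply/eqP/eqP => [E|]; first by rewrite /e -E.
rewrite /e -az => E.
exact: (laminj _ _ (map_f (fun b : K * M => deg b.2) aq) (map_f (fun b : K * M => deg b.2) a0q)).
Qed.

Lemma big_no_constraint u : constrained no_constraint u.
Proof. by case. Qed.

Lemma big_span_all g : chart_ring (Y := X) (sigma := sigma) g -> char_span S chi g.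
Proof.
move=> /chart_ringP[q dq ->]; exists q => // a /dq da; split=> //; exact: big_no_constraint.
Qed.

Section Structure.
Variables (n0 : nat) (w kap : 'I_n0 -> 'cV[int]_(r + s)) (e : nat) (h : 'I_e -> 'cV[int]_(r + s)).
Variable wt : {additive 'cV[int]_s -> int}.
Hypotheses (gc : graded_characters deg wt S U chi (chart_ring (Y := X) (sigma := sigma)) w
     (fun j => dot (kap j)))
  (indep : alg_independent (chart_coord chi w h))
  (Sh : forall i, S (h i))
  (gen : forall u, S u -> graded_span deg U chi h (deg u) (chi u))
  (hray : forall i, exists2 a, sigma (toQ (v a)) &
     forall b, sigma (toQ (v b)) -> dot (h i) (v b) = (b == a)%:Z).

Definition generator_ray (a : I) : Prop :=
  exists i, forall b, sigma (toQ (v b)) -> dot (h i) (v b) = (b == a)%:Z.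

(** The character of [u] is a combination of generated characters of the same degree; take one that
    occurs. It pairs to zero with every ray not dual to a generator. *)
Lemma degree_shift u : dual_chars sigma u -> exists2 u', dual_chars sigma u' &
  dsubmx (u' - u) = 0 /\ forall a, sigma (toQ (v a)) -> ~ generator_ray a -> dot u' (v a) = 0.
Proof.
move=> du; have Su : S u by split=> //; exact: big_no_constraint.
have [q hq Eq] := gen Su; have [yt hyt] := torus_point gav Ss.
case: q hq Eq => [|b q] hq Eq.
  have := hyt u du; rewrite -[pchar_at _ _]/(chi u yt) Eq /monomial_sum big_nil.
  by rewrite eqxx.
have [gb Ebu] := hq b (mem_head _ _); exists b.2; first by case: (generatedS gc Sh gb).
split; first by rewrite [LHS](raddfB deg) Ebu subrr.
move=> a sa nga; have [z [al [[pz _] ->]]] := gb.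
rewrite dotDl (perpP z).1 // add0r dot_suml big1 // => i _; rewrite dotMnl.
have [a' sa' ha'] := hray i; rewrite ha' //; case: eqP => [E|_]; last by rewrite mul0rn.
by case: nga; exists i => b' sb'; rewrite ha' // E.
Qed.

(** Shift a character of order 1 along [a] to one of order 0: the difference has degree zero, so its
    value -1 on [a] is a multiple of the exponent, which must be 1. For a second ray in the same
    row, shift a character vanishing on that ray and positive on [a]: the result would be negative
    on the second ray. *)
Lemma non_generator_ray a : sigma (toQ (v a)) -> ~ generator_ray a ->
  exists i (j : 'I_(n i)), [/\ a = idx_ij m j, l j = 1%N
    & forall k, k != j -> ~ sigma (v_ij l d k)].
Proof.
move=> sa nga; have [u du ua] := primitive_dual gav Ss sa.
have [u' du' [dd u'0]] := degree_shift du.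
have := u'0 a sa nga; have Eu : u' = (u' - u) + u by rewrite subrK.
case: a sa nga ua u'0 => [[i j]|k] sa nga ua u'0; last first.
  by rewrite Eu dotDl dot_hcoef_inr // ua.
rewrite Eu dotDl ua -[inl _]/(idx_ij m j) dot_hcoef_idx // => /eqP; rewrite addr_eq0 => /eqP hl.
exists i, j; split=> //.
  have := congr1 absz hl; rewrite abszM /= => /eqP; rewrite muln_eq1 => /andP[_ /eqP //].
move=> k kj sk.
have [w' [dw w0 hw]] := facet_dual gav Ss sk.
have [w'' dw'' [dd' w''0]] := degree_shift dw.
have pos : 0 < dot w' (v (idx_ij m j)).
  apply: hw => //; apply: contra kj => /eqP[] /eqP; rewrite -tag_eqE /tag_eq /= eqxx /= tagged_asE.
  by rewrite eq_sym.
have Ew : w'' = (w'' - w') + w' by rewrite subrK.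
have := w''0 _ sa nga; rewrite Ew dotDl -[inl _]/(idx_ij m j) dot_hcoef_idx // => E1.
have := (dualP w'').1 dw'' _ sk; rewrite Ew dotDl w0 addr0 dot_hcoef_idx //.
have := gav_l gav j; have := gav_l gav k; move: E1 pos.
move: (hcoef _ _) (dot w' _) => p q; case: (l j) => // lj; case: (l k) => // lk E1 pos _ _ ge.
have : p < 0 by rewrite ltNge; apply/negP => p0; nia.
nia.
Qed.

Definition generator_row i : Prop :=
  forall j : 'I_(n i), sigma (v_ij l d j) -> generator_ray (idx_ij m j).

Lemma generator_row_char i : generator_row i ->
  exists2 u, S u & forall b, sigma (toQ (v b)) -> dot u (v b) = l_at l i b.
Proof.
move=> gi.
have /choice[g hg] (j : 'I_(n i)) : exists u, sigma (v_ij l d j) -> S u /\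
    forall b, sigma (toQ (v b)) -> dot u (v b) = (b == idx_ij m j)%:Z.
  have [/gi[i' hi']|ns] := pselect (sigma (v_ij l d j)); first by exists (h i').
  by exists 0.
have E b : sigma (toQ (v b)) ->
    dot (\sum_(j | ray_mem v sigma (idx_ij m j)) g j *+ l j) (v b) = l_at l i b.
  move=> sb; rewrite dot_suml; case: b sb => [[i' j]|k] sb; last first.
    by rewrite big1 // => j /ray_memP/hg[_ H]; rewrite dotMnl H // mul0rn.
  rewrite /=; case: (eqVneq i' i) => [E|ne]; last first.
    rewrite big1 // => j' /ray_memP/hg[_ H]; rewrite dotMnl H //.
    rewrite (_ : (_ == _) = false) ?mul0rn //; apply/eqP => -[/eqP].
    by rewrite (negbTE ne).
  subst i'; rewrite (bigD1 j) /=; last exact/ray_memP.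
  have [_ H] := hg j sb; rewrite dotMnl H // eqxx natz big1 ?addr0 // => j' /andP[/ray_memP/hg[_ H'] jj].
  rewrite dotMnl H' // (_ : (_ == _) = false) ?mul0rn //; apply: contraNF jj => /eqP[] /eqP.
  by rewrite -tag_eqE /tag_eq /= eqxx /= tagged_asE eq_sym.
exists (\sum_(j | ray_mem v sigma (idx_ij m j)) g j *+ l j) => //; split.
  by apply/dualP => b sb; rewrite E.
exact: big_no_constraint.
Qed.

(** Let [a] be the only ray in row [i0], with exponent 1, and not dual to a generator. If some row
    consists of generator rays, the product of its generators times a ratio of row monomials is dual
    to [a]. Otherwise each row has a missed ray, so a degree shift has nonpositive [hcoef] in all
    rows and -1 in row [i0], although they sum to zero. *)
Lemma big_dual_basis : has_dual_basis v sigma.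
Proof.
move=> a sa; have [[i hi]|nga] := pselect (generator_ray a); first by exists (h i).
have [i0 [j0 [Ea l1 only]]] := non_generator_ray sa nga.
have lE b : sigma (toQ (v b)) -> (l_at l i0 b)%:Z = (b == a)%:Z.
  rewrite Ea; case: b => [[i' j]|k] sb //=; case: (eqVneq i' i0) => [E|ne]; last first.
    by rewrite (_ : (_ == _) = false) //; apply/eqP => -[/eqP]; rewrite (negbTE ne).
  subst i'; have [->|jj] := eqVneq j j0; first by rewrite l1 eqxx.
  by case: (only _ jj).
have [[i1 gi1]|no] := pselect (exists i, generator_row i).
  have [u Su hu] := generator_row_char gi1.
  exists (u + (ebar s i0 - ebar s i1)) => b sb.
  by rewrite dotDl hu // dot_ebar -lE //; ring.
have [u du ua] := primitive_dual gav Ss sa.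
have [u' du' [dd u'0]] := degree_shift du; have Eu : u' = (u' - u) + u by rewrite subrK.
have hle i : hcoef i (u' - u) <= 0.
  have [j [sj ngj]] : exists j : 'I_(n i), sigma (v_ij l d j) /\ ~ generator_ray (idx_ij m j).
    apply: contrapT => H; apply: no; exists i => j sj; apply: contrapT => ng; apply: H; by exists j.
  have := u'0 _ sj ngj; rewrite {1}Eu dotDl dot_hcoef_idx // => E.
  have := (dualP u).1 du _ sj; have := gav_l gav j; move: E.
  move: (hcoef _ _) (dot u _) => p q; case: (l j) => // lj E _ ge.
  by rewrite leNgt; apply/negP => p0; nia.
have := u'0 a sa nga; rewrite {1}Eu dotDl ua Ea dot_hcoef_idx // l1 mulr1 => h1.
have := hcoef_sum (u' - u); rewrite (bigD1 i0) //=.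
have : \sum_(i | i != i0) hcoef i (u' - u) <= 0 by apply: sumr_le0 => i _.
move: h1; move: (\sum_(_ | _) _) (hcoef _ _) => p q; lia.
Qed.

(* On c + 2 rows violating the star condition all rays would carry generators h_i, and
   a linear relation between the rows would be an algebraic relation between these. *)
Lemma big_star : star_condition c l d sigma.
Proof.
move=> iota inc; apply: contrapT => nostar.
have iinj : injective iota.
  move=> a b E; have [lt|lt|/ord_inj //] := ltngtP a b; have := inc _ _ lt; by rewrite E ltnn.
have grow q : generator_row (iota q).
  move=> j sj; apply: contrapT => ng.
  have [i [j' [Ea l1 only]]] := non_generator_ray sj ng; apply: nostar; exists q.
  have E := congr1 (fun a : I => if a is inl p then tag p else iota q) Ea; rewrite /= in E.
  by subst i; exists j'; split=> //; rewrite /v_ij -Ea.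
have /choice[en hen] (a : I) : exists oi : option 'I_e, generator_ray a ->
    exists2 i, oi = Some i & forall b, sigma (toQ (v b)) -> dot (h i) (v b) = (b == a)%:Z.
  have [[i hi]|ng] := pselect (generator_ray a); last by exists None.
  by exists (Some i) => _; exists i.
have [i00 _] : exists i : 'I_e, True.
  have [j sj] := big (iota ord0); by have [i] := grow _ _ sj; exists i.
pose eh a := odflt i00 (en a).
have ehP q (j : 'I_(n (iota q))) : sigma (v_ij l d j) -> forall b, sigma (toQ (v b)) ->
    dot (h (eh (idx_ij m j))) (v b) = (b == idx_ij m j)%:Z.
  by move=> sj; have [i Ei hi] := hen _ (grow q j sj); rewrite /eh Ei.
(* The monomial of row [iota q] written in the generators. *)
pose lam q := \sum_(j : 'I_(n (iota q)) | ray_mem v sigma (idx_ij m j)) h (eh (idx_ij m j)) *+ l j.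
have lamE q b : sigma (toQ (v b)) -> dot (lam q) (v b) = l_at l (iota q) b.
  move=> sb; rewrite dot_suml; case: b sb => [[i' j]|k] sb; last first.
    by rewrite big1 // => j /ray_memP sj; rewrite dotMnl ehP // mul0rn.
  rewrite /=; case: (eqVneq i' (iota q)) => [E|ne]; last first.
    rewrite big1 // => j' /ray_memP sj; rewrite dotMnl ehP //.
    by rewrite (_ : (_ == _) = false) ?mul0rn //; apply/eqP => -[/eqP]; rewrite (negbTE ne).
  subst i'; rewrite (bigD1 j) /=; last exact/ray_memP.
  rewrite dotMnl ehP // eqxx natz big1 ?addr0 // => j' /andP[/ray_memP sj' jj].
  rewrite dotMnl ehP // (_ : (_ == _) = false) ?mul0rn //; apply: contraNF jj => /eqP[] /eqP.
  by rewrite -tag_eqE /tag_eq /= eqxx /= tagged_asE eq_sym.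
(* These characters differ from each other exactly by ratios of row monomials, so they satisfy the
   linear relation; each differs from [lam q] by a unit only. *)
pose u q : M := lam ord0 + (ebar s (iota q) - ebar s (iota ord0)).
have uE q b : sigma (toQ (v b)) -> dot (u q) (v b) = l_at l (iota q) b.
  by move=> sb; rewrite dotDl lamE // dot_ebar addrC subrK.
have lam_gen q : S (lam q).
  by split; [apply/dualP => b sb; rewrite lamE | exact: big_no_constraint].
have Uz q : U (u q - lam q).
  split; last exact: big_no_constraint.
  by apply/perpP => b sb; rewrite dotBl uE // lamE // subrr.
have [b [q1 bq1] hb] := rowspace_relation A iota.
have rel y : \sum_q b q * chi (u q) y = 0.
  have [z hz E] := chart_pointP gav y.
  (* The exponents of the common factor between the [u q] and the row monomials; it does not depend
     on [q]. *)
  pose kap' a := dot (lam ord0) (v a) - (l_at l (iota ord0) a)%:Z.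
  have kap0 a : z a = 0 -> kap' a = 0 by move=> /hz.2 sa; rewrite /kap' lamE // subrr.
  have uz q : chi (u q) y = monom_T l z (iota q) * \prod_a z a ^ kap' a.
    rewrite /chi /chart_char E; last by apply/dualP => a sa; rewrite uE.
    rewrite monom_TE -big_split; apply: eq_bigr => a _ /=.
    rewrite dotDl dot_ebar; have [za|za] := eqVneq (z a) 0.
      rewrite (kap0 a za) expr0z mulr1 exprnP; congr (_ ^ _).
      by rewrite (lamE _ _ (hz.2 a za)); ring.
    rewrite exprnP -expfzDr // /kap'; congr (_ ^ _); ring.
  under eq_bigr do rewrite uz mulrA.
  by rewrite -mulr_suml hb ?mul0r //; apply/(barXP gav); case: hz.
have rz q : laurent_rep chi w h (chi (u q - lam q)).
  by apply: (laurent_rep_generated gc Sh); exact: (generatedU h (Uz q)).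
have /choice[kz /choice[Pz hPz]] := rz.
pose ex q : {mpoly K[n0 + e]} :=
  \prod_(j : 'I_(n (iota q)) | ray_mem v sigma (idx_ij m j)) 'X_(rshift n0 (eh (idx_ij m j))) ^+ l j.
pose W := unit_poly K n0 e; pose y t := fun i => chart_coord chi w h i t.
have exE q t : (ex q).@[y t] = chi (lam q) t.
  rewrite rmorph_prod /=.
  pose good u val := S u /\ chi u t = val.
  suff [_ ->] : good (lam q) (\prod_(j : 'I_(n (iota q)) | ray_mem v sigma (idx_ij m j))
     ('X_(rshift n0 (eh (idx_ij m j))) ^+ l j).@[y t]) by [].
  apply: (big_rec2 good) => [|j u' val sj [Su' <-]].
    by split; [exact: (S0 gc) | exact: (gc_chi0 gc)].
  have [Sl El] := chiX gc (l j) t (Sh (eh (idx_ij m j))).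
  split; first exact: (gc_SD gc).
  rewrite (gc_chiD gc) // El rmorphXn /= mevalXU; congr (_ ^+ _ * _).
  by rewrite /y /chart_coord (unsplitK (inr _)).
have poly0 : \sum_q b q *: (W ^+ (\sum_i kz i - kz q) * Pz q * ex q) = 0.
  apply: indep => t.
  transitivity (W.@[y t] ^+ (\sum_i kz i) * \sum_q b q * chi (u q) t); last by rewrite rel mulr0.
  rewrite meval_sum mulr_sumr.
  apply: eq_bigr => q _; rewrite mevalZ !mevalM rmorphXn /= -hPz exE.
  have -> : chi (u q) t = chi (u q - lam q) t * chi (lam q) t.
    by rewrite -(gc_chiD gc) ?subrK //; exact: (gc_US gc).
  rewrite -(unit_polyE chi w h) -/W.
  rewrite -[in RHS](@subnK (kz q) (\sum_i kz i)) ?exprD; last by rewrite (bigD1 q) //= leq_addr.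
  by rewrite -/(y t); ring.
(* Setting to zero the generators of all rows but [q1] leaves one term of the relation, which is not
   zero. *)
pose Z (k : 'I_(n0 + e)) := [exists q, (q != q1) && [exists j : 'I_(n (iota q)),
   ray_mem v sigma (idx_ij m j) && (k == rshift n0 (eh (idx_ij m j)))]].
have kW : kill_vars Z W = W.
  apply: kill_W => k; apply/negP => /existsP[q /andP[_ /existsP[j /andP[_ /eqP E]]]].
  by move/eqP: E; rewrite eq_lrshift.
have kex q : q != q1 -> kill_vars Z (ex q) = 0.
  move=> qq; have [j sj] := big (iota q).
  rewrite /kill_vars rmorph_prod /= (bigD1 j) /=; last exact/ray_memP.
  rewrite -!/(kill_vars _ _) kill_vars_exp kill_varsX.
  have -> : Z (rshift n0 (eh (idx_ij m j))).
    by apply/existsP; exists q; rewrite qq; apply/existsP; exists j; rewrite eqxx andbT; exact/ray_memP.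
  by rewrite expr0n gtn_eqF ?mul0r // (gav_l gav).
have kex1 : kill_vars Z (ex q1) = ex q1.
  rewrite /kill_vars rmorph_prod /=; apply: eq_bigr => j /ray_memP sj.
  rewrite -!/(kill_vars _ _) kill_vars_exp kill_varsX; case: ifP => // /existsP[q /andP[qq]].
  move=> /existsP[j' /andP[/ray_memP sj' /eqP /rshift_inj E]].
  have := ehP q1 j sj _ sj; rewrite E (ehP q j' sj' _ sj) eqxx; case: eqP => // -[E' _] _.
  by case/negP: qq; apply/eqP; exact: esym (iinj _ _ E').
have ex0 : ex q1 != 0.
  by apply/prodf_neq0 => j _; rewrite expf_neq0 // -msize_poly_eq0 msizeX.
have kP : kill_vars Z (Pz q1) != 0.
  have UN := gc_UN gc (Uz q1).
  have [k' [P' hP']] : laurent_rep chi w h (chi (- (u q1 - lam q1))).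
    by apply: (laurent_rep_generated gc Sh); exact: (generatedU h UN).
  have E : Pz q1 * P' = W ^+ (kz q1 + k').
    apply: (mpoly_ident indep) => t; rewrite mevalM -hPz -hP' rmorphXn /= (unit_polyE chi w h).
    rewrite mulrACA -(gc_chiD gc) ?subrr ?(gc_chi0 gc) ?mulr1 -?exprD //; exact: (gc_US gc).
  have : kill_vars Z (Pz q1 * P') != 0.
    by rewrite E kill_vars_exp kW expf_neq0 // W_neq0'.
  by rewrite kill_varsM mulf_eq0 negb_or => /andP[].
have := congr1 (kill_vars Z) poly0; rewrite /kill_vars raddf_sum /= raddf0 (bigD1 q1) //= [X in _ + X = _]big1.
  rewrite addr0 linearZ /= -!/(kill_vars _ _) !kill_varsM kill_vars_exp kW kex1 => /eqP.
  rewrite scaler_eq0 (negbTE bq1) !mulf_eq0 (negbTE kP) (negbTE ex0) expf_eq0 !orbF /=.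
  by rewrite (negbTE (W_neq0' _ _ _)) andbF.
by move=> q qq; rewrite linearZ /= -!/(kill_vars _ _) !kill_varsM kex // mulr0 scaler0.
Qed.

End Structure.

Theorem big_smooth (x : affine_chart X sigma) :
  (forall u, dual_chars sigma u -> ~ perp_chars sigma u -> pchar_at (val x) u = 0) ->
  smooth_point (chart_ring (Y := X) (sigma := sigma)) x ->
  has_dual_basis v sigma /\ star_condition c l d sigma.
Proof.
move=> x0 sm; have [om [om0 omE]] := balanced_weights.
pose p : M := \sum_(a | ray_mem v sigma a) om a *: v a.
(* By [balanced_weights] the pairing with [p] ignores the Z^r part, so it is a function of the
   degree; on a character it is a positive combination of its orders along the rays. *)
pose wt : {additive 'cV[int]_s -> int} := dot (dsubmx p).
have dotp u : dot p u = \sum_(a | ray_mem v sigma a) om a * dot u (v a).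
  by rewrite /p dot_suml; apply: eq_bigr => a _; rewrite dotZl dotC.
have wtE u : wt (deg u) = \sum_(a | ray_mem v sigma a) om a * dot u (v a).
  have -> : wt (deg u) = dot p (col_mx 0 (dsubmx u)).
    rewrite /wt /= [RHS]/dot big_split_ord /= big1 => [|i _]; last by rewrite col_mxEu mxE mulr0.
    by rewrite add0r; apply: eq_bigr => i _; rewrite col_mxEd mxE.
  have -> : col_mx 0 (dsubmx u) = u - col_mx (usubmx u) 0.
    by rewrite -{2}[u]vsubmxK opp_col_mx add_col_mx subrr oppr0 addr0.
  rewrite dotDr dotNr !dotp [X in _ - X]omE ?subr0 //.
  by rewrite col_mxKd.
have ge0 u a : S u -> ray_mem v sigma a -> 0 <= om a * dot u (v a).
  by move=> [du _] /ray_memP sa; rewrite mulr_ge0 ?(ltW (om0 a)) //; exact: (dualP u).1.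
have [|||||||n0 [w [kap [e [h [gc indep Sh gen hray]]]]]] :=
  @smooth_structure _ _ _ _ _ _ _ _ _ _ gav sigma Ss _ no_constraint _ deg wt _ _ _ _ _ _ _ x x0 sm.
- by move=> u Su; rewrite wtE; apply: sumr_ge0 => a; exact: ge0.
- move=> u Su; rewrite wtE => /eqP; rewrite psumr_eq0 => [/allP H|a]; last exact: ge0.
  split; last by case: Su.
  apply/perpP => a /ray_memP sa; have := H a (mem_index_enum a).
  by rewrite sa mulf_eq0 gt_eqF //= => /eqP.
- by move=> u [pu _]; rewrite wtE big1 // => a /ray_memP sa; rewrite (perpP u).1 ?mulr0.
- move=> u u' [pu _] [pu' _] E; apply/eqP; rewrite -subr_eq0; apply/eqP; apply: big_row_char_eq0.
    by rewrite [LHS](raddfB deg) E subrr.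
  by move=> a sa; rewrite dotBl (perpP u).1 // (perpP u').1 // subrr.
- exact: big_homogeneous.
- move=> g /big_span_all hg; exists (fun=> 1); split; last 1 first.
  + by rewrite (_ : (fun t => _) = g) //; apply/funext => t; rewrite mul1r.
  + exists [:: (1, 0)] => [a|]; last first.
      by apply/funext => t; rewrite /monomial_sum big_seq1 mul1r [RHS](pchar0 gav).
    rewrite inE => /eqP ->; split; [exact: dual_chars0 | exact: big_no_constraint].
  + by move=> t; exact: oner_neq0.
- by move=> u; exists u => //; exact: big_no_constraint.
by split; [exact: (big_dual_basis gc Sh gen hray) | exact: (big_star gc indep Sh gen hray)].
Qed.

End Big.

(** * Charts isomorphic to open subsets of affine spaces *)

Section RegularFunctions.
Variables (K : fieldType) (p : nat) (g : {mpoly K[p]}).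

(** Regular functions on the open set where [g] is nonzero; values elsewhere are arbitrary. *)
Definition regular_fun (F : ('I_p -> K) -> K) : Prop :=
  exists (k : nat) (P : {mpoly K[p]}), forall y, g.@[y] != 0 -> g.@[y] ^+ k * F y = P.@[y].

Lemma regular_poly (P : {mpoly K[p]}) : regular_fun (fun y => P.@[y]).
Proof. by exists 0%N, P => y _; rewrite mul1r. Qed.

Lemma regular_ext F F' : (forall y, g.@[y] != 0 -> F y = F' y) -> regular_fun F -> regular_fun F'.
Proof. by move=> E [k [P h]]; exists k, P => y gy; rewrite -E // h. Qed.

Lemma regularM F F' : regular_fun F -> regular_fun F' -> regular_fun (fun y => F y * F' y).
Proof.
move=> [k [P h]] [k' [P' h']]; exists (k + k')%N, (P * P') => y gy.
by rewrite mevalM -h // -h' // exprD mulrACA.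
Qed.

Lemma regularD F F' : regular_fun F -> regular_fun F' -> regular_fun (fun y => F y + F' y).
Proof.
move=> [k [P h]] [k' [P' h']]; exists (k + k')%N, (g ^+ k' * P + g ^+ k * P') => y gy.
by rewrite mevalD !mevalM -h // -h' // !rmorphXn /= exprD; ring.
Qed.

Lemma regularC a : regular_fun (fun=> a).
Proof. by exists 0%N, a%:MP => y _; rewrite mevalC mul1r. Qed.

Lemma regular_coord i : regular_fun (fun y => y i).
Proof. by exists 0%N, 'X_i => y _; rewrite mevalXU mul1r. Qed.

Lemma regular_exp F k : regular_fun F -> regular_fun (fun y => F y ^+ k).
Proof.
move=> rF; elim: k => [|k IH]; first exact: regularC.
by apply: (regular_ext _ (regularM rF IH)) => y _; rewrite exprS.
Qed.

Lemma regular_sum (I : Type) (r : seq I) (F : I -> ('I_p -> K) -> K) :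
  (forall i, regular_fun (F i)) -> regular_fun (fun y => \sum_(i <- r) F i y).
Proof.
move=> h; elim: r => [|i r IH].
  by apply: (regular_ext _ (regularC 0)) => y _; rewrite big_nil.
by apply: (regular_ext _ (regularD (h i) IH)) => y _; rewrite big_cons.
Qed.

Lemma regular_prod (I : Type) (r : seq I) (F : I -> ('I_p -> K) -> K) :
  (forall i, regular_fun (F i)) -> regular_fun (fun y => \prod_(i <- r) F i y).
Proof.
move=> h; elim: r => [|i r IH].
  by apply: (regular_ext _ (regularC 1)) => y _; rewrite big_nil.
by apply: (regular_ext _ (regularM (h i) IH)) => y _; rewrite big_cons.
Qed.

Lemma regular_inv F H : regular_fun H -> (forall y, g.@[y] != 0 -> F y * H y = g.@[y]) ->
  regular_fun (fun y => (F y)^-1).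
Proof.
move=> rH FH; have rg : regular_fun (fun y => (g.@[y])^-1).
  by exists 1%N, 1 => y gy; rewrite meval1 expr1 divff.
apply: (regular_ext _ (regularM rH rg)) => y gy; rewrite -FH // invfM mulrCA divff ?mulr1 //.
by have := gy; rewrite -(FH y gy) mulf_eq0 negb_or => /andP[].
Qed.

Lemma regular_expz F k : regular_fun F -> regular_fun (fun y => (F y)^-1) ->
  regular_fun (fun y => F y ^ k).
Proof.
move=> rF rV; case: k => k; first exact: regular_exp.
by apply: (regular_ext _ (regular_exp k.+1 rV)) => y _; rewrite NegzE -exprnN exprVn.
Qed.

(** Restriction to a smaller principal open set: its denominator [g] is a multiple of [q]. *)
Lemma regular_mul (q : {mpoly K[p]}) F :
  (exists (k : nat) (P : {mpoly K[p]}), forall y, q.@[y] != 0 -> q.@[y] ^+ k * F y = P.@[y]) ->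
  (exists q', g = q * q') -> regular_fun F.
Proof.
move=> [k [P h]] [q' E]; exists k, (q' ^+ k * P) => y.
rewrite E !mevalM mulf_eq0 negb_or => /andP[q0 _].
by rewrite exprMn rmorphXn /= -h //; ring.
Qed.

End RegularFunctions.

Section ChartCoordinates.
Variables (K : closedFieldType) (c r : nat) (n : 'I_r.+1 -> nat) (m s : nat).
Variables (A : 'M[K]_(c.+1, r.+1)) (l : forall i : 'I_r.+1, 'I_(n i) -> nat).
Variables (d : col_index n m -> 'cV[int]_s) (Sigma : set (set 'cV[rat]_(r + s))).
Hypothesis gav : explicit_gav A l d Sigma.
Let I : finType := col_index n m.
Let v : I -> 'cV[int]_(r + s) := P_col l d.
Let X := X_var A l d Sigma.
Let M : zmodType := 'cV[int]_(r + s).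
Variable sigma : set 'cV[rat]_(r + s).
Hypothesis Ss : Sigma sigma.

Let dualP u := dual_charsP (gav_fan gav) (gav_rays gav) u Ss.
Let perpP u := perp_charsP (gav_fan gav) (gav_rays gav) u Ss.

Definition cone_ray : finType := {a : I | ray_mem v sigma a}.

Lemma cone_rayP (a : cone_ray) : sigma (toQ (v (val a))).
Proof. by apply/ray_memP; exact: valP a. Qed.

Definition to_cone_ray a (sa : sigma (toQ (v a))) : cone_ray :=
  exist _ a (introT (ray_memP v sigma a) sa).

Variables (delta : cone_ray -> 'cV[int]_(r + s)).
Hypothesis deltaE : forall a b, dot (delta a) (v (val b)) = (b == a)%:Z.
Variables (E : finType) (w : E -> 'cV[int]_(r + s)) (kap : E -> 'cV[int]_(r + s) -> int).
Hypotheses (kapD : forall j u u', kap j (u + u') = kap j u + kap j u')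
  (perp_w : forall j, perp_chars sigma (w j))
  (perp_basis : forall u, perp_chars sigma u -> u = \sum_j kap j u *: w j)
  (kap_w : forall i j, kap j (w i) = (i == j)%:Z).

Definition unit_part (u : 'cV[int]_(r + s)) : 'cV[int]_(r + s) :=
  u - \sum_a dot u (v (val a)) *: delta a.

(** The value of the character [u] at the point of the toric chart with coordinates [T] along the
    rays of [sigma] and [om] for a basis of units. *)
Definition chart_mon (T : cone_ray -> K) (om : E -> K) (u : 'cV[int]_(r + s)) : K :=
  (\prod_a T a ^ dot u (v (val a))) * \prod_j om j ^ kap j (unit_part u).

Variable i1 : 'I_r.+1.

(** Along the rays of [sigma] it has the orders of the row monomial, so on the chart it replaces
    this monomial up to a factor without zeros that is the same for all rows. *)
Definition row_char (i : 'I_r.+1) : 'cV[int]_(r + s) :=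
  \sum_(a : cone_ray) (l_at l i1 (val a))%:Z *: delta a + (ebar s i - ebar s i1).

Lemma row_charE i b : sigma (toQ (v b)) -> dot (row_char i) (v b) = l_at l i b.
Proof.
move=> sb; rewrite dotDl dot_ebar dot_suml (bigD1 (to_cone_ray sb)) //= big1 => [|a ab].
  by rewrite dotZl (deltaE _ (to_cone_ray sb)) eqxx mulr1 addr0 addrC subrK.
by rewrite dotZl (deltaE _ (to_cone_ray sb)) eq_sym (negbTE ab) mulr0.
Qed.

Lemma row_char_dual i : dual_chars sigma (row_char i).
Proof. by apply/dualP => b sb; rewrite row_charE. Qed.

Lemma delta_dual a : dual_chars sigma (delta a).
Proof. by apply/dualP => b sb; rewrite (deltaE a (to_cone_ray sb)). Qed.

Lemma perp_dual u : perp_chars sigma u -> dual_chars sigma u.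
Proof. by move=> h x /h ->. Qed.

Lemma unit_part_perp u : perp_chars sigma (unit_part u).
Proof.
apply/perpP => b sb; rewrite dotBl dot_suml (bigD1 (to_cone_ray sb)) //= big1 => [|a ab].
  by rewrite dotZl (deltaE _ (to_cone_ray sb)) eqxx mulr1 addr0 subrr.
by rewrite dotZl (deltaE _ (to_cone_ray sb)) eq_sym (negbTE ab) mulr0.
Qed.

Lemma kap0 j : kap j 0 = 0.
Proof. by have := kapD j 0 0; rewrite addr0 => /esym/eqP; rewrite -subr_eq0 addrK => /eqP. Qed.

Lemma unit_part_units u : perp_chars sigma u -> unit_part u = u.
Proof.
move=> pu; rewrite /unit_part big1 ?subr0 // => a _.
by rewrite (iffLR (perpP u) pu _ (cone_rayP a)) scale0r.
Qed.

Lemma unit_part_delta a : unit_part (delta a) = 0.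
Proof.
rewrite /unit_part (bigD1 a) //= big1 => [|b ba]; rewrite deltaE.
  by rewrite eqxx scale1r addr0 subrr.
by rewrite (negbTE ba) scale0r.
Qed.

Lemma chart_mon_delta T om a : chart_mon T om (delta a) = T a.
Proof.
rewrite /chart_mon unit_part_delta [X in _ * X]big1 => [|j _]; last by rewrite kap0 expr0z.
rewrite mulr1 (bigD1 a) //= big1 => [|b ba]; rewrite deltaE ?eqxx ?expr1z ?mulr1 //.
by rewrite (negbTE ba) expr0z.
Qed.

Lemma chart_mon_w T om j : chart_mon T om (w j) = om j.
Proof.
rewrite /chart_mon unit_part_units // big1 => [|a _]; last first.
  by rewrite (iffLR (perpP _) (perp_w j) _ (cone_rayP a)) expr0z.
rewrite mul1r (bigD1 j) //= big1 => [|k kj]; rewrite kap_w ?eqxx ?expr1z ?mulr1 //.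
by rewrite eq_sym (negbTE kj) expr0z.
Qed.

Lemma chart_mon_ext T om T' om' u :
  (forall a, dot u (v (val a)) != 0 -> T a = T' a) ->
  (forall j, kap j (unit_part u) != 0 -> om j = om' j) ->
  chart_mon T om u = chart_mon T' om' u.
Proof.
move=> hT hom; congr (_ * _); apply: eq_bigr => a _.
  by have [->|/hT ->] := eqVneq (dot u (v (val a))) 0; rewrite ?expr0z.
by have [->|/hom ->] := eqVneq (kap a (unit_part u)) 0; rewrite ?expr0z.
Qed.

Lemma ev_chart_mon (z : I -> K) u : (forall a, z a = 0 -> sigma (toQ (v a))) -> dual_chars sigma u ->
  ev v z u = chart_mon (fun a => ev v z (delta a)) (fun j => ev v z (w j)) u.
Proof.
move=> zs du.
have ge0 u' a : dual_chars sigma u' -> z a = 0 -> 0 <= dot u' (v a).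
  by move=> du' /zs sa; exact: (dualP u').1.
have perpz u' a : perp_chars sigma u' -> z a = 0 -> dot u' (v a) = 0.
  by move=> pu /zs sa; exact: (perpP u').1.
pose good u' val := dual_chars sigma u' /\ ev v z u' = val.
have sum_good (J : finType) (x : J -> 'cV[int]_(r + s)) (e : J -> int) :
    (forall j, dual_chars sigma (e j *: x j)) ->
    good (\sum_j e j *: x j) (\prod_j ev v z (x j) ^ e j).
  move=> hx; apply: (big_rec2 good) => [|j val u' _ [du' Eu']].
    by split; [exact: dual_chars0 | exact: ev0].
  split; first exact: dual_charsD.
  by rewrite evD ?evZ ?Eu' // => a; apply: ge0.
have [d1 e1] : good (\sum_a dot u (v (val a)) *: delta a)
    (\prod_a ev v z (delta a) ^ dot u (v (val a))).
  apply: sum_good => a; apply/dualP => b sb; rewrite dotZl (deltaE a (to_cone_ray sb)).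
  by rewrite mulr_ge0 // (iffLR (dualP u) du _ (cone_rayP a)).
have pz := unit_part_perp u.
have [d2 e2] : good (\sum_j kap j (unit_part u) *: w j) (\prod_j ev v z (w j) ^ kap j (unit_part u)).
  by apply: sum_good => j; apply/dualP => b sb; rewrite dotZl (iffLR (perpP _) (perp_w j) _ sb) mulr0.
rewrite -perp_basis // in d2 e2.
rewrite /chart_mon -e1 -e2 -evD => [|a|a]; try by apply: ge0.
by rewrite addrC subrK.
Qed.

Lemma chart_char_mon (y : affine_chart X sigma) u : dual_chars sigma u ->
  pchar_at (val y) u =
  chart_mon (fun a => pchar_at (val y) (delta a)) (fun j => pchar_at (val y) (w j)) u.
Proof.
move=> du; have [z [_ zs] Ez] := chart_pointP gav y; rewrite Ez // ev_chart_mon //.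
congr (_ * _); apply: eq_bigr => a _; rewrite Ez //; first exact: delta_dual.
exact: perp_dual.
Qed.

Lemma row_char_ev (z : I -> K) : (forall a, z a = 0 -> sigma (toQ (v a))) ->
  exists2 b, b != 0 & forall i, ev v z (row_char i) = b * monom_T l z i.
Proof.
move=> zs.
pose e a := dot (row_char i1) (v a) - (l_at l i1 a)%:Z.
have e0 a : z a = 0 -> e a = 0 by move=> /zs sa; rewrite /e row_charE // subrr.
exists (\prod_a z a ^ e a).
  by apply/prodf_neq0 => a _; have [/e0 ->|za] := eqVneq (z a) 0; rewrite ?expr0z ?oner_neq0 // expfz_neq0.
move=> i; rewrite monom_TE -big_split; apply: eq_bigr => a _ /=.
have Ea : dot (row_char i) (v a) = e a + (l_at l i a)%:Z.
  rewrite /e /row_char dotDl dot_ebar dotDl dot_ebar; ring.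
rewrite Ea; have [/[dup] za /e0 ->|za] := eqVneq (z a) 0; first by rewrite add0r expr0z mul1r.
by rewrite expfzDr.
Qed.

Lemma chart_rowspace (y : affine_chart X sigma) :
  in_rowspace A (fun i => pchar_at (val y) (row_char i)).
Proof.
have [z [bz zs] Ez] := chart_pointP gav y; have [b _ hb] := row_char_ev zs.
rewrite (_ : (fun i => _) = fun i => b * monom_T l z i).
  by apply: in_rowspaceZ; exact/(barXP gav).
by apply/funext => i; rewrite Ez ?hb //; exact: row_char_dual.
Qed.

Lemma chart_mon_multiplicative (om : E -> K) : (forall j, om j != 0) ->
  (forall u u', \prod_j om j ^ kap j (u + u') = (\prod_j om j ^ kap j u) * \prod_j om j ^ kap j u') /\
  forall u, \prod_j om j ^ kap j u != 0.
Proof.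
move=> om0; split=> [u u'|u].
  by rewrite -big_split; apply: eq_bigr => j _; rewrite kapD expfzDr.
by apply/prodf_neq0 => j _; rewrite expfz_neq0.
Qed.

(** The unit coordinates lift to a torus point of Cox's space. The ray coordinates are then adjusted
    by factors, possibly zero, at the rays of [sigma] only, which leaves the units unchanged. *)
Lemma chart_point_of_coords (T : cone_ray -> K) (om : E -> K) : (forall j, om j != 0) ->
  in_rowspace A (fun i => chart_mon T om (row_char i)) ->
  exists y : affine_chart X sigma, forall u, dual_chars sigma u ->
    pchar_at (val y) u = chart_mon T om u.
Proof.
move=> om0 Lx; have [phiD phi0] := chart_mon_multiplicative om0.
pose phi u := \prod_j om j ^ kap j u.
have [zeta [z0 zev _]] := @torus_lift _ _ _ _ _ _ _ _ _ _ gav phi phiD phi0.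
pose tau a := if insub a is Some b then T b / ev v zeta (delta b) else 1.
have tauE (b : cone_ray) : tau (val b) = T b / ev v zeta (delta b) by rewrite /tau valK.
pose z a := zeta a * tau a.
have zs a : z a = 0 -> sigma (toQ (v a)).
  move=> /eqP; rewrite mulf_eq0 (negbTE (z0 a)) /tau; case: insubP => [b _ <- _|_].
    exact: cone_rayP.
  by rewrite oner_eq0.
have tau1 a : ~ sigma (toQ (v a)) -> tau a = 1.
  by move=> na; rewrite /tau insubN //; apply/ray_memP.
have ev_tau_w j : ev v tau (w j) = 1.
  rewrite /ev big1 // => a _; have [sa|/tau1 ->] := pselect (sigma (toQ (v a))); last exact: exp1rz.
  by rewrite (iffLR (perpP _) (perp_w j) _ sa) expr0z.
have ev_tau_delta b : ev v tau (delta b) = tau (val b).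
  rewrite /ev (bigD1 (val b)) //= big1 => [|a ab].
    by rewrite deltaE eqxx expr1z mulr1.
  have [sa|/tau1 ->] := pselect (sigma (toQ (v a))); last exact: exp1rz.
  rewrite (deltaE b (to_cone_ray sa)) (_ : (to_cone_ray sa == b) = false) ?expr0z //.
  by apply: contraNF ab => /eqP <-.
have Ez u : dual_chars sigma u -> ev v z u = chart_mon T om u.
  move=> du; rewrite ev_chart_mon //; apply: chart_mon_ext => [b _|j _].
    by rewrite ev_mul ev_tau_delta tauE zev mulrCA divff ?mulr1 // /phi -/(phi _) phi0.
  rewrite ev_mul ev_tau_w mulr1 zev /phi (bigD1 j) //= big1 => [|k kj].
    by rewrite kap_w eqxx expr1z mulr1.
  by rewrite kap_w eq_sym (negbTE kj) expr0z.
have bz : barX A l z.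
  apply/(barXP gav); have [b b0 hb] := row_char_ev zs.
  rewrite (_ : monom_T l z = fun i => b^-1 * chart_mon T om (row_char i)).
    exact: in_rowspaceZ.
  by apply/funext => i; rewrite -Ez ?hb ?mulKf //; exact: row_char_dual.
have [y hy] := chart_point gav Ss (conj bz zs).
by exists y => u du; rewrite hy // Ez.
Qed.

(* The chart is the graph of psi over D(g), hence isomorphic to D(g). *)
Theorem smooth_of_coordinates (p : nat) (g : {mpoly K[p]})
    (psiT : cone_ray -> ('I_p -> K) -> K) (psiom : E -> ('I_p -> K) -> K)
    (ys : 'I_p -> 'cV[int]_(r + s)) :
  (forall a, regular_fun g (psiT a)) -> (forall j, regular_fun g (psiom j)) ->
  (forall j, regular_fun g (fun x => (psiom j x)^-1)) ->
  (forall j x, g.@[x] != 0 -> psiom j x != 0) ->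
  (forall i, dual_chars sigma (ys i)) ->
  let y i (t : affine_chart X sigma) := pchar_at (val t) (ys i) in
  (forall t, g.@[y^~ t] != 0) ->
  (forall a t, pchar_at (val t) (delta a) = psiT a (y^~ t)) ->
  (forall j t, pchar_at (val t) (w j) = psiom j (y^~ t)) ->
  (forall x, g.@[x] != 0 ->
     in_rowspace A (fun i => chart_mon (psiT^~ x) (psiom^~ x) (row_char i))) ->
  (forall x i, g.@[x] != 0 -> chart_mon (psiT^~ x) (psiom^~ x) (ys i) = x i) ->
  forall x, smooth_point (chart_ring (Y := X) (sigma := sigma)) x.
Proof.
move=> rT rom rV om0 dy y gy ET Eom hrow hys.
apply: (@smooth_of_parametrization K _ _ p y g (chart_ring_subalgebra gav Ss)) => //.
- by move=> i; exact: chart_ring_char.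
- move=> x gx; have [t ht] := chart_point_of_coords (fun j => om0 j x gx) (hrow x gx).
  by exists t => i; rewrite /y ht // hys.
move=> f /chart_ringP[q dq ->].
(* The value 0 for characters outside the dual cone makes each summand regular; no such character
   occurs in [q]. *)
suff [k [P hP]] : regular_fun g (fun x => \sum_(a <- q) a.1 *
    if `[< dual_chars sigma a.2 >] then chart_mon (psiT^~ x) (psiom^~ x) a.2 else 0).
  exists k, P => t; rewrite -hP //; congr (_ * _); apply: eq_big_seq => a /dq da.
  rewrite asboolT // chart_char_mon //; congr (_ * _); apply: chart_mon_ext => [b _|j _].
    exact: ET.
  exact: Eom.
apply: regular_sum => a; apply: regularM; first exact: regularC.
case: asboolP => da; last exact: regularC.
apply: regularM; apply: regular_prod => b; last exact: regular_expz.
have := iffLR (dualP _) da _ (cone_rayP b); case: (dot _ _) => // k _.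
exact: regular_exp.
Qed.

End ChartCoordinates.

(** Multiply [g0] by the numerators of all [Q j], that is, shrink the open set to where they are
    nonzero. *)
Lemma invertible_denominator (K : fieldType) (p : nat) (g0 : {mpoly K[p]}) (J : finType)
    (Q : J -> ('I_p -> K) -> K) : (forall j, regular_fun g0 (Q j)) ->
  exists g : {mpoly K[p]}, [/\ forall F, regular_fun g0 F -> regular_fun g F,
    forall j, regular_fun g (fun x => (Q j x)^-1)
  & forall x, g.@[x] != 0 <-> g0.@[x] != 0 /\ forall j, Q j x != 0].
Proof.
move=> rQ; have /choice[k /choice[P hP]] := rQ.
pose g := g0 * \prod_j P j; exists g.
have gE x : g.@[x] = g0.@[x] * \prod_j (P j).@[x] by rewrite mevalM rmorph_prod.
have g0g x : g.@[x] != 0 -> g0.@[x] != 0 by rewrite gE mulf_eq0 negb_or => /andP[].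
have lift F : regular_fun g0 F -> regular_fun g F.
  by move=> rF; apply: (@regular_mul _ _ g g0 F rF); exists (\prod_j P j).
split=> // [j|x].
  apply: (@regular_inv _ _ g (Q j) (fun x => (g0 ^+ (k j).+1 * \prod_(i | i != j) P i).@[x])).
    exact: regular_poly.
  move=> x /g0g gx; rewrite gE mevalM rmorphXn rmorph_prod [in RHS](bigD1 j) //= -hP //.
  by rewrite exprSr; ring.
rewrite gE mulf_eq0 negb_or; split=> [/andP[gx /prodf_neq0 Px]|[gx Qx]].
  split=> // j; have := Px j isT; rewrite -hP // mulf_eq0 negb_or; by case/andP.
rewrite gx; apply/prodf_neq0 => j _; by rewrite -hP // mulf_neq0 ?expf_neq0.
Qed.

(** * Regular leaf cones have smooth charts *)

Section LeafConverse.
Variables (K : closedFieldType) (c r : nat) (n : 'I_r.+1 -> nat) (m s : nat).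
Variables (A : 'M[K]_(c.+1, r.+1)) (l : forall i : 'I_r.+1, 'I_(n i) -> nat).
Variables (d : col_index n m -> 'cV[int]_s) (Sigma : set (set 'cV[rat]_(r + s))).
Hypothesis gav : explicit_gav A l d Sigma.
Let I : finType := col_index n m.
Let v : I -> 'cV[int]_(r + s) := P_col l d.
Let X := X_var A l d Sigma.
Let M : zmodType := 'cV[int]_(r + s).
Variable sigma : set 'cV[rat]_(r + s).
Hypothesis Ss : Sigma sigma.
Variables (J : {set 'I_r.+1}) (i0 : 'I_r.+1).
Hypotheses (hJ : forall i (j : 'I_(n i)), sigma (v_ij l d j) -> i \in J) (i0J : i0 \notin J).
Variables (f : 'I_c.+1 -> 'I_r.+1) (cf : 'I_r.+1 -> 'I_c.+1 -> K).
Hypotheses (fC : forall i, (i \in J) || (i == i0) <-> exists k, f k = i)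
  (cf1 : forall x, in_rowspace A x <-> forall i, x i = \sum_k cf i k * x (f k))
  (cf2 : forall k k', cf (f k) k' = (k' == k)%:R).

Let dualP u := dual_charsP (gav_fan gav) (gav_rays gav) u Ss.
Let perpP u := perp_charsP (gav_fan gav) (gav_rays gav) u Ss.
Let outer := outer_row J i0.
Let R := cone_ray l d sigma.
Let row i : 'cV[int]_(r + s) := ebar s i - ebar s i0.
Let pr (u : 'cV[int]_(r + s)) := u - \sum_(i | outer i) hcoef i u *: row i.

Lemma pr_constrained u : constrained (leaf_constraint s J i0) (pr u).
Proof. by have [u' cu' Eu] := @leaf_project r s J i0 u; rewrite /pr {1}Eu addrK. Qed.

Lemma pr_dot u a : sigma (toQ (v a)) -> dot (pr u) (v a) = dot u (v a).
Proof.
move=> sa; rewrite dotBl dot_suml big1 ?subr0 // => i oi.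
by rewrite dotZl (outer_unit hJ i0J oi sa) mulr0.
Qed.

Lemma prD u w : pr (u + w) = pr u + pr w.
Proof.
rewrite /pr -addrACA -opprD -big_split; congr (_ - _); apply: eq_bigr => i _ /=.
by rewrite hcoefD scalerDl.
Qed.

Lemma hcoef_row i k : outer k -> hcoef k (row i) = (k == i)%:Z.
Proof. by move=> /andP[_ /negbTE ki0]; rewrite hcoef_ebar ki0 subr0. Qed.

Lemma pr_row i : outer i -> pr (row i) = 0.
Proof.
move=> oi; rewrite /pr (bigD1 i) //= big1 => [|k /andP[ok /negbTE ki]]; last first.
  by rewrite hcoef_row // ki scale0r.
by rewrite hcoef_row // eqxx scale1r addr0 subrr.
Qed.

Lemma pr_id u : (forall i, outer i -> hcoef i u = 0) -> pr u = u.
Proof. by move=> h; rewrite /pr big1 ?subr0 // => i /h ->; rewrite scale0r. Qed.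

Lemma row_inner i : i \in J \/ i = i0 -> forall k, outer k -> hcoef k (row i) = 0.
Proof.
move=> hi k ok; rewrite hcoef_row //; case: eqP => // E; subst k.
by case: hi ok => [iJ|->]; rewrite /outer /outer_row ?iJ // eqxx andbF.
Qed.

(** Free coordinates are the dual characters and a basis of units, both without outer components.
    The outer ratios are the functions [Q i] of these, by the linear relations, so the chart is the
    open set where the units and the [Q i] are nonzero. *)
Theorem leaf_dual_basis_smooth : has_dual_basis v sigma ->
  forall x, smooth_point (chart_ring (Y := X) (sigma := sigma)) x.
Proof.
move=> dual.
have /choice[delta hd] (a : R) : exists u, (forall i, outer i -> hcoef i u = 0) /\
    forall b, sigma (toQ (v b)) -> dot u (v b) = (b == val a)%:Z.
  have [u hu] := dual (val a) (cone_rayP a); exists (pr u); split.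
    exact/leaf_constrained/pr_constrained.
  by move=> b sb; rewrite pr_dot ?hu.
have deltaE a (b : R) : dot (delta a) (v (val b)) = (b == a)%:Z.
  by rewrite (hd a).2 //; exact: cone_rayP.
have [n0 [w0 [kap0 [Uw basis kw]]]] := units_basis gav Ss (leaf_constraint s J i0).
pose E : finType := ('I_n0 + {i : 'I_r.+1 | i \in outer})%type.
pose w (j : E) := match j with inl k => w0 k | inr i => row (val i) end.
pose kap (j : E) u := match j with inl k => dot (kap0 k) (pr u) | inr i => hcoef (val i) u end.
have oE (i : {i : 'I_r.+1 | i \in outer}) : outer (val i) by exact: valP i.
have w0h k i : outer i -> hcoef i (w0 k) = 0.
  by apply: (iffLR (leaf_constrained J i0 _)); case: (Uw k).
have kapD j u u' : kap j (u + u') = kap j u + kap j u'.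
  by case: j => j; rewrite /kap ?prD ?dotDr ?hcoefD.
have perp_row i : outer i -> perp_chars sigma (row i).
  by move=> oi; apply/perpP => a sa; exact: (outer_unit hJ i0J oi sa).
have perp_w j : perp_chars sigma (w j).
  by case: j => [k|i] /=; [case: (Uw k) | exact: perp_row (oE i)].
have perp_basis u : perp_chars sigma u -> u = \sum_j kap j u *: w j.
  move=> pu; rewrite big_sumType /=.
  rewrite -(big_sub (op := +%R) outer (fun i => hcoef i u *: row i)).
  rewrite (eq_bigr (fun k => w0 k *~ dot (kap0 k) (pr u))) => [|k _]; last by rewrite -scaler_int intz.
  rewrite -basis ?subrK //; split; last exact: pr_constrained.
  by apply/perpP => a sa; rewrite pr_dot // (perpP u).1.
have kap_w i j : kap j (w i) = (i == j)%:Z.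
  case: i j => [i|i] [j|j] /=.
  - by rewrite pr_id ?kw // => k; exact: w0h.
  - by rewrite (w0h _ _ (oE j)).
  - by rewrite (pr_row (oE i)) dot0r.
  - by rewrite (hcoef_row _ (oE j)) eq_sym.
have row_charE i : row_char delta i0 i = row i.
  rewrite /row_char big1 ?add0r // => a _.
  by rewrite (sigma_row hJ (cone_rayP a) i0J) scale0r.
have unit_row i j : i \in J \/ i = i0 -> kap (inr j) (unit_part delta (row i)) = 0.
  move=> hi; rewrite /kap /unit_part hcoefD hcoefN (row_inner hi) // hcoefE dot_sumr big1 ?subr0 //.
  by move=> a _; rewrite dotZr -hcoefE (hd a).1 ?mulr0.
have row_dual i : i \in J \/ i = i0 -> dual_chars sigma (row i).
  by case/(ratio_monoid gav Ss hJ i0J).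
pose V : finType := (R + 'I_n0)%type.
pose p := #|V|.
pose T0 (a : R) (x : 'I_p -> K) := x (enum_rank (inl a : V)).
pose u0 (j : 'I_n0) (x : 'I_p -> K) := x (enum_rank (inr j : V)).
(* Outer coordinates may be set to 1 here: the inner ratios do not involve them. *)
pose om0 (j : E) (x : 'I_p -> K) := if j is inl k then u0 k x else 1.
pose Q (i : {i : 'I_r.+1 | i \in outer}) (x : 'I_p -> K) :=
  \sum_k cf (val i) k * chart_mon delta kap (T0^~ x) (om0^~ x) (row (f k)).
pose om (j : E) (x : 'I_p -> K) := match j with inl k => u0 k x | inr i => Q i x end.
pose ys (i : 'I_p) := match enum_val i with inl a => delta a | inr j => w0 j end.
(* The units are inverted first, because the [Q i] are regular only where they are nonzero. *)
have [g1 [lift1 inv1 nz1]] := @invertible_denominator K p 1 _ u0 (fun j => regular_coord _ _).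
have fin k : f k \in J \/ f k = i0 := f_inner fC k.
have rT0 a : regular_fun g1 (T0 a) by exact: regular_coord.
have ru0 a : regular_fun g1 (u0 a) by exact: regular_coord.
have rQ i : regular_fun g1 (Q i).
  apply: regular_sum => k; apply: regularM; first exact: regularC.
  apply: regularM; apply: regular_prod => a.
    have := iffLR (dualP _) (row_dual _ (fin k)) _ (cone_rayP a); case: (dot _ _) => // q _.
    exact: regular_exp.
  case: a => [a|a]; first exact: (regular_expz _ (ru0 a) (inv1 a)).
  by apply: (regular_ext _ (regularC _ 1)) => x _; rewrite /om0 exp1rz.
have [g [lift inv nz]] := invertible_denominator rQ.
have chi_row (t : affine_chart X sigma) k : chart_mon delta kap
    (T0^~ (fun i => pchar_at (val t) (ys i))) (om0^~ (fun i => pchar_at (val t) (ys i))) (row (f k)) =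
    pchar_at (val t) (row (f k)).
  rewrite (chart_char_mon gav Ss deltaE perp_w perp_basis t (row_dual _ (fin k))).
  apply: chart_mon_ext => [a _|[j|j] nz0]; rewrite /T0 /= /u0 /ys ?enum_rankK //.
  by rewrite unit_row ?eqxx in nz0.
have Q_row (t : affine_chart X sigma) i : pchar_at (val t) (row (val i)) = Q i (fun i => pchar_at (val t) (ys i)).
  have [->|] := leaf_ratioE gav Ss hJ i0J fC cf1 (val i) t; last by have := oE i; rewrite /outer => ->.
  by apply: eq_bigr => k _; rewrite chi_row.
apply: (@smooth_of_coordinates _ _ _ _ _ _ _ _ _ _ gav _ Ss delta deltaE E w kap kapD perp_w perp_basis
  kap_w i0 p g T0 om ys).
- by move=> a; exact: lift.
- by case=> j; [exact: lift (ru0 j) | exact: lift (rQ j)].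
- by case=> j; [exact: lift (inv1 j) | exact: inv].
- by move=> [j|j] x /nz[/nz1[_ h1] h]; [exact: h1 | exact: h].
- move=> i; rewrite /ys; case: (enum_val i) => a.
    by apply/dualP => b sb; rewrite (hd a).2.
  by apply: perp_dual; case: (Uw a).
- move=> t; apply/nz; split.
    apply/nz1; split=> [|j]; first by rewrite meval1 oner_neq0.
    rewrite /u0 /ys enum_rankK; have [z hz ->] := chart_pointP gav t.
      by apply: ev_neq0 => a /hz.2; apply: (perpP _).1; case: (Uw j).
    by apply: perp_dual; case: (Uw j).
  move=> i; rewrite -[X in X != _](Q_row t i).
  have [->|] := leaf_ratioE gav Ss hJ i0J fC cf1 (val i) t; last by have := oE i; rewrite /outer => ->.
  exact: (outer_char_neq0 gav Ss hJ i0J fC cf1 t (oE i)).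
- by move=> a t; rewrite /T0 /ys enum_rankK.
- by move=> [j|j] t /=; [rewrite /u0 /ys enum_rankK | exact: Q_row].
- move=> x gx; apply/cf1 => i; rewrite (eq_bigr (fun k => cf i k *
      chart_mon delta kap (T0^~ x) (om0^~ x) (row (f k)))) => [|k _].
    case oi: (outer i).
      rewrite row_charE (chart_mon_w gav Ss delta perp_w kap_w _ _ (inr (exist _ i oi))).
      by [].
    have /fC[k <-] : (i \in J) || (i == i0).
      by move: oi; rewrite /outer /outer_row; case: (i \in J); case: (i == i0).
    rewrite (bigD1 k) //= cf2 eqxx mul1r big1 ?addr0 => [|k' /negbTE k'k]; last first.
      by rewrite cf2 k'k mul0r.
    rewrite row_charE; apply: chart_mon_ext => // -[j|j] // nz0.
    by rewrite unit_row ?eqxx in nz0.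
  rewrite row_charE; congr (_ * _); apply: chart_mon_ext => // -[j|j] // nz0.
  by rewrite unit_row ?eqxx in nz0.
move=> x i gx; rewrite /ys -{2}[i]enum_valK; case: (enum_val i) => a.
  exact: (chart_mon_delta deltaE kapD).
exact: (chart_mon_w gav Ss delta perp_w kap_w _ _ (inl a)).
Qed.

End LeafConverse.

(** * Regular big cones with few bad rows have smooth charts *)

Section BigConverse.
Variables (K : closedFieldType) (c r : nat) (n : 'I_r.+1 -> nat) (m s : nat).
Variables (A : 'M[K]_(c.+1, r.+1)) (l : forall i : 'I_r.+1, 'I_(n i) -> nat).
Variables (d : col_index n m -> 'cV[int]_s) (Sigma : set (set 'cV[rat]_(r + s))).
Hypothesis gav : explicit_gav A l d Sigma.
Let I : finType := col_index n m.
Let v : I -> 'cV[int]_(r + s) := P_col l d.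
Let X := X_var A l d Sigma.
Let M : zmodType := 'cV[int]_(r + s).
Variable sigma : set 'cV[rat]_(r + s).
Hypothesis Ss : Sigma sigma.
Let R := cone_ray l d sigma.

Section GoodRows.
Variables (C : {set 'I_r.+1}) (f : 'I_c.+1 -> 'I_r.+1) (cf : 'I_r.+1 -> 'I_c.+1 -> K).
Hypotheses (good : forall i, i \notin C -> exists j : 'I_(n i),
    [/\ sigma (v_ij l d j), l j = 1%N & forall k, k != j -> ~ sigma (v_ij l d k)])
  (fC : forall i, i \in C <-> exists k, f k = i)
  (cf1 : forall x, in_rowspace A x <-> forall i, x i = \sum_k cf i k * x (f k))
  (cf2 : forall k k', cf (f k) k' = (k' == k)%:R).

Let dualP u := dual_charsP (gav_fan gav) (gav_rays gav) u Ss.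
Let perpP u := perp_charsP (gav_fan gav) (gav_rays gav) u Ss.

(* In a row outside C the linear relation with the rows of C determines the coordinate
   of the only ray of sigma in that row, as its exponent is 1. *)
Definition kept (a : R) : bool := if val a is inl p then tag p \in C else true.
Definition row_of (a : R) : 'I_r.+1 := if val a is inl p then tag p else ord0.

Lemma unkept_l_at a b : ~~ kept a -> l_at l (row_of a) (val b) = (b == a).
Proof.
rewrite -val_eqE /kept /row_of; have := cone_rayP a; have := cone_rayP b.
case: (val a) => // -[i j] sb sa /good[j0 [_ lj0 hj0]].
have uniq k : sigma (v_ij l d k) -> k = j0 by have [//|/hj0] := eqVneq k j0.
have Ej : j = j0 by exact: uniq.
case: (val b) sb => [[i' j']|k'] //= sb.
have [E|ne] := eqVneq i' i; last first.
  by apply/esym/eqP; rewrite eqb0; apply: contra_neq ne => -[].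
by subst i'; rewrite (uniq j' sb) Ej lj0 eqxx.
Qed.

Lemma unkept_ray i : i \notin C -> exists a, ~~ kept a /\ row_of a = i.
Proof.
move=> iC; have [j [sj _ _]] := good iC.
by exists (to_cone_ray (a := idx_ij m j) sj).
Qed.

Lemma kept_l_at k a : ~~ kept a -> l_at l (f k) (val a) = 0%N.
Proof.
have : f k \in C by apply/fC; exists k.
by rewrite /kept; case: (val a) => [p fk /negP pC|//] /=; case: eqP => // E; case: pC; rewrite E.
Qed.

(** Coordinates are the kept rays and the units. The character of a row outside [C] is the
    coordinate of its only ray times a unit [mu], so the linear relation is solved for it by
    division by [mu]. *)
Lemma good_rows_smooth : has_dual_basis v sigma ->
  forall x, smooth_point (chart_ring (Y := X) (sigma := sigma)) x.
Proof.
move=> dual.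
have /choice[delta hd] (a : R) : exists u, forall b, sigma (toQ (v b)) -> dot u (v b) = (b == val a)%:Z.
  exact: dual (val a) (cone_rayP a).
have deltaE a (b : R) : dot (delta a) (v (val b)) = (b == a)%:Z.
  by rewrite hd //; exact: cone_rayP.
have [n0 [w [kap0 [Uw basis kw]]]] := units_basis gav Ss (fun _ : 'I_0 => 0).
pose kap j u := dot (kap0 j) u.
have kapD j u u' : kap j (u + u') = kap j u + kap j u' by exact: dotDr.
have perp_w j : perp_chars sigma (w j) by case: (Uw j).
have perp_basis u : perp_chars sigma u -> u = \sum_j kap j u *: w j.
  move=> pu; rewrite {1}[u]basis; last by split=> // -[].
  by apply: eq_bigr => j _; rewrite -scaler_int intz.
have kap_w i j : kap j (w i) = (i == j)%:Z by exact: kw.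
pose rowc := row_char delta (f ord0).
have rowcE i (a : R) : dot (rowc i) (v (val a)) = (l_at l i (val a))%:Z.
  exact: (row_charE deltaE _ i (cone_rayP a)).
have rowc_dual i : dual_chars sigma (rowc i) := row_char_dual gav Ss deltaE (f ord0) i.
pose mu (z : 'I_n0 -> K) i := \prod_j z j ^ kap j (unit_part delta (rowc i)).
have mon_unkept (T : R -> K) (z : 'I_n0 -> K) a : ~~ kept a ->
    chart_mon delta kap T z (rowc (row_of a)) = T a * mu z (row_of a).
  move=> ka; congr (_ * _); rewrite (bigD1 a) //= big1 ?mulr1 => [|b ba]; rewrite rowcE unkept_l_at //.
    by rewrite eqxx expr1z.
  by rewrite (negbTE ba) expr0z.
pose V : finType := ({a : R | kept a} + 'I_n0)%type.
pose p := #|V|.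
pose T0 (a : R) (x : 'I_p -> K) := if insub a is Some b then x (enum_rank (inl b : V)) else 1.
pose u0 (j : 'I_n0) (x : 'I_p -> K) := x (enum_rank (inr j : V)).
pose L i (x : 'I_p -> K) := \sum_k cf i k * chart_mon delta kap (T0^~ x) (u0^~ x) (rowc (f k)).
pose T (a : R) (x : 'I_p -> K) := if kept a then T0 a x else
  (\prod_j u0 j x ^ (- kap j (unit_part delta (rowc (row_of a))))) * L (row_of a) x.
have T_mu a x : ~~ kept a -> (forall j, u0 j x != 0) -> T a x * mu (u0^~ x) (row_of a) = L (row_of a) x.
  move=> ka ux; rewrite /T (negbTE ka) mulrAC -big_split /= big1 ?mul1r // => j _.
  by rewrite -expfzDr // addNr expr0z.
have mon_f (T' : R -> K) z x k : (forall a, kept a -> T' a = T0 a x) -> (forall j, z j = u0 j x) ->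
    chart_mon delta kap T' z (rowc (f k)) = chart_mon delta kap (T0^~ x) (u0^~ x) (rowc (f k)).
  move=> hT hz; apply: chart_mon_ext => // a; rewrite rowcE.
  by case ka: (kept a); [move=> _; exact: hT | rewrite kept_l_at ?ka ?eqxx].
pose ys (i : 'I_p) := match enum_val i with inl a => delta (val a) | inr j => w j end.
have [g [lift inv nz]] := @invertible_denominator K p 1 _ u0 (fun j => regular_coord _ _).
have rT0 a : regular_fun g (T0 a).
  by rewrite /T0; case: insub => [b|]; [exact: regular_coord | exact: regularC].
have ru0 a : regular_fun g (u0 a) by exact: regular_coord.
have rL i : regular_fun g (L i).
  apply: regular_sum => k; apply: regularM; first exact: regularC.
  apply: regularM; apply: regular_prod => a.
    by rewrite rowcE; exact: regular_exp.
  exact: (regular_expz _ (ru0 a) (inv a)).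
have T0y (t : affine_chart X sigma) a : kept a ->
    T0 a (fun i => pchar_at (val t) (ys i)) = pchar_at (val t) (delta a).
  by move=> ka; rewrite /T0 insubT /ys enum_rankK.
have u0y (t : affine_chart X sigma) j :
    u0 j (fun i => pchar_at (val t) (ys i)) = pchar_at (val t) (w j).
  by rewrite /u0 /ys enum_rankK.
have u0nz x j : g.@[x] != 0 -> u0 j x != 0 by case/nz => _; exact.
have gy (t : affine_chart X sigma) : g.@[fun i => pchar_at (val t) (ys i)] != 0.
  apply/nz; split=> [|j]; first by rewrite meval1 oner_neq0.
  rewrite u0y; have [z hz ->] := chart_pointP gav t; last exact: perp_dual.
  by apply: ev_neq0 => a /hz.2; apply: (perpP _).1.
have chi_mon (t : affine_chart X sigma) i := chart_char_mon gav Ss deltaE perp_w perp_basis t (rowc_dual i).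
apply: (@smooth_of_coordinates _ _ _ _ _ _ _ _ _ _ gav _ Ss delta deltaE _ w kap kapD perp_w perp_basis
  kap_w (f ord0) p g T u0 ys) => //.
- move=> a; rewrite /T; case: (kept a) => //; apply: regularM => //.
  by apply: regular_prod => j; exact: (regular_expz _ (ru0 j) (inv j)).
- by move=> j x; exact: u0nz.
- move=> i; rewrite /ys; case: (enum_val i) => a; last exact: perp_dual.
  by apply/dualP => b sb; rewrite hd.
- move=> a t; case ka: (kept a); first by rewrite /T ka T0y.
  have {}ka : ~~ kept a by rewrite ka.
  have m0 : mu (u0^~ (fun i => pchar_at (val t) (ys i))) (row_of a) != 0.
    by apply/prodf_neq0 => j _; rewrite expfz_neq0 // u0nz.
  apply: (mulIf m0); rewrite T_mu // => [|j]; last exact: u0nz.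
  have -> : mu (u0^~ (fun i => pchar_at (val t) (ys i))) (row_of a) =
      mu (fun j => pchar_at (val t) (w j)) (row_of a) by apply: eq_bigr => j _; rewrite u0y.
  rewrite -(mon_unkept (fun a => pchar_at (val t) (delta a))) // -chi_mon.
  rewrite (iffLR (cf1 _) (chart_rowspace gav Ss deltaE (f ord0) t)); apply: eq_bigr => k _.
  by rewrite -/(rowc (f k)) chi_mon; congr (_ * _); apply: mon_f => [b kb|j]; rewrite ?T0y ?u0y.
- move=> x gx; have ux j := u0nz x j gx.
  have Tf k : chart_mon delta kap (T^~ x) (u0^~ x) (rowc (f k)) =
      chart_mon delta kap (T0^~ x) (u0^~ x) (rowc (f k)).
    by apply: mon_f => // a ka; rewrite /T ka.
  apply/cf1 => i; rewrite -/(rowc i) (eq_bigr (fun k => cf i k *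
      chart_mon delta kap (T0^~ x) (u0^~ x) (rowc (f k)))) => [|k _]; last by rewrite -Tf.
  have [iC|iC] := boolP (i \in C); last first.
    by have [a [ka <-]] := unkept_ray iC; rewrite mon_unkept // T_mu.
  have /fC[k <-] := iC; rewrite (bigD1 k) //= cf2 eqxx mul1r big1 ?addr0 => [|k' /negbTE k'k].
    exact: Tf.
  by rewrite cf2 k'k mul0r.
move=> x i gx; rewrite /ys -{2}[i]enum_valK; case: (enum_val i) => a.
  rewrite (chart_mon_delta deltaE kapD) /T (valP a) /T0 insubT ?(valP a) // => h.
  by congr (x (enum_rank (inl _))); exact: val_inj.
exact: (chart_mon_w gav Ss delta perp_w kap_w).
Qed.

End GoodRows.

Lemma increasing_enumeration (k N : nat) (B : {set 'I_N}) : (k <= #|B|)%N ->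
  exists2 iota : 'I_k -> 'I_N, forall a b : 'I_k, (a < b)%N -> (iota a < iota b)%N
    & forall a, iota a \in B.
Proof.
move=> kB; exists (fun a => enum_val (widen_ord kB a)) => [a b ab|a]; last exact: enum_valP.
have N0 : 'I_N by exact: (enum_val (widen_ord kB a)).
have S : sorted (fun x y : 'I_N => x < y)%N (enum B).
  rewrite /enum_mem; apply: sorted_filter => [x y z|]; first exact: ltn_trans.
  by have := iota_ltn_sorted 0 N; rewrite -val_enum_ord sorted_map -enumT.
rewrite !(enum_val_nth N0).
apply: (sorted_ltn_nth (leT := fun x y : 'I_N => x < y)%N) => //=.
- by move=> x y z; exact: ltn_trans.
- by rewrite inE -cardE (leq_trans _ kB).
- by rewrite inE -cardE (leq_trans _ kB).
Qed.

Lemma card_superset (T : finType) (B : {set T}) (k : nat) : (#|B| <= k <= #|T|)%N ->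
  exists2 C : {set T}, B \subset C & #|C| = k.
Proof.
case/andP; elim: k => [|k IH] Bk kT.
  by exists B => //; apply/eqP; rewrite -leqn0.
have [E|ne] := eqVneq #|B| k.+1; first by exists B.
have [||C BC EC] := IH; [by rewrite -ltnS ltn_neqAle ne | exact: ltnW |].
have [x xC] : exists x, x \in ~: C.
  by apply/set0Pn; rewrite -card_gt0 cardsCs finset.setCK EC subn_gt0.
exists (x |: C); first exact: (fintype.subset_trans BC (finset.subsetUr _ _)).
by rewrite cardsU1 -finset.in_setC xC EC.
Qed.

(** More than [c.+1] bad rows would give an increasing sequence violating the star condition. The
    bad rows thus fit into a set [C] of exactly [c.+1] rows, whose entries are coordinates on the
    row space. *)
Theorem big_dual_basis_smooth : star_condition c l d sigma -> has_dual_basis v sigma ->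
  forall x, smooth_point (chart_ring (Y := X) (sigma := sigma)) x.
Proof.
move=> star; pose good i := `[< exists j : 'I_(n i),
  [/\ sigma (v_ij l d j), l j = 1%N & forall k, k != j -> ~ sigma (v_ij l d k)] >].
have Bc : (#|[set i | ~~ good i]%SET| <= c.+1)%N.
  rewrite leqNgt; apply/negP => /increasing_enumeration[iota incr iB].
  have [q [j hj]] := star iota incr; have := iB q; rewrite inE => /asboolP[]; by exists j.
have [|C BC EC] := @card_superset _ _ c.+1 (_ : #|[set i | ~~ good i]%SET| <= c.+1 <= #|'I_r.+1|)%N.
  by rewrite Bc card_ord ltnS; case/andP: (gav_cr gav).
have [f [finj fC]] := set_injection EC.
have [cf [cf1 cf2 _]] := rowspace_coords (gav_rank gav) finj.
apply: (good_rows_smooth _ fC cf1 cf2) => i iC; apply/asboolP; apply: contraNT iC => ng.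
by apply: (fintype.subsetP BC); rewrite inE.
Qed.

End BigConverse.

(** * Smooth pieces *)

Section SmoothPieces.
Variables (K : closedFieldType) (c r : nat) (n : 'I_r.+1 -> nat) (m s : nat).
Variables (A : 'M[K]_(c.+1, r.+1)) (l : forall i : 'I_r.+1, 'I_(n i) -> nat).
Variables (d : col_index n m -> 'cV[int]_s) (Sigma : set (set 'cV[rat]_(r + s))).
Hypothesis gav : explicit_gav A l d Sigma.
Let X := X_var A l d Sigma.
Variable sigma : set 'cV[rat]_(r + s).
Hypothesis Ss : Sigma sigma.

Lemma leaf_smoothP (x : affine_chart X sigma) : leaf_cone c l d sigma ->
  (forall u, dual_chars sigma u -> ~ perp_chars sigma u -> pchar_at (val x) u = 0) ->
  smooth_point (chart_ring (Y := X) (sigma := sigma)) x <-> has_dual_basis (P_col l d) sigma.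
Proof.
move=> [J [EJ hJ]] x0; have /andP[_ cr] := gav_cr gav.
have [i0 i0J] : exists i0, i0 \notin J.
  have [i|] := pickP [pred i | i \notin J]; first by exists i.
  move=> /(_ _)/negbFE JT; have : #|J| = r.+1 by rewrite -[RHS]card_ord; apply: eq_card.
  by move=> E; rewrite -EJ E ltnn in cr.
have EC : #|(i0 |: J)%SET| = c.+1 by rewrite cardsU1 i0J EJ.
have [f [finj fC']] := set_injection EC.
have fC i : (i \in J) || (i == i0) <-> exists k, f k = i.
  by rewrite -fC' in_setU1 orbC.
have [cf [cf1 cf2 cf3]] := rowspace_coords (gav_rank gav) finj.
have [k0 fk0] : exists k, f k = i0 by apply/fC; rewrite eqxx orbT.
split=> [sm|dual]; last exact: (leaf_dual_basis_smooth gav Ss hJ i0J fC cf1 cf2 dual).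
exact: (leaf_smooth_dual_basis gav Ss EJ hJ i0J finj fC fk0 cf1 cf2 cf3 x0 sm).
Qed.

Lemma big_smoothP (x : affine_chart X sigma) : big_cone l d sigma ->
  (forall u, dual_chars sigma u -> ~ perp_chars sigma u -> pchar_at (val x) u = 0) ->
  smooth_point (chart_ring (Y := X) (sigma := sigma)) x <->
  has_dual_basis (P_col l d) sigma /\ star_condition c l d sigma.
Proof.
move=> big x0; split=> [sm|[dual star]]; last exact: (big_dual_basis_smooth gav Ss star dual).
exact: (big_smooth gav Ss big x0 sm).
Qed.

(** Smoothness at a point of the piece is equivalent to a condition [P] that does not mention the
    point, and the piece is not empty. *)
Lemma piece_smooth_equiv (P : Prop) : big_cone l d sigma \/ leaf_cone c l d sigma ->
  (forall x : affine_chart X sigma,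
    (forall u, dual_chars sigma u -> ~ perp_chars sigma u -> pchar_at (val x) u = 0) ->
    smooth_point (chart_ring (Y := X) (sigma := sigma)) x <-> P) ->
  [<-> exists2 x, piece A l d Sigma sigma x & smooth_at X x;
       forall x, piece A l d Sigma sigma x -> smooth_at X x; P].
Proof.
move=> bl smP.
have equiv x : piece A l d Sigma sigma x -> smooth_at X x <-> P.
  by move=> px; have [y [_ -> /smP]] := piece_smoothP Ss px.
tfae => [[x px /(equiv x px) hP] y /equiv -> //|h|hP].
  by have [x px] := big_leaf_piece gav Ss bl; apply/(equiv x px)/h.
by have [x px] := big_leaf_piece gav Ss bl; exists x => //; apply/(equiv x px).
Qed.

End SmoothPieces.

Theorem corollary7p16 (K : closedFieldType) (charK0 : [pchar K] =i pred0)
    (c r : nat) (n : 'I_r.+1 -> nat) (m s : nat)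
    (A : 'M[K]_(c.+1, r.+1)) (l : forall i : 'I_r.+1, 'I_(n i) -> nat)
    (d : col_index n m -> 'cV[int]_s) (Sigma : set (set 'cV[rat]_(r + s))) :
  explicit_gav A l d Sigma ->
  (forall sigma : set 'cV[rat]_(r + s), Sigma sigma -> big_cone l d sigma ->
     [<-> exists2 x, piece A l d Sigma sigma x & smooth_at (X_var A l d Sigma) x;
          forall x, piece A l d Sigma sigma x -> smooth_at (X_var A l d Sigma) x;
          regular_cone sigma /\ star_condition c l d sigma;
          Q_full l d sigma /\ star_condition c l d sigma]) /\
  (forall sigma : set 'cV[rat]_(r + s), Sigma sigma -> leaf_cone c l d sigma ->
     [<-> exists2 x, piece A l d Sigma sigma x & smooth_at (X_var A l d Sigma) x;
          forall x, piece A l d Sigma sigma x -> smooth_at (X_var A l d Sigma) x;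
          regular_cone sigma;
          Q_full l d sigma]).
Proof.
move=> gav.
have regP sigma : Sigma sigma -> regular_cone sigma <-> has_dual_basis (P_col l d) sigma.
  exact: (regular_coneP (gav_fan gav) (gav_rays gav) (gav_inj gav) (gav_prim gav)).
have QP sigma : Q_full l d sigma <-> has_dual_basis (P_col l d) sigma := Qproj_fullP _ sigma.
split=> sigma Ss shape.
  have [ab [bc ca]] := piece_smooth_equiv gav Ss (or_introl shape)
    (fun x => big_smoothP gav Ss (x := x) shape).
  tfae=> //.
  - by move=> /bc[h st]; split=> //; apply/regP.
  - by move=> [/regP h st]; split=> //; apply/QP/h.
  - by move=> [h st]; apply: ca; split=> //; apply/QP.
have [ab [bc ca]] := piece_smooth_equiv gav Ss (or_intror shape)
  (fun x => leaf_smoothP gav Ss (x := x) shape).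
tfae=> //.
- by move=> /bc h; apply/regP.
- by move=> /regP h; apply/QP/h.
- by move=> /QP/ca.
Qed.
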